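(* Let $n\ge 1$, $m\ge 0$, $t\ge 1$ be integers and let $r_1,\dots,r_t>1$ be integers such that $r_{i+1}$ divides $r_i$ for $1\le i\le t-1$. Let $$G=\underbrace{\mathbb{Z}\stackrel{n}{*}\cdots\stackrel{n}{*}\mathbb{Z}}_{m\text{ copies}}\stackrel{n}{*}\mathbb{Z}_{r_1}\stackrel{n}{*}\cdots\stackrel{n}{*}\mathbb{Z}_{r_t}$$ be the $n$th nilpotent product of these $m+t$ cyclic groups. Suppose $\gcd(p,r_1)=1$ for all primes $p\le n$. Let $s\ge 1$, $c_1\ge n$ and $c_2,\dots,c_s\ge 1$ be integers. Then the polynilpotent multiplier of $G$ with class row $(c_1,c_2,\dots,c_s)$ satisfies $$\mathcal{N}_{c_1,c_2,\dots,c_s}M(G)\;\cong\;\mathbb{Z}^{(d_m)}\oplus\mathbb{Z}_{r_1}^{(d_{m+1}-d_m)}\oplus\cdots\oplus\mathbb{Z}_{r_t}^{(d_{m+t}-d_{m+t-1})},$$ where, for $m\le k\le m+t$, $$d_k=\chi_{c_s+1}\Bigl(\cdots\Bigl(\chi_{c_2+1}\Bigl(\sum_{i=1}^{n}\chi_{c_1+i}(k)\Bigr)\Bigr)\cdots\Bigr)$$ (for $s=1$ this reads $d_k=\sum_{i=1}^n\chi_{c_1+i}(k)$).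
   Context: Notation: $\mathbb{Z}_r$ is the cyclic group of order $r$, and $A^{(d)}$ denotes the direct sum of $d$ copies of an abelian group $A$. $\gamma_k(H)$ denotes the $k$th term of the lower central series of a group $H$ ($\gamma_1(H)=H$, $\gamma_{k+1}(H)=[\gamma_k(H),H]$), and $\gamma_{a}\circ\gamma_b(H)=\gamma_a(\gamma_b(H))$. The $n$th nilpotent product of a family of cyclic groups $\{G_i\}_{i\in I}$ is $P/\gamma_{n+1}(P)$, where $P$ is the free product of the $G_i$. For a group $G$ with a free presentation $G\cong F/R$ ($F$ free, $R$ normal in $F$), the polynilpotent multiplier of $G$ with class row $(c_1,\dots,c_s)$ (its Baer invariant with respect to the variety of polynilpotent groups of class row $(c_1,\dots,c_s)$) is the abelian group $$\mathcal{N}_{c_1,\dots,c_s}M(G)=\frac{R\cap\gamma_{c_s+1}\circ\cdots\circ\gamma_{c_1+1}(F)}{[R,\,{}_{c_1}F,\,{}_{c_2}\gamma_{c_1+1}(F),\dots,\,{}_{c_s}\gamma_{c_{s-1}+1}\circ\cdots\circ\gamma_{c_1+1}(F)]},$$ where commutators are left-normed and ${}_{c}H$ means that the subgroup $H$ is repeated $c$ times as an entry. Up to isomorphism it does not depend on the choice of free presentation. For integers $k\ge1$, $d\ge0$, $\chi_k(d)=\frac1k\sum_{e\mid k}\mu(e)\,d^{k/e}$, where $\mu$ is the Möbius function; this is the number of basic commutators of weight $k$ on $d$ letters (so $\chi_k(0)=0$). *)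

(* Defs.v *)
From HB Require Import structures.
From mathcomp Require Import all_boot all_order all_algebra.
From mathcomp Require Import boolp classical_sets.

Set Implicit Arguments.
Unset Strict Implicit.
Unset Printing Implicit Defensive.

Local Open Scope quotient_scope.
Local Open Scope classical_set_scope.
Local Open Scope group_scope.

(* Every subgroup occurring below (the kernel R of a presentation, the terms of
   the iterated lower central series, their intersections and commutators) is
   normal in the ambient group, so only normal subgroups are bundled. *)
Record nsubgroup (G : groupType) := NSubgroup {
  nsg_set :> set G;
  nsg1 : nsg_set 1;
  nsgM : forall x y, nsg_set x -> nsg_set y -> nsg_set (x * y);
  nsgV : forall x, nsg_set x -> nsg_set x^-1;
  nsgJ : forall x y, nsg_set x -> nsg_set (x ^ y)
}.

Definition isog (G H : groupType) : Prop :=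
  exists f : {multiplicative G -> H}, bijective f.

Section Quotient.
Context (G : groupType) (N : nsubgroup G).
Implicit Types x y z : G.

Definition coset_eq x y : bool := `[< nsg_set N (x^-1 * y) >].

Lemma coset_eq_refl : reflexive coset_eq.
Proof. by move=> x; apply/asboolP; rewrite mulVg; apply: nsg1. Qed.

Lemma coset_eq_sym : symmetric coset_eq.
Proof.
by move=> x y; apply/asboolP/asboolP => /nsgV; rewrite invgM invgK.
Qed.

Lemma coset_eq_trans : transitive coset_eq.
Proof.
move=> y x z /asboolP xy /asboolP yz; apply/asboolP.
by have := nsgM xy yz; rewrite mulgA mulgK.
Qed.

Canonical coset_equiv :=
  EquivRel coset_eq coset_eq_refl coset_eq_sym coset_eq_trans.

Definition quotg := {eq_quot coset_equiv}.
HB.instance Definition _ := Choice.on quotg.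
HB.instance Definition _ := EqQuotient.on quotg.

Definition cosetg (x : G) : quotg := \pi_quotg x.

Lemma cosetgP x y : (cosetg x = cosetg y) <-> nsg_set N (x^-1 * y).
Proof.
split; last by move=> h; apply/eqquotP/asboolP.
by move/eqquotP/asboolP.
Qed.

Lemma cosetg_surj (q : quotg) : exists x, q = cosetg x.
Proof. by exists (repr q); rewrite /cosetg reprK. Qed.

Definition quotg_mul (p q : quotg) : quotg := cosetg (repr p * repr q).
Definition quotg_inv (p : quotg) : quotg := cosetg (repr p)^-1.

Lemma cosetg_repr x : nsg_set N (x^-1 * repr (cosetg x)).
Proof. by apply/cosetgP; rewrite /cosetg reprK. Qed.

Lemma cosetgM x y : quotg_mul (cosetg x) (cosetg y) = cosetg (x * y).
Proof.
apply/esym/cosetgP.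
have := nsgM (nsgJ y (cosetg_repr x)) (cosetg_repr y).
by rewrite /conjg invgM !mulgA mulgK.
Qed.

Lemma cosetgV x : quotg_inv (cosetg x) = cosetg x^-1.
Proof.
apply/cosetgP; rewrite invgK.
have := nsgJ x^-1 (cosetg_repr x).
by rewrite /conjg invgK !mulgA mulgV mul1g.
Qed.

Lemma quotg_mulA : associative quotg_mul.
Proof.
move=> p q r; have [[x ->] [y ->] [z ->]] := And3 (cosetg_surj p)
  (cosetg_surj q) (cosetg_surj r).
by rewrite !cosetgM mulgA.
Qed.

Lemma quotg_mul1 : left_id (cosetg 1) quotg_mul.
Proof. by move=> p; have [x ->] := cosetg_surj p; rewrite cosetgM mul1g. Qed.

Lemma quotg_mulr1 : right_id (cosetg 1) quotg_mul.
Proof. by move=> p; have [x ->] := cosetg_surj p; rewrite cosetgM mulg1. Qed.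

Lemma quotg_mulV : left_inverse (cosetg 1) quotg_inv quotg_mul.
Proof.
by move=> p; have [x ->] := cosetg_surj p; rewrite cosetgV cosetgM mulVg.
Qed.

Lemma quotg_mulrV : right_inverse (cosetg 1) quotg_inv quotg_mul.
Proof.
by move=> p; have [x ->] := cosetg_surj p; rewrite cosetgV cosetgM mulgV.
Qed.

HB.instance Definition _ := isGroup.Build quotg
  quotg_mulA quotg_mul1 quotg_mulr1 quotg_mulV quotg_mulrV.

End Quotient.

Section NormalSubgroups.
Context (G : groupType).
Implicit Types (A : set G) (H K : nsubgroup G).

Definition nsgT : nsubgroup G :=
  @NSubgroup G setT I (fun _ _ _ _ => I) (fun _ _ => I) (fun _ _ _ => I).

Definition nsgI H K : nsubgroup G.
Proof.
exists (H `&` K).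
- by split; apply: nsg1.
- by move=> x y [? ?] [? ?]; split; apply: nsgM.
- by move=> x [? ?]; split; apply: nsgV.
- by move=> x y [? ?]; split; apply: nsgJ.
Defined.

Inductive generated A : set G :=
| gen_mem x of A x : generated A x
| gen_one : generated A 1
| gen_mul x y of generated A x & generated A y : generated A (x * y)
| gen_inv x of generated A x : generated A x^-1.

Definition commutators (A B : set G) : set G :=
  [set z | exists2 x, A x & exists2 y, B y & z = [~ x, y]].

Lemma nsgR_J H K x y :
  generated (commutators H K) x -> generated (commutators H K) (x ^ y).
Proof.
elim=> {x} [_ [a Ha [b Kb ->]]||u v _ hu _ hv|u _ hu].
- rewrite conjRg; apply: gen_mem; exists (a ^ y); first exact: nsgJ.
  by exists (b ^ y) => //; apply: nsgJ.
- by rewrite conj1g; apply: gen_one.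
- by rewrite conjMg; apply: gen_mul.
- by rewrite conjVg; apply: gen_inv.
Qed.

Definition nsgR H K : nsubgroup G :=
  @NSubgroup G (generated (commutators H K)) (gen_one _)
    (fun x y => @gen_mul _ x y) (fun x => @gen_inv _ x)
    (fun x y => @nsgR_J H K x y).

(* [H, K, ..., K] with K repeated c times *)
Definition nsgRn (c : nat) K H : nsubgroup G := iter c (nsgR^~ K) H.

(* indexed from 1, as usual: gamma 1 H = H and gamma k.+1 H = [gamma k H, H]
   for 1 <= k; the value of gamma 0 is irrelevant *)
Definition gamma (k : nat) H : nsubgroup G := nsgRn k.-1 H H.

(* the term gamma_(c_s + 1) (... (gamma_(c_1 + 1) G)) for cs = [:: c_1; ...; c_s] *)
Definition poly_gamma (cs : seq nat) : nsubgroup G :=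
  foldl (fun H c => gamma c.+1 H) nsgT cs.

Fixpoint poly_comm_rec (H D : nsubgroup G) (cs : seq nat) : nsubgroup G :=
  if cs is c :: cs' then poly_comm_rec (gamma c.+1 H) (nsgRn c H D) cs' else D.

(* [R, _(c_1) G, _(c_2) gamma_(c_1+1)(G), ...,
    _(c_s) gamma_(c_(s-1)+1) o ... o gamma_(c_1+1) (G)] *)
Definition poly_comm (R : nsubgroup G) (cs : seq nat) : nsubgroup G :=
  poly_comm_rec nsgT R cs.

Lemma nsgR_subl H K : nsgR H K `<=` H.
Proof.
move=> x; elim=> {x} [_ [a Ha [b _ ->]]||u v _ hu _ hv|u _ hu].
- by rewrite commgEl; apply: nsgM; [apply: nsgV|apply: nsgJ].
- exact: nsg1.
- exact: nsgM.
- exact: nsgV.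
Qed.

Lemma nsgRS H H' K : H `<=` H' -> nsgR H K `<=` nsgR H' K.
Proof.
move=> sHH' x; elim=> {x} [_ [a Ha [b Kb ->]]||u v _ hu _ hv|u _ hu].
- by apply: gen_mem; exists a; [apply: sHH'|exists b].
- exact: gen_one.
- exact: gen_mul.
- exact: gen_inv.
Qed.

Lemma poly_comm_sub (R : nsubgroup G) cs :
  poly_comm R cs `<=` nsgI R (poly_gamma cs).
Proof.
rewrite /poly_comm /poly_gamma.
suff sub (D H : nsubgroup G) : D `<=` R -> D `<=` H ->
    poly_comm_rec H D cs `<=` R `&` foldl (fun H c => gamma c.+1 H) H cs.
  exact: sub.
elim: cs D H => [|c cs IH] D H DR DH /=.
  by move=> x Dx; split; [apply: DR|apply: DH].
apply: IH; first by elim: c => [|c IHc] //=; apply: subset_trans IHc;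
  apply: nsgR_subl.
by rewrite /gamma /=; elim: c => [|c IHc] //=; apply: nsgRS.
Qed.

End NormalSubgroups.

Section SubQuotient.
Context (G : groupType) (A B : nsubgroup G).

Definition sgpred : pred G := fun x => x \in nsg_set A.

Definition sgtype := {x : G | sgpred x}.
HB.instance Definition _ := SubChoice.on sgtype.

Lemma sgpred_closed : group_closed sgpred.
Proof.
split; first by apply/mem_set/nsg1.
move=> x y /set_mem Ax /set_mem Ay.
by apply/mem_set/nsgM => //; apply: nsgV.
Qed.

HB.instance Definition _ :=
  SubChoice_isSubGroup.Build G sgpred sgtype sgpred_closed.

Definition nsg_restr : nsubgroup sgtype.
Proof.
exists (fun x : sgtype => nsg_set B (val x)).
- by rewrite gmulf1; apply: nsg1.
- by move=> x y; rewrite gmulfM; apply: nsgM.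
- by move=> x; rewrite gmulfV; apply: nsgV.
- by move=> x y; rewrite /conjg !gmulfM gmulfV; apply: nsgJ.
Defined.

(* A / B; meant for B contained in A *)
Definition subquotg : groupType := quotg nsg_restr.

End SubQuotient.

(* For F free and R the kernel of a presentation of G = F / R. The denominator
   is contained in the numerator by poly_comm_sub. *)
Definition polynilpotent_multiplier (F : groupType) (R : nsubgroup F)
    (cs : seq nat) : groupType :=
  subquotg (nsgI R (poly_gamma F cs)) (poly_comm R cs).

Definition is_free_basis (F : groupType) (X : Type) (b : X -> F) : Prop :=
  forall (H : groupType) (f : X -> H),
    exists g : {multiplicative F -> H}, (forall x, g (b x) = f x) /\
      forall g' : {multiplicative F -> H}, (forall x, g' (b x) = f x) -> g' =1 g.

Definition is_free_product (I : Type) (C : I -> groupType) (P : groupType)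
    (inj : forall i, {multiplicative C i -> P}) : Prop :=
  forall (H : groupType) (f : forall i, {multiplicative C i -> H}),
    exists g : {multiplicative P -> H}, (forall i x, g (inj i x) = f i x) /\
      forall g' : {multiplicative P -> H},
        (forall i x, g' (inj i x) = f i x) -> g' =1 g.

(* the n-th nilpotent product of a family with free product P *)
Definition nilpotent_product (n : nat) (P : groupType) : groupType :=
  quotg (gamma n.+1 (nsgT P)).

Definition Zgroup : groupType := Algebra.to_multiplicative int.

(* 'Z_r is cyclic of order r only for 1 < r *)
Definition Zmodgroup (r : nat) : groupType := Algebra.to_multiplicative 'Z_r.

Definition cyclic_family (m t : nat) (r : nat -> nat) (i : 'I_m + 'I_t) :
    groupType :=
  match i with inl _ => Zgroup | inr j => Zmodgroup (r j.+1) end.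

Definition dpower (A : groupType) (d : nat) : groupType := {ffun 'I_d -> A}.

Definition dsum (A B : groupType) : groupType := (A * B)%type.

Definition moebius (e : nat) : int :=
  if all (fun p => logn p e == 1%N) (primes e)
  then ((-1) ^+ size (primes e))%R else 0%R.

(* The quotient is exact and nonnegative for 0 < k, so neither the Euclidean
   division nor the absolute value alters the usual (Witt) formula. *)
Definition chi (k d : nat) : nat :=
  absz ((\sum_(e <- divisors k) moebius e * (d ^ (k %/ e))%N%:Z)%R %/ k%:Z)%Z.

(* d_k for class row (c1, cs) *)
Definition mult_rank (n c1 : nat) (cs : seq nat) (k : nat) : nat :=
  foldl (fun x c => chi c.+1 x) (\sum_(1 <= i < n.+1) chi (c1 + i) k)%N cs.

(* Z^(d_m) + Z_(r_1)^(d_(m+1) - d_m) + ... + Z_(r_t)^(d_(m+t) - d_(m+t-1)) *)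
Definition target_group (m t : nat) (r d : nat -> nat) : groupType :=
  foldl dsum (dpower Zgroup (d m))
    [seq dpower (Zmodgroup (r i)) (d (m + i) - d (m + i).-1)%N | i <- iota 1 t].

(* Main.v *)
(* Write G = F/R, let H be a term of the iterated lower central series of F and
   D the corresponding denominator. If H/D is an n-th nilpotent product of
   cyclic groups of orders o_j (o_j = 0 for Z) and c >= n, then
   gamma_(c+1)(H)/[D, H, ..., H] is the direct sum of the groups Z/o(w), where w
   runs over the Lyndon words with c < |w| <= c + n and o(w) is the gcd of the
   orders of the letters of w. Being abelian, this is again such an H/D with
   n = 1, so the theorem follows by iteration; Lyndon words are counted by chi.

   Upper bound: bracketed Lyndon words generate gamma_l(H) modulo
   gamma_(l+1)(H)[D, H, ..., H], and w has exponent o(w) there.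

   Lower bound: sending the j-th generator to 1 + X_j maps H/D to power series
   with constant term 1, modulo degree > n and modulo o(v) at each word v; the
   hypothesis on the primes p <= n makes (1 + X_j)^(o_j) trivial there. As H is
   projective, this lifts to H -> 1 + (X). The coefficients at Lyndon words of
   degree in (c, c + n] are additive on gamma_(c+1)(H), vanish on [D, H, ..., H],
   and are unitriangular on the bracketed Lyndon words. *)

From HB Require Import structures.
Require Import Defs.
From mathcomp Require Import all_boot all_order all_algebra.
From mathcomp Require Import boolp classical_sets.
From mathcomp Require Import zify ring.

(** The truncated series see H/D only up to degree n, while the invariants of
    gamma_(c+1)(H)/[D, H, ..., H] sit in degrees c+1 to c+n; hence the lift to untruncated integral
    series. The lift is not canonical, but on D its values are congruent to 1 up to degree n, and
    each commutator with H raises this degree by one, so [D, H, ..., H] is congruent to 1 up to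
    degree c+n. Additivity comes from n <= c: elements of gamma_(c+1)(H) are 1 plus terms of degree
    at least c+1, so cross terms start in degree 2c+2, beyond c+n. The inequality n <= c_1 also puts
    gamma_(c_1+1)(F) inside R, as F/R has class at most n, so the intersection in the numerator of
    the multiplier is no restriction.

    Give Z level 0 and Z_(r_i) level i. Along the chain r_(i+1) | r_i, the gcd o(w) is the order
    attached to the highest level of a letter of w. The words of level at most i are the words in
    the letters of level at most i, so d_(m+i) is a cumulative count, to which chi applies at each
    iteration, and the exponents in the answer are its differences. *)

Set Implicit Arguments.
Unset Strict Implicit.
Unset Printing Implicit Defensive.

(** * Lyndon words *)

Section Words.
Implicit Types (a b s t u v w : seq nat).

Lemma take_neq0 i w : 0 < i -> w != [::] -> take i w != [::].
Proof. by case: i w => [|i] [|x w]. Qed.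

Lemma drop_neq0 i w : i < size w -> drop i w != [::].
Proof. by move=> iw; rewrite -size_eq0 size_drop subn_eq0 -ltnNge. Qed.

Fixpoint ltw s t : bool :=
  match s, t with
  | _, [::] => false
  | [::], _ :: _ => true
  | x :: s', y :: t' => (x < y) || ((x == y) && ltw s' t')
  end.

Lemma ltw_irr s : ltw s s = false.
Proof. by elim: s => [|x s IH] //=; rewrite ltnn eqxx. Qed.

Lemma ltw_trans : transitive ltw.
Proof.
move=> t s u; elim: s t u => [|x s IH] [|y t] [|z u] //=.
case/orP => [xy|/andP [/eqP -> st]]; case/orP => [yz|/andP [/eqP zz tu]].
- by rewrite (ltn_trans xy yz).
- by rewrite -zz xy.
- by rewrite yz.
- by rewrite zz eqxx (IH _ _ st tu) orbT.
Qed.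

Lemma ltw_total s t : s != t -> ~~ ltw s t -> ltw t s.
Proof.
elim: s t => [|x s IH] [|y t] //=; rewrite eqseq_cons.
by case: (ltngtP x y) => //= _; exact: IH.
Qed.

Lemma ltw_nltw_trans s t u : ltw s t -> ~~ ltw u t -> ltw s u.
Proof.
case: (eqVneq u t) => [->|ut] // st nut.
exact: ltw_trans st (ltw_total ut nut).
Qed.

Lemma nltw_trans s t u : ~~ ltw t s -> ~~ ltw u t -> ~~ ltw u s.
Proof. by move=> ts; apply: contra => us; apply: ltw_nltw_trans us ts. Qed.

Lemma ltwW s t : ltw s t -> ~~ ltw t s.
Proof. by move=> st; apply/negP => /(ltw_trans st); rewrite ltw_irr. Qed.

Lemma ltw_neq s t : ltw s t -> s != t.
Proof. by apply: contraTneq => ->; rewrite ltw_irr. Qed.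

Lemma ltw_cat2l u s t : ltw (u ++ s) (u ++ t) = ltw s t.
Proof. by elim: u => //= x u ->; rewrite ltnn eqxx. Qed.

Lemma ltw_cat s t a b : size s = size t ->
  ltw (s ++ a) (t ++ b) = ltw s t || (s == t) && ltw a b.
Proof.
elim: s t => [|x s IH] [|y t] //= [/IH ->].
by rewrite eqseq_cons; case: (ltngtP x y).
Qed.

Lemma ltw_self_cat u a : a != [::] -> ltw u (u ++ a).
Proof. by rewrite -{1}[u]cats0 ltw_cat2l; case: a. Qed.

Lemma ltw_catr s t a b : ltw s t -> ~~ prefix s t -> ltw (s ++ a) (t ++ b).
Proof.
elim: s t => [|x s IH] [|y t] //=.
case: (ltngtP x y) => //= _; exact: IH.
Qed.

Lemma ltw_cat_l s t a : ltw s t -> ltw s (t ++ a).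
Proof.
move=> st; case: (eqVneq a [::]) => [->|a0]; first by rewrite cats0.
exact: ltw_trans st (ltw_self_cat _ a0).
Qed.

Lemma ltw_size_prefix s t : size t <= size s -> ltw s t -> ~~ prefix s t.
Proof.
move=> ts st; apply/negP => /prefixP [a tE]; move: ts st; rewrite tE size_cat.
case: a {tE} => [|x a] /=; first by rewrite cats0 ltw_irr.
by lia.
Qed.

Definition lyndon w :=
  (w != [::]) && all (fun i => ltw w (drop i w)) (iota 1 (size w).-1).

Lemma lyndonP w : reflect
  (w != [::] /\ forall u v, u != [::] -> v != [::] -> w = u ++ v -> ltw w v)
  (lyndon w).
Proof.
apply: (iffP andP) => [[w0 /allP lw]|[w0 lw]]; split=> //.
- move=> u v u0 v0 wE.
  have := lw (size u); rewrite mem_iota wE drop_size_cat // size_cat -wE.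
  by apply; case: u v u0 v0 {wE} => [|x u] [|y v] //= _ _; lia.
- apply/allP => i; rewrite mem_iota => hi.
  have sw : 0 < size w by rewrite lt0n size_eq0.
  apply: (lw (take i w)); last by rewrite cat_take_drop.
  + by apply: take_neq0 => //; case/andP: hi.
  + by apply: drop_neq0; move: hi sw; lia.
Qed.

Lemma lyndon_neq0 w : lyndon w -> w != [::].
Proof. by case/andP. Qed.

Lemma lyndon_suffix u v : lyndon (u ++ v) -> u != [::] -> v != [::] ->
  ltw (u ++ v) v.
Proof. by move=> /lyndonP [_ h] u0 v0; apply: (h u v). Qed.

Lemma lyndon1 x : lyndon [:: x].
Proof. by []. Qed.

Lemma lyndon_rot u v : lyndon (u ++ v) -> u != [::] -> v != [::] ->
  ltw (u ++ v) (v ++ u).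
Proof. by move=> L u0 v0; apply/ltw_cat_l/lyndon_suffix. Qed.

(** First uv < v: this is decided at a letter unless v = uy, and then v < y because v is Lyndon.
    Proper suffixes of v exceed v. A suffix sv with s a proper suffix of u exceeds uv because u < s
    is decided at a letter, s being shorter than u. *)
Lemma lyndon_cat u v : lyndon u -> lyndon v -> ltw u v -> lyndon (u ++ v).
Proof.
move=> Lu Lv uv.
have u0 := lyndon_neq0 Lu; have v0 := lyndon_neq0 Lv.
have uvv : ltw (u ++ v) v.
  have [/prefixP [y vE]|np] := boolP (prefix u v); last first.
    by rewrite -[X in ltw _ X]cats0; apply: ltw_catr.
  rewrite {2}vE ltw_cat2l.
  have y0 : y != [::] by apply: contraTneq uv; rewrite vE => ->; rewrite cats0 ltw_irr.
  by rewrite {1}vE; apply: lyndon_suffix; rewrite -?vE.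
apply/lyndonP; split; first by case: (u) u0.
move=> a b a0 b0 E.
have [ua|au] := leqP (size u) (size a).
  have aE : a = u ++ drop (size u) a.
    have : take (size u) (u ++ v) = take (size u) (a ++ b) by rewrite E.
    rewrite take_size_cat // takel_cat // => {1}->; by rewrite cat_take_drop.
  move: E; rewrite aE -catA => /eqP; rewrite eqseq_cat // eqxx /= => /eqP vE.
  case: (eqVneq (drop (size u) a) [::]) => [d0|d0].
    by move: vE; rewrite d0 /= => <-.
  rewrite vE in Lv.
  by apply: ltw_trans uvv _; rewrite vE; apply: lyndon_suffix.
have uE : u = a ++ drop (size a) u.
  have : take (size a) (u ++ v) = take (size a) (a ++ b) by rewrite E.
  by rewrite takel_cat 1?ltnW // take_size_cat // => {1}<-; rewrite cat_take_drop.
have d0 : drop (size a) u != [::] by apply: drop_neq0.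
move: E; rewrite {1}uE -catA => /eqP; rewrite eqseq_cat // eqxx /= => /eqP bE.
rewrite -bE; apply: ltw_catr; first by rewrite {1}uE; apply: lyndon_suffix; rewrite -?uE.
apply: ltw_size_prefix; first by rewrite size_drop; lia.
by rewrite {1}uE; apply: lyndon_suffix; rewrite -?uE.
Qed.

(* v is the least proper suffix of u ++ v: for a Lyndon word, this is its
   standard factorization. *)
Definition is_std u v := forall a s, a != [::] -> s != [::] -> u ++ v = a ++ s ->
  ~~ ltw s v.

Lemma lyndon_stdr u v : lyndon (u ++ v) -> u != [::] -> v != [::] ->
  is_std u v -> lyndon v.
Proof.
move=> L u0 v0 S; apply/lyndonP; split=> // a b a0 b0 vE.
apply: ltw_total; first apply/eqP => /(congr1 size).
  by rewrite vE size_cat; case: (a) a0 => //= *; lia.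
by apply: (S (u ++ a)) => //; [case: (u) u0 | rewrite -catA vE].
Qed.

(** A proper suffix s < u would have to be a prefix of u, since uv < sv. With u = sy, cancelling s
    leaves yv < v, against the minimality of v. *)
Lemma lyndon_stdl u v : lyndon (u ++ v) -> u != [::] -> v != [::] ->
  is_std u v -> lyndon u.
Proof.
move=> L u0 v0 S; apply/lyndonP; split=> // a s a0 s0 uE.
apply: contraT => nus.
have us : u != s by apply/eqP => /(congr1 size); rewrite uE size_cat; case: (a) a0 => //= *; lia.
have su : ltw s u by apply: ltw_total.
have sv : ltw (u ++ v) (s ++ v).
  by rewrite {1}uE -catA; apply: lyndon_suffix; rewrite ?catA -?uE //; case: (s) s0.
have [/prefixP [y yE]|np] := boolP (prefix s u); last first.
  by move: (ltw_catr v v su np) => /ltwW; rewrite sv.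
move: sv; rewrite yE -catA ltw_cat2l => yv.
suff : ~~ ltw (y ++ v) v by rewrite yv.
apply: (S s) => //; last by rewrite yE catA.
by case: (y) v0 => //.
Qed.

Lemma lyndon_std_lt u v : lyndon (u ++ v) -> u != [::] -> v != [::] -> ltw u v.
Proof.
move=> L u0 v0; have := lyndon_suffix L u0 v0.
by apply: ltw_trans; apply: ltw_self_cat.
Qed.

(** A proper suffix longer than v is s'v with s' a proper suffix of u1 u2, so s' >= u2 >= v. This is
    the case of [lyndon_commutator] in which the bracket needs no rewriting. *)
Lemma is_std_cat u1 u2 v : is_std u1 u2 -> ~~ ltw u2 v -> lyndon v ->
  u2 != [::] -> is_std (u1 ++ u2) v.
Proof.
move=> S u2v Lv u20 a s a0 s0 E.
have v0 := lyndon_neq0 Lv.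
have [vs|sv] := leqP (size s) (size v).
  have sE : s = drop (size v - size s) v.
    have := congr1 (drop (size a)) E; rewrite [RHS]drop_size_cat // => {1}<-.
    have sz := congr1 size E; rewrite !size_cat in sz.
    by rewrite drop_cat !size_cat; case: ltnP => ?; [exfalso; lia|congr drop; lia].
  case: (eqVneq (take (size v - size s) v) [::]) => [t0|t0].
    have := cat_take_drop (size v - size s) v; rewrite t0 -sE /= => ->.
    by rewrite ltw_irr.
  apply: ltwW; have := cat_take_drop (size v - size s) v; rewrite -sE => vE.
  by rewrite -{1}vE; apply: lyndon_suffix; rewrite ?vE.
have sz := congr1 size E; rewrite !size_cat in sz.
have sE : s = drop (size a) (u1 ++ u2) ++ v.
  have := congr1 (drop (size a)) E; rewrite [RHS]drop_size_cat // => {1}<-.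
  by rewrite drop_cat !size_cat; case: ltnP => // ?; exfalso; lia.
set s' := drop _ _ in sE.
have s'0 : s' != [::] by apply: drop_neq0; rewrite size_cat; lia.
have : ~~ ltw s' u2.
  apply: (S (take (size a) (u1 ++ u2))) => //; last by rewrite cat_take_drop.
  apply: take_neq0; first by rewrite lt0n size_eq0.
  by rewrite -size_eq0 size_cat; case: (u2) u20 => //= *; lia.
rewrite sE => s'u2; apply: nltw_trans u2v _ => //.
have -> : ~~ ltw (s' ++ v) u2.
  by apply: contra s'u2; apply: ltw_trans; apply: ltw_self_cat.
by [].
Qed.

Lemma is_std_letter x v : lyndon v -> is_std [:: x] v.
Proof.
move=> Lv [|y a] s //= _ s0 [_ E].
case: (eqVneq a [::]) E => [-> /= <-|a0 E]; first by rewrite ltw_irr.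
by apply: ltwW; rewrite E; apply: lyndon_suffix; rewrite -?E.
Qed.

(* One less than the length of the left factor. *)
Definition stdi w := find (fun i => all (fun j => ~~ ltw (drop j w) (drop i w))
   (iota 1 (size w).-1)) (iota 1 (size w).-1).

Lemma min_word (S : seq nat) (f : nat -> seq nat) : S != [::] ->
  has (fun i => all (fun j => ~~ ltw (f j) (f i)) S) S.
Proof.
elim: S => // x S IH _.
case: (eqVneq S [::]) => [->|/IH /hasP [i iS /allP im]] /=.
  by rewrite ltw_irr.
have [xi|xi] := boolP (ltw (f x) (f i)).
  apply/orP; left; rewrite ltw_irr /=.
  by apply/allP => j /im ij; apply: contra ij => jx; apply: ltw_trans jx xi.
apply/orP; right; apply/hasP; exists i => //.
by rewrite /= xi; apply/allP.
Qed.

Lemma stdiP w : 1 < size w -> exists u v,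
  [/\ w = u ++ v, u != [::], v != [::], (stdi w).+1 = size u & is_std u v].
Proof.
move=> sw; set i := (stdi w).+1.
have I0 : iota 1 (size w).-1 != [::] by case: (w) sw => [|? []].
have H := min_word (fun i => drop i w) I0.
have lt := H; rewrite has_find size_iota -/(stdi w) in lt.
have := nth_find 0 H; rewrite -/(stdi w) nth_iota // add1n -/i => /allP im.
exists (take i w), (drop i w); split.
- by rewrite cat_take_drop.
- by apply: take_neq0; rewrite -?size_eq0 //; move: sw; case: (size w).
- by apply: drop_neq0; move: lt sw; rewrite /i; lia.
- by rewrite size_take; case: ifP; lia.
move=> a s a0 s0; rewrite cat_take_drop => E.
have := im (size a); rewrite E drop_size_cat // -E; apply.
rewrite mem_iota E size_cat; by case: (a) (s) a0 s0 => [|? ?] [|? ?] //= _ _; lia.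
Qed.

(** Two least proper suffixes are equal, so [is_std] alone determines the cut computed by [stdi]. *)
Lemma stdi_uniq u v : u != [::] -> v != [::] -> is_std u v ->
  (stdi (u ++ v)).+1 = size u.
Proof.
move=> u0 v0 S.
have [|u' [v' [E u'0 v'0 -> S']]] := @stdiP (u ++ v).
  by rewrite size_cat; case: (u) (v) u0 v0 => [|? ?] [|? ?] //= _ _; lia.
have h1 := S _ _ u'0 v'0 E; have h2 := S' _ _ u0 v0 (esym E).
have vv : v = v'.
  by apply/eqP; apply: contraT => /ltw_total -/(_ h2); rewrite (negbTE h1).
by have := congr1 size E; rewrite !size_cat vv; lia.
Qed.

End Words.

(** * Powers and rotations of words *)

Section WordPowers.
Implicit Types (s t u v w z : seq nat).

Definition wpow q u := flatten (nseq q u).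

Lemma wpowS q u : wpow q.+1 u = u ++ wpow q u.
Proof. by []. Qed.

Lemma size_wpow q u : size (wpow q u) = (q * size u)%N.
Proof. by elim: q => // q IH; rewrite wpowS size_cat IH mulSn. Qed.

Lemma cat_wpow q u : u ++ wpow q u = wpow q u ++ u.
Proof. by elim: q => [|q IH]; rewrite ?cats0 // !wpowS {1}IH catA. Qed.

Lemma wpow_rot_cat q u v : wpow q (u ++ v) ++ u = u ++ wpow q (v ++ u).
Proof. by elim: q => [|q IH]; rewrite ?cats0 // !wpowS -!catA IH. Qed.

Lemma rot_wpow_small q i u : i <= size u -> rot i (wpow q u) = wpow q (rot i u).
Proof.
case: q => [|q]; first by rewrite /rot.
move=> iu; rewrite /rot.
rewrite wpowS takel_cat // drop_cat ltn_neqAle iu andbT.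
case: eqP => [->|_].
  by rewrite subnn drop0 drop_size take_size -cat_wpow.
have := wpow_rot_cat q (take i u) (drop i u); rewrite cat_take_drop => E.
by rewrite wpowS -!catA E.
Qed.

Lemma rot_wpow_size q u : rot (size u) (wpow q u) = wpow q u.
Proof. by rewrite rot_wpow_small // rot_size. Qed.

Lemma rot_wpow q i u : i <= size (wpow q u) -> exists2 j,
  j < maxn 1 (size u) & rot i (wpow q u) = wpow q (rot j u).
Proof.
elim/ltn_ind: i => i IH iq.
have [iu|ui] := ltnP i (size u).
  by exists i; [rewrite leq_max iu orbT | rewrite rot_wpow_small // ltnW].
case: (posnP (size u)) => [u0|u0].
  by exists 0%N; rewrite ?u0 // (size0nil u0) /wpow /rot; elim: q {IH iq} => // q /= ->.
have [||j ju E] := IH (i - size u)%N; [lia|lia|].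
exists j => //; rewrite -E.
rewrite -{1}(subnK ui) rotD; last by lia.
by rewrite rot_wpow_size.
Qed.

Lemma ltw_wpow q s t : size s = size t -> ltw s t -> ltw (wpow q.+1 s) (wpow q.+1 t).
Proof. by move=> st lt; rewrite !wpowS ltw_cat // lt. Qed.

Lemma wpow_inj q s t : size s = size t -> wpow q.+1 s = wpow q.+1 t -> s = t.
Proof. by move=> st /eqP; rewrite !wpowS eqseq_cat // => /andP [/eqP]. Qed.

Lemma lyndon_rot_le u i : lyndon u -> ~~ ltw (rot i u) u.
Proof.
move=> Lu; have [iu|iu] := ltnP i (size u); last by rewrite rot_oversize ?ltw_irr.
case: (posnP i) => [->|i0]; first by rewrite rot0 ltw_irr.
apply: ltwW; rewrite -{1}(cat_take_drop i u); apply: lyndon_rot.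
- by rewrite cat_take_drop.
- exact: take_neq0 (lyndon_neq0 Lu).
- exact: drop_neq0.
Qed.

Lemma lyndon_rot_neq u i : lyndon u -> 0 < i < size u -> rot i u != u.
Proof.
move=> Lu /andP [i0 iu]; rewrite eq_sym; apply: ltw_neq.
rewrite -{1}(cat_take_drop i u); apply: lyndon_rot.
- by rewrite cat_take_drop.
- exact: take_neq0 (lyndon_neq0 Lu).
- exact: drop_neq0.
Qed.

Lemma lyndon_wpow_min q u k : lyndon u -> k <= size (wpow q.+1 u) ->
  ~~ ltw (rot k (wpow q.+1 u)) (wpow q.+1 u).
Proof.
move=> Lu /rot_wpow [j _ ->].
case: (eqVneq (rot j u) u) => [->|ne]; first by rewrite ltw_irr.
apply/ltwW/ltw_wpow; first by rewrite size_rot.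
by apply: ltw_total; rewrite // lyndon_rot_le.
Qed.

(** A border would exceed u as a proper suffix and precede u as a proper prefix. *)
Lemma lyndon_border u i : lyndon u -> 0 < i < size u ->
  drop i u != take (size u - i) u.
Proof.
move=> Lu /andP [i0 iu]; apply/eqP => E.
have : ltw u (drop i u).
  rewrite -{1}(cat_take_drop i u); apply: lyndon_suffix.
  - by rewrite cat_take_drop.
  - exact: take_neq0 (lyndon_neq0 Lu).
  - exact: drop_neq0.
rewrite E => /ltwW; rewrite -[X in ltw _ X](cat_take_drop (size u - i) u) ltw_self_cat //.
by apply: drop_neq0; lia.
Qed.

Lemma wpow_drop q u : drop (size u) (wpow q u) = take (size (wpow q u) - size u) (wpow q u).
Proof.
case: q => [|q] //; rewrite {1}wpowS drop_size_cat // size_wpow mulSn addKn.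
by rewrite wpowS cat_wpow take_size_cat ?size_wpow.
Qed.

(** If u were shorter than v, the prefix v of the common power would inherit the period |u| and
    hence have a border. *)
Lemma lyndon_root_size u v q r : lyndon v -> 0 < size u -> wpow q.+1 u = wpow r.+1 v ->
  size v <= size u.
Proof.
move=> Lv u0 E; rewrite leqNgt; apply/negP => uv.
have := lyndon_border Lv (i := size u); rewrite u0 uv => /(_ isT) /negP; apply.
have vE : v = take (size v) (wpow q.+1 u) by rewrite E wpowS take_size_cat.
apply/eqP; rewrite [X in _ = take _ X]vE take_takel; last by lia.
have -> : drop (size u) v = take (size v - size u) (drop (size u) (wpow q.+1 u)).
  by rewrite {1}vE -{1}(subnK (ltnW uv)) -take_drop.
rewrite wpow_drop take_takel // leq_sub2r // E wpowS size_cat; lia.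
Qed.

Lemma rot_eq_wpow q u y : u ++ y = y ++ u -> size y = (q * size u)%N -> y = wpow q u.
Proof.
elim: q y => [|q IH] y; first by move=> _ /size0nil.
rewrite mulSn => E sy.
have uE : take (size u) y = u.
  by have := congr1 (take (size u)) E; rewrite take_size_cat // takel_cat // sy leq_addr.
have yE := cat_take_drop (size u) y; rewrite uE in yE.
rewrite -yE wpowS; congr (_ ++ _); apply: IH; last by rewrite size_drop sy addKn.
by move: E; rewrite -{1 2}yE -catA => /eqP; rewrite eqseq_cat // eqxx => /eqP.
Qed.

(** Let w = as with s < w. Then s is a prefix of w, as otherwise sa < w; so w = sy with |y| = |a|.
    Comparing w with sa gives y < a, and comparing it with ys gives a < y. *)
Lemma lyndon_rot_lt w : w != [::] ->
  (forall i, 0 < i < size w -> ltw w (rot i w)) -> lyndon w.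
Proof.
move=> w0 H; apply/lyndonP; split=> // a s a0 s0 wE.
have rotE b t : b != [::] -> t != [::] -> w = b ++ t -> ltw w (t ++ b).
  move=> b0 t0 E; have := H (size b); rewrite {3}E rot_size_cat; apply.
  by rewrite E size_cat -[X in X < _ + _]addn0 ltn_add2l !lt0n !size_eq0 b0 t0.
apply: contraT => nws.
have sw : ltw s w.
  apply: ltw_total => //; apply/eqP => /(congr1 size).
  by rewrite wE size_cat; case: (a) a0 => //= *; lia.
have [/prefixP [y yE]|np] := boolP (prefix s w); last first.
  have := ltw_catr a [::] sw np; rewrite cats0 => /ltwW.
  by rewrite (rotE a s).
have h1 := rotE _ _ a0 s0 wE.
have y0 : y != [::] by apply: contraTneq sw => y0; rewrite yE y0 cats0 ltw_irr.
have h2 := rotE _ _ s0 y0 yE.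
have sz : size a = size y.
  by apply/eqP; rewrite -(eqn_add2l (size s)) -[eqbRHS]size_cat -yE wE size_cat addnC.
move: h1; rewrite {1}yE ltw_cat2l => /ltwW /negbTE ay.
by move: h2; rewrite wE ltw_cat // ltw_irr andbF orbF ay.
Qed.

(** Let z be the least rotation of w and e > 0 the least rotation amount fixing z. Then e divides
    |w|, so z is a power of its prefix u of length e, and u is strictly least among its own
    rotations. *)
Lemma lyndon_decomp w : w != [::] -> exists u q i,
  [/\ lyndon u, size w = (q * size u)%N, 0 < q, i < size u & w = wpow q (rot i u)].
Proof.
move=> w0; set l := size w.
have l0 : 0 < l by rewrite lt0n size_eq0.
have I0 : iota 0 l != [::] by case: (l) l0.
have /hasP [k] := min_word (fun i => rot i w) I0.
rewrite mem_iota add0n => /andP [_ kl] /allP kmin.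
set z := rot k w in kmin.
have sz : size z = l by rewrite size_rot.
have zmin i : ~~ ltw (rot i z) z.
  have [il|il] := ltnP i l; last first.
    by rewrite rot_oversize ?sz // ltw_irr.
  have E : rot i z = rot (if i + k <= l then i + k else i + k - l)%N w.
    by rewrite /z rot_add_mod; rewrite -/l // ltnW.
  set j := (if _ then _ else _) in E.
  case: (eqVneq j l) => [jl|jl].
    have -> : rot i z = rot 0 w by rewrite E jl rot_size rot0.
    by apply: kmin; rewrite mem_iota; lia.
  rewrite E; apply: kmin; rewrite mem_iota /j; move: jl; rewrite /j.
  by case: ifP; lia.
have ex : exists e, (0 < e) && (rot e z == z).
  by exists l; rewrite l0 -sz rot_size eqxx.
case: (ex_minnP ex) => e /andP [e0 /eqP ze] emin.
have el : e <= l by apply: emin; rewrite l0 -sz rot_size eqxx.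
have zme a : (a * e <= l)%N -> rot (a * e) z = z.
  elim: a => [|a IH]; first by rewrite rot0.
  rewrite mulSn => h; rewrite rotD ?sz // IH //; lia.
have ediv : (e %| l)%N.
  rewrite /dvdn eqn0Ngt; apply/negP => r0.
  have : e <= l %% e.
    apply: emin; rewrite r0 /=.
    have lE : (l %% e + l %/ e * e = l)%N by rewrite addnC -(divn_eq l e).
    have h2 : rot (l %% e) (rot (l %/ e * e) z) = z.
      by rewrite -rotD lE -sz ?rot_size.
    by rewrite zme in h2; [rewrite h2|rewrite leq_trunc_div].
  by rewrite leqNgt ltn_mod e0.
set q := (l %/ e)%N; have lE : l = (q * e)%N by rewrite /q divnK.
have q0 : 0 < q by move: l0; rewrite lE; case: (q).
pose u := take e z.
have su : size u = e by rewrite size_takel ?sz.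
have zE : z = wpow q u.
  have := rot_eq_wpow (q := q.-1) (u := u) (y := drop e z).
  rewrite cat_take_drop -/(rot e z) ze su size_drop sz => /(_ erefl) h.
  have : drop e z = wpow q.-1 u.
    by apply: h; rewrite lE; case: (q) q0 => // q' _; rewrite mulSn addKn.
  move=> dE; rewrite -(cat_take_drop e z) dE -/u -wpowS.
  by rewrite prednK.
have q1 : q = q.-1.+1 by rewrite prednK.
have Lu : lyndon u.
  apply: lyndon_rot_lt => [|i]; first by rewrite -size_eq0 su -lt0n.
  rewrite su => /andP [i0 ie].
  have rne : rot i u != u.
    apply/negP => riu; have := ie; rewrite ltnNge => /negP; apply; apply: emin; rewrite i0 /=.
    by apply/eqP; rewrite zE rot_wpow_small ?(eqP riu) // su ltnW.
  rewrite eq_sym in rne; apply: contraT => nlt; have := ltw_total rne nlt.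
  move=> /(ltw_wpow q.-1 (size_rot _ _)); rewrite -q1 -rot_wpow_small ?su 1?ltnW //.
  by rewrite -zE (negbTE (zmin i)).
have wz : w = rot (l - k) z.
  by rewrite -[LHS](rotK k) /rotr size_rot.
have [|j ju E] := @rot_wpow q (l - k) u.
  by rewrite -zE sz leq_subr.
exists u, q, j; rewrite su; split=> //.
  by move: ju; rewrite su; lia.
by rewrite -E -zE.
Qed.

(** The unrotated powers are rotations of each other and each is least among its rotations, so they
    coincide. Equal powers have Lyndon roots of equal length, and a nontrivial rotation moves a
    Lyndon word. *)
Lemma wpow_rot_inj u v i j q r : lyndon u -> lyndon v ->
  i < size u -> j < size v -> wpow q.+1 (rot i u) = wpow r.+1 (rot j v) ->
  u = v /\ i = j.
Proof.
move=> Lu Lv iu jv.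
rewrite -!rot_wpow_small; [|exact: ltnW..].
set z := wpow q.+1 u; set y := wpow r.+1 v => E.
have szy : size z = size y by have := congr1 size E; rewrite !size_rot.
have iz : i <= size z by rewrite size_wpow mulSn; lia.
have jy : j <= size y by rewrite size_wpow mulSn; lia.
have zy : z = y.
  have zr : exists2 k, k <= size y & z = rot k y.
    have : z = rotr i (rot j y) by rewrite -E rotK.
    rewrite /rotr size_rot rot_add_mod; [|lia|lia].
    by set m := (if _ then _ else _) => E2; exists m => //; rewrite /m; case: ifP; lia.
  have yr : exists2 k, k <= size z & y = rot k z.
    have : y = rotr j (rot i z) by rewrite E rotK.
    rewrite /rotr size_rot rot_add_mod; [|lia|lia].
    by set m := (if _ then _ else _) => E2; exists m => //; rewrite /m; case: ifP; lia.
  have [k ky zk] := zr; have [k' kz yk] := yr.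
  apply/eqP; apply: contraT => zy.
  have := lyndon_wpow_min Lv ky; rewrite -/y -zk => nzy.
  have := lyndon_wpow_min Lu kz; rewrite -/z -yk => nyz.
  by have := ltw_total zy nzy; rewrite (negbTE nyz).
have uv : u = v.
  have s1 : size v <= size u.
    by apply: (@lyndon_root_size _ _ q r) => //; rewrite lt0n size_eq0 lyndon_neq0.
  have s2 : size u <= size v.
    by apply: (@lyndon_root_size _ _ r q) => //; rewrite lt0n size_eq0 lyndon_neq0.
  have s12 : size u = size v by apply/eqP; rewrite eqn_leq s1 s2.
  by move: zy => /eqP; rewrite /z /y !wpowS eqseq_cat // => /andP [/eqP].
split=> //; subst v.
have E2 : rot i u = rot j u.
  move: E; rewrite -zy /z !rot_wpow_small; [|exact: ltnW..].
  by apply: wpow_inj; rewrite !size_rot.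
wlog ij : i j iu jv E2 {E iz jy} / i <= j.
  move=> H; case/orP: (leq_total i j) => [/H|/H h]; first exact.
  by apply/esym/h.
move: ij; rewrite leq_eqVlt => /orP [/eqP //|ij].
have := lyndon_rot_neq Lu (i := j - i).
have -> : 0 < j - i < size u by lia.
move=> /(_ isT); have -> : rot (j - i) u = u; last by rewrite eqxx.
apply: (@rot_inj i); rewrite E2 -rotD; last by lia.
by rewrite subnKC // ltnW.
Qed.

End WordPowers.

(** * Enumeration of words and Lyndon words *)

Fixpoint words (A : seq nat) l : seq (seq nat) :=
  if l is l'.+1 then [seq x :: w | x <- A, w <- words A l'] else [:: [::]].

Lemma mem_words A l w : (w \in words A l) = (size w == l) && all (mem A) w.
Proof.
elim: l w => [|l IH] [|x w] //=.
  by apply/negP => /allpairsP [[? ?] []].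
rewrite eqSS; apply/allpairsP/and3P => [[[y v] /= [yA]]|[sw xA wA]].
  by rewrite IH => /andP [/eqP <- vA] [-> ->]; split.
by exists (x, w); split=> //=; rewrite IH sw.
Qed.

Lemma uniq_words A l : uniq A -> uniq (words A l).
Proof.
move=> uA; elim: l => //= l IH; apply: allpairs_uniq => //.
by move=> [x w] [y v] _ _ [-> ->].
Qed.

Lemma size_words A l : size (words A l) = (size A ^ l)%N.
Proof. by elim: l => //= l IH; rewrite size_allpairs IH expnS. Qed.

Definition lyn A l := [seq w <- words A l | lyndon w].

Lemma mem_lyn A l w : (w \in lyn A l) = [&& lyndon w, size w == l & all (mem A) w].
Proof. by rewrite mem_filter mem_words. Qed.

(** Each word of length l is, in exactly one way, a power of the i-th rotation of a Lyndon word of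
    length e, with e | l and i < e. Moebius inversion of this identity yields [chi]. *)
Lemma sum_lyn A l : uniq A -> 0 < l ->
  (\sum_(e <- divisors l) e * size (lyn A e) = size A ^ l)%N.
Proof.
move=> uA l0; rewrite -size_words.
pose F := [seq wpow (l %/ e) (rot p.2 p.1) | e <- divisors l,
   p <- [seq (u, i) | u <- lyn A e, i <- iota 0 e]].
have sF : size F = (\sum_(e <- divisors l) e * size (lyn A e))%N.
  rewrite size_allpairs_dep sumnE big_map; apply: eq_bigr => e _.
  by rewrite size_allpairs size_iota mulnC.
have qS e : e %| l -> exists q, l %/ e = q.+1.
  move=> el; have : 0 < l %/ e.
    by rewrite divn_gt0; [apply: dvdn_leq | apply: dvdn_gt0 el].
  by case: (l %/ e)%N => // q _; exists q.
rewrite -sF; apply: perm_size; apply: uniq_perm; last 1 first.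
- move=> w; apply/idP/idP.
    case/allpairsPdep => e [p [ed /allpairsP [[u i] /= [uL ie] ->] -> /=]].
    move: ed; rewrite -dvdn_divisors // => ed.
    move: uL; rewrite mem_lyn => /and3P [_ /eqP su uA'].
    rewrite mem_words size_wpow size_rot su divnK // eqxx /=.
    rewrite /wpow; elim: (l %/ e)%N => //= q IHq; rewrite all_cat IHq andbT.
    by apply: etrans (uA'); apply: perm_all; rewrite perm_rot.
  rewrite mem_words => /andP [/eqP sw wA].
  have w0 : w != [::] by rewrite -size_eq0 sw -lt0n.
  have [u [q [i [Lu sE q0 iu wE]]]] := lyndon_decomp w0.
  apply/allpairsPdep; exists (size u), (u, i); split=> /=.
  - by rewrite -dvdn_divisors // -sw sE dvdn_mull.
  - apply/allpairsP; exists (u, i); split=> //=; last by rewrite mem_iota.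
    rewrite mem_lyn Lu eqxx /=; apply/allP => x xu; apply: (allP wA).
    rewrite wE; case: (q) q0 => // q' _; rewrite wpowS mem_cat mem_rot xu //.
  by rewrite -sw sE mulnK //; lia.
- rewrite /F; apply: allpairs_uniq_dep.
  + exact: divisors_uniq.
  + move=> e _; apply: allpairs_uniq; [exact/filter_uniq/uniq_words|exact: iota_uniq|].
    by move=> [? ?] [? ?] _ _ [-> ->].
  move=> x y /allpairsPdep [e [p [ed /allpairsP [[u i] /= [uL ie] ->] ->]]].
  move=> /allpairsPdep [e' [p' [ed' /allpairsP [[u' i'] /= [uL' ie'] ->] ->]]] /=.
  move: ed ed'; rewrite -!dvdn_divisors // => ed ed'.
  move: uL uL' ie ie'; rewrite !mem_lyn !mem_iota.
  move=> /and3P [Lu /eqP su _] /and3P [Lu' /eqP su' _] /andP [_ ie] /andP [_ ie'].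
  have [q ->] := qS _ ed; have [q' ->] := qS _ ed'.
  case/wpow_rot_inj; rewrite ?su ?su' // => uu ii.
  by subst u' i'; rewrite -su su'; subst e'.
exact: uniq_words.
Qed.

(** * Words of fixed length as numbers in base k *)

Section WordValue.
Variable k : nat.
Implicit Types (s t u v w : seq nat).

Definition letters_lt w := all (fun i => i < k) w.

(** On words of one length this turns [ltw] into the order of numbers below a power of k, which
    allows induction along [ltw] in either direction. *)
Fixpoint wval w : nat := if w is x :: w' then x * k ^ size w' + wval w' else 0.

Lemma wval_lt w : letters_lt w -> wval w < k ^ size w.
Proof.
elim: w => //= x w IH /andP [xk /IH lt].
rewrite expnS; apply: (@leq_trans (x.+1 * k ^ size w)).
  by rewrite mulSn addnC ltn_add2r.
by rewrite leq_mul2r xk orbT.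
Qed.

Lemma ltw_wval s t : size s = size t -> letters_lt s -> letters_lt t ->
  ltw s t = (wval s < wval t).
Proof.
elim: s t => [|x s IH] [|y t] //= [st] /andP [xk sk] /andP [yk tk].
have ls := wval_lt sk; have lt := wval_lt tk; rewrite st in ls *.
have key a b p q : a < b -> p < k ^ size t -> a * k ^ size t + p < b * k ^ size t + q.
  move=> ab pl; apply: (@leq_trans (a.+1 * k ^ size t)).
    by rewrite mulSn addnC ltn_add2r.
  by apply: leq_trans (leq_addr _ _); rewrite leq_mul2r ab orbT.
case: (ltngtP x y) => [xy|yx|->] /=; first by rewrite key.
  by apply/esym/negbTE; rewrite -leqNgt ltnW // key.
by rewrite ltn_add2l IH.
Qed.

Lemma wval_inj s t : size s = size t -> letters_lt s -> letters_lt t ->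
  wval s = wval t -> s = t.
Proof.
move=> st sk tk E; apply/eqP; apply: contraT => ne.
have : ~~ ltw s t by rewrite ltw_wval // E ltnn.
by move/(ltw_total ne); rewrite ltw_wval // E ltnn.
Qed.

Lemma letters_lt_cat u v : letters_lt (u ++ v) = letters_lt u && letters_lt v.
Proof. exact: all_cat. Qed.

End WordValue.

(** * Moebius inversion and the number of Lyndon words *)

Import GRing.Theory Num.Theory.

Section Moebius.
Local Open Scope ring_scope.

Lemma moebiusM_prime p e : prime p -> (0 < e)%N -> ~~ (p %| e)%N ->
  moebius (p * e) = - moebius e.
Proof.
move=> pp e0 pe.
have p0 := prime_gt0 pp.
have pP : perm_eq (primes (p * e)) (p :: primes e).
  apply: uniq_perm; first exact: primes_uniq.
    by rewrite /= primes_uniq andbT mem_primes (negbTE pe) !andbF.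
  by move=> q; rewrite in_cons primesM // primes_prime // inE.
rewrite /moebius (perm_all _ pP) (perm_size pP) /=.
have -> : logn p (p * e) = 1%N.
  by rewrite lognM // logn_prime // eqxx lognE (negbTE pe) !andbF.
rewrite eqxx /= (@eq_in_all _ _ (fun q => logn q e == 1%N)) => [|q qe].
  by case: ifP; rewrite ?oppr0 // exprS mulN1r.
rewrite lognM // logn_prime //; case: (eqVneq q p) => [qp|//].
by move: qe; rewrite mem_primes qp (negbTE pe) !andbF.
Qed.

Lemma moebius_sq p e : prime p -> (0 < e)%N -> (p %| e)%N -> moebius (p * e) = 0.
Proof.
move=> pp e0 pe; rewrite /moebius; have p0 := prime_gt0 pp.
case: allP => // /(_ p); rewrite mem_primes pp muln_gt0 p0 e0 dvdn_mulr // => /(_ isT).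
rewrite lognM // logn_prime // eqxx.
by have : (0 < logn p e)%N; [rewrite logn_gt0 mem_primes pp e0|case: logn].
Qed.

(** For a prime p | n, write the divisors that are multiples of p as pe with e | n/p. The term
    vanishes if p | e; otherwise it cancels the term of e, and these e are exactly the divisors of n
    prime to p. *)
Lemma sum_moebius n : (0 < n)%N ->
  \sum_(e <- divisors n) moebius e = (n == 1%N)%:R.
Proof.
move=> n0; have [->|n1] := eqVneq n 1%N; first by rewrite big_seq1.
set p := pdiv n.
have pp : prime p by apply: pdiv_prime; rewrite ltn_neqAle eq_sym n1.
have p0 := prime_gt0 pp.
have pn : (p %| n)%N := pdiv_dvd n.
have np0 : (0 < n %/ p)%N by rewrite divn_gt0 // dvdn_leq.
rewrite (bigID (fun e => (p %| e)%N)) /=.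
rewrite -big_filter -[X in _ + X]big_filter.
have P1 : perm_eq [seq e <- divisors n | (p %| e)%N] [seq (p * e)%N | e <- divisors (n %/ p)].
  apply: uniq_perm; first exact/filter_uniq/divisors_uniq.
    by rewrite map_inj_uniq ?divisors_uniq // => a b /eqP; rewrite eqn_pmul2l // => /eqP.
  move=> e; rewrite mem_filter -dvdn_divisors //; apply/andP/mapP.
    case=> /dvdnP [e' ->] h; exists e'; last by rewrite mulnC.
    by rewrite -dvdn_divisors // dvdn_divRL // mulnC.
  case=> e'; rewrite -dvdn_divisors // => h ->; rewrite dvdn_mulr //; split=> //.
  by rewrite mulnC -dvdn_divRL.
have P2 : perm_eq [seq e <- divisors n | ~~ (p %| e)%N]
    [seq e <- divisors (n %/ p) | ~~ (p %| e)%N].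
  apply: uniq_perm; [exact/filter_uniq/divisors_uniq..|].
  move=> e; rewrite !mem_filter -!dvdn_divisors //.
  case: (boolP (p %| e)%N) => //= pe.
  rewrite -{1}(divnK pn) Gauss_dvdl // coprime_sym prime_coprime //.
rewrite (perm_big _ P1) (perm_big _ P2) big_map big_filter /=.
rewrite (bigID (fun e => (p %| e)%N)) /= big_seq_cond big1 => [|e /andP [ed pe]].
  rewrite add0r -big_split big_seq_cond big1 // => e /andP [ed pe].
  move: ed; rewrite -dvdn_divisors // => /dvdn_gt0 -/(_ np0) e0.
  by rewrite moebiusM_prime //; exact: addNr.
move: ed; rewrite -dvdn_divisors // => /dvdn_gt0 -/(_ np0) e0.
exact: moebius_sq.
Qed.

(** After exchanging the sums, the coefficient of g d is the sum of [moebius] over the divisors of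
    n/d, which is 0 unless d = n. *)
Lemma moebius_inversion (f g : nat -> int) :
  (forall l, (0 < l)%N -> f l = \sum_(d <- divisors l) g d) ->
  forall n, (0 < n)%N -> \sum_(e <- divisors n) moebius e * f (n %/ e)%N = g n.
Proof.
move=> fg n n0.
have -> : \sum_(e <- divisors n) moebius e * f (n %/ e)%N =
    \sum_(e <- divisors n) \sum_(d <- divisors n | (e * d %| n)%N) moebius e * g d.
  apply: eq_big_seq => e; rewrite -dvdn_divisors // => en.
  have e0 := dvdn_gt0 n0 en.
  have ne0 : (0 < n %/ e)%N by rewrite divn_gt0 // dvdn_leq.
  rewrite fg // mulr_sumr -[RHS]big_filter; apply: perm_big.
  apply: uniq_perm; rewrite ?filter_uniq ?divisors_uniq // => d.
  rewrite mem_filter -!dvdn_divisors // dvdn_divRL // mulnC.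
  by case: (boolP (e * d %| n)%N) => //= /(dvdn_trans (dvdn_mull e (dvdnn d))) ->.
rewrite (exchange_big_dep xpredT) //=.
rewrite (bigD1_seq n) ?divisors_uniq ?divisors_id //=.
rewrite [X in _ + X]big_seq_cond [X in _ + X]big1 ?addr0 => [|d /andP [dn ne]].
  rewrite -big_filter (_ : [seq _ <- _ | _] = [:: 1%N]).
    by rewrite big_seq1 /moebius mul1r.
  have P : perm_eq [seq i <- divisors n | (i * n %| n)%N] [:: 1%N].
    apply: uniq_perm; rewrite ?filter_uniq ?divisors_uniq // => e.
    rewrite mem_filter -dvdn_divisors // inE.
    rewrite -{2}[n]mul1n dvdn_pmul2r // dvdn1.
    by case: eqP => [->|//]; rewrite dvd1n.
  exact: perm_small_eq P.
move: dn; rewrite -dvdn_divisors // => dn; have d0 := dvdn_gt0 n0 dn.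
have nd0 : (0 < n %/ d)%N by rewrite divn_gt0 // dvdn_leq.
rewrite -mulr_suml -big_filter.
rewrite (perm_big (divisors (n %/ d))) /=; last first.
  apply: uniq_perm; rewrite ?filter_uniq ?divisors_uniq // => e.
  rewrite mem_filter -!dvdn_divisors // dvdn_divRL //.
  by case: (boolP (e * d %| n)%N) => //= /(dvdn_trans (dvdn_mulr d (dvdnn e))) ->.
rewrite sum_moebius //; case: eqP => [h|_]; last by rewrite mul0r.
by move: ne; rewrite -(divnK dn) h mul1n eqxx.
Qed.

End Moebius.

Lemma size_lyn A l : uniq A -> 0 < l -> size (lyn A l) = chi l (size A).
Proof.
move=> uA l0; rewrite /chi.
pose g e := Posz (e * size (lyn A e)).
have fg k : (0 < k)%N -> Posz (size A ^ k) = (\sum_(d <- divisors k) g d)%R.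
  by move=> k0; rewrite -sum_lyn // /g; apply: (big_morph Posz PoszD).
rewrite (moebius_inversion fg l0) /g PoszM mulrC mulzK //.
by case: l l0.
Qed.

(** * Commutator calculus *)

Local Open Scope classical_set_scope.
Local Open Scope group_scope.

Lemma commMgJ (G : groupType) (x y z : G) : [~ x * y, z] = [~ x, z] ^ y * [~ y, z].
Proof. by rewrite /commg /conjg !invgM !mulgA !(mulgK, mulgVK). Qed.

Lemma commVgJ (G : groupType) (x y : G) : [~ x^-1, y] = ([~ x, y]^-1) ^ x^-1.
Proof. by rewrite /commg /conjg !invgM !invgK !mulgA !(mulgK, mulgVK). Qed.

Lemma commgVJ (G : groupType) (x y : G) : [~ x, y^-1] = ([~ x, y]^-1) ^ y^-1.
Proof. by rewrite /commg /conjg !invgM !invgK !mulgA mulgV mul1g. Qed.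

Lemma conjg_mulR (G : groupType) (x y : G) : x ^ y = x * [~ x, y].
Proof. by rewrite commgEl mulVKg. Qed.

Lemma hall_witt (G : groupType) (x y z : G) :
  [~ x, y^-1, z] ^ y * [~ y, z^-1, x] ^ z * [~ z, x^-1, y] ^ x = 1.
Proof.
by rewrite /commg /conjg !invgM !invgK !mulgA !(mulVg, mul1g, mulgK, mulgVK, mulgV).
Qed.

Section NSubgroup.
Context (G : groupType).
Implicit Types (A B H K D : nsubgroup G) (S T : set G) (x y z : G).

Lemma nsgJV H x y : nsg_set H (x ^ y) -> nsg_set H x.
Proof. by move=> /(nsgJ y^-1); rewrite conjgK. Qed.

Lemma nsgVr H x : nsg_set H x^-1 -> nsg_set H x.
Proof. by move/nsgV; rewrite invgK. Qed.

Lemma nsgX H x n : nsg_set H x -> nsg_set H (x ^+ n).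
Proof.
by move=> Hx; elim: n => [|n IH]; [apply: nsg1 | rewrite expgS; apply: nsgM].
Qed.

Lemma nsg_commC H x y : nsg_set H [~ x, y] -> nsg_set H [~ y, x].
Proof. by rewrite -invgR => /nsgVr. Qed.

Lemma generated_sub S T : S `<=` T -> generated S `<=` generated T.
Proof.
move=> ST x; elim=> {x} [x /ST|  |x y _ Tx _ Ty|x _ Tx].
- exact: gen_mem.
- exact: gen_one.
- exact: gen_mul.
- exact: gen_inv.
Qed.

Lemma generated_nsg S H : S `<=` nsg_set H -> generated S `<=` nsg_set H.
Proof.
move=> SH x; elim=> {x} [x /SH//|  |x y _ Tx _ Ty|x _ Tx].
- exact: nsg1.
- exact: nsgM.
- exact: nsgV.
Qed.

Lemma nsgR_mem H K x y : nsg_set H x -> nsg_set K y -> nsg_set (nsgR H K) [~ x, y].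
Proof. by move=> Hx Ky; apply: gen_mem; exists x => //; exists y. Qed.

Lemma nsgR_sub H K A :
  (forall x y, nsg_set H x -> nsg_set K y -> nsg_set A [~ x, y]) ->
  nsg_set (nsgR H K) `<=` nsg_set A.
Proof. by move=> h; apply: generated_nsg => _ [x Hx [y Ky ->]]; apply: h. Qed.

Lemma nsgRnS c K H : nsgRn c.+1 K H = nsgR (nsgRn c K H) K.
Proof. by []. Qed.

Lemma nsgRnSr c K H : nsgRn c.+1 K H = nsgRn c K (nsgR H K).
Proof. exact: iterSr. Qed.

Lemma nsgRnD a b K H : nsgRn (a + b) K H = nsgRn a K (nsgRn b K H).
Proof. exact: iterD. Qed.

Lemma nsgRn_sub c K H : nsg_set (nsgRn c K H) `<=` nsg_set H.
Proof. by elim: c => [|c IH] // x /nsgR_subl /IH. Qed.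

Lemma nsgRn_mono c K H H' : nsg_set H `<=` nsg_set H' ->
  nsg_set (nsgRn c K H) `<=` nsg_set (nsgRn c K H').
Proof. by move=> HH; elim: c => [|c IH] //=; apply: nsgRS. Qed.

Lemma nsgRn_le a b K H : (a <= b)%N ->
  nsg_set (nsgRn b K H) `<=` nsg_set (nsgRn a K H).
Proof. by move=> ab; rewrite -(subnK ab) nsgRnD; apply: nsgRn_sub. Qed.

(* [A, gamma_(j+1) H] <= [A, H, ..., H] with j+1 copies of H: the three
   subgroups lemma, with A generalised so that the induction goes through. *)
Lemma nsgRn_comm j A H a g : nsg_set A a -> nsg_set (nsgRn j H H) g ->
  nsg_set (nsgRn j.+1 H A) [~ a, g].
Proof.
elim: j A a g => [|j IH] A a g Aa; first exact: nsgR_mem.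
move=> Gg; apply: nsg_commC; move: g Gg a Aa.
move=> g; elim=> {g} [_ [y Gy [h Hh ->]] | | g g' _ h _ h' | g _ h] a Aa.
- have b := hall_witt y h^-1 a; rewrite invgK in b.
  have h1 : nsg_set (nsgRn j.+2 H A) ([~ h^-1, a^-1, y] ^ a).
    rewrite nsgRnSr; apply/nsgJ/IH => //.
    by apply/nsg_commC/nsgR_mem; apply: nsgV.
  have h2 : nsg_set (nsgRn j.+2 H A) ([~ a, y^-1, h^-1] ^ y).
    by apply/nsgJ/nsgR_mem; [apply: IH => //; apply: nsgV | apply: nsgV].
  apply: (@nsgJV _ _ h^-1); have -> : [~ y, h, a] ^ h^-1 =
     ([~ h^-1, a^-1, y] ^ a * [~ a, y^-1, h^-1] ^ y)^-1.
    by apply: invg_inj; rewrite invgK; apply/mulg1_eq; rewrite mulgA.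
  by apply/nsgV/nsgM.
- by rewrite comm1g; apply: nsg1.
- by rewrite commMgJ; apply: nsgM; [apply/nsgJ/h | apply: h'].
- by rewrite commVgJ; apply/nsgJ/nsgV/h.
Qed.

Lemma gammaS k H : (0 < k)%N -> gamma k.+1 H = nsgR (gamma k H) H.
Proof. by case: k. Qed.

Lemma gamma_comm i j H x y : (0 < i)%N -> (0 < j)%N -> nsg_set (gamma i H) x ->
  nsg_set (gamma j H) y -> nsg_set (gamma (i + j) H) [~ x, y].
Proof.
case: i j => [|i] [|j] // _ _ Hx Hy.
have := nsgRn_comm Hx Hy; rewrite -[gamma i.+1 H]/(nsgRn i H H) -nsgRnD.
by rewrite addnC.
Qed.

Lemma gamma_le i j H : (i <= j)%N -> nsg_set (gamma j H) `<=` nsg_set (gamma i H).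
Proof. by move=> ij; apply: nsgRn_le; lia. Qed.

Lemma gamma_sub i H : nsg_set (gamma i H) `<=` nsg_set H.
Proof. exact: nsgRn_sub. Qed.

Definition nsgMul A B : nsubgroup G.
Proof.
exists [set z | exists2 a, nsg_set A a & exists2 b, nsg_set B b & z = a * b].
- by exists 1; [apply: nsg1 | exists 1; [apply: nsg1 | rewrite mulg1]].
- move=> _ _ [a Aa [b Bb ->]] [a' Aa' [b' Bb' ->]].
  exists (a * a' ^ b^-1); first by apply: nsgM => //; apply: nsgJ.
  exists (b * b'); first exact: nsgM.
  by rewrite /conjg invgK !mulgA mulgVK.
- move=> _ [a Aa [b Bb ->]]; exists (a^-1 ^ b).
    by apply/nsgJ/nsgV.
  by exists b^-1; [apply: nsgV | rewrite /conjg invgM !mulgA mulgK].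
- move=> _ y [a Aa [b Bb ->]]; exists (a ^ y); first exact: nsgJ.
  by exists (b ^ y); [apply: nsgJ | rewrite conjMg].
Defined.

Lemma nsgMul_l A B : nsg_set A `<=` nsg_set (nsgMul A B).
Proof. by move=> a Aa; exists a => //; exists 1; [apply: nsg1 | rewrite mulg1]. Qed.

Lemma nsgMul_r A B : nsg_set B `<=` nsg_set (nsgMul A B).
Proof. by move=> b Bb; exists 1; [apply: nsg1 | exists b; rewrite ?mul1g]. Qed.

Lemma nsgMul_sub A B H : nsg_set A `<=` nsg_set H -> nsg_set B `<=` nsg_set H ->
  nsg_set (nsgMul A B) `<=` nsg_set H.
Proof. by move=> AH BH _ [a /AH Ha [b /BH Hb ->]]; apply: nsgM. Qed.

End NSubgroup.

Section CosetMorphism.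
Context (G : groupType) (N : nsubgroup G).

Lemma cosetg_is_multiplicative (x y : G) :
  cosetg N (x * y) = cosetg N x * cosetg N y.
Proof. by rewrite -(cosetgM N x y). Qed.

HB.instance Definition _ :=
  isMultiplicative.Build G (quotg N) (cosetg N) cosetg_is_multiplicative.

Lemma cosetg1 : cosetg N 1 = 1. Proof. by []. Qed.

Lemma cosetg_eq1 x : (cosetg N x = 1) <-> nsg_set N x.
Proof.
rewrite -cosetg1; split=> [/esym /cosetgP|Nx]; first by rewrite invg1 mul1g.
by apply/esym/cosetgP; rewrite invg1 mul1g.
Qed.

End CosetMorphism.

(** The measure of the induction in [lyndon_commutator]: K - V counts how far a word of value V is
    below the bound K, and the length t < S of the left factor breaks ties. *)
Lemma lex_measure_lt K V W S r t q : ((K - V) * S + t <= q)%N -> (V < W)%N ->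
  (W < K)%N -> (r < S)%N -> ((K - W) * S + r < q)%N.
Proof.
move=> hq VW WK rS.
have : ((K - W).+1 * S <= (K - V) * S)%N by rewrite leq_mul2r; lia.
by rewrite mulSn; lia.
Qed.

Lemma dvdzD (d a b : int) : (d %| a)%Z -> (d %| b)%Z -> (d %| (a + b)%R)%Z.
Proof. exact: rpredD. Qed.

Lemma dvdzB (d a b : int) : (d %| a)%Z -> (d %| b)%Z -> (d %| (a - b)%R)%Z.
Proof. exact: rpredB. Qed.

Lemma dvdzBr (d a b : int) : (d %| (a - b)%R)%Z -> (d %| b)%Z -> (d %| a)%Z.
Proof. by move=> h /(dvdzD h); rewrite subrK. Qed.

Lemma dvdzBl (d a b : int) : (d %| (a - b)%R)%Z -> (d %| a)%Z -> (d %| b)%Z.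
Proof. by move=> h /dvdzB /(_ h); rewrite subKr. Qed.

Definition zexp (G : groupType) (a : G) (c : int) : G :=
  match c with Posz n => a ^+ n | Negz n => a ^- n.+1 end.

Lemma zexpD (G : groupType) (a : G) c d : zexp a (c + d)%R = zexp a c * zexp a d.
Proof.
have S c' : zexp a (c' + 1)%R = zexp a c' * a.
  case: c' => [n|[|n]].
    by rewrite (_ : (Posz n + 1)%R = Posz n.+1) /= ?expgSr //; lia.
    by rewrite /= expg1 mulVg.
  rewrite (_ : (Negz n.+1 + 1)%R = Negz n) /=; last by lia.
  by rewrite [a ^+ n.+2]expgS invgM mulgVK.
elim/int_ind: d => [|n IH|n IH].
- by rewrite addr0 mulg1.
- by rewrite -addn1 PoszD addrA !S IH mulgA.
have S' c' : zexp a (c' - 1)%R = zexp a c' * a^-1.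
  by rewrite -{2}(subrK 1%R c') S mulgK.
rewrite (_ : (- (n.+1)%:Z = - n%:Z - 1)%R); last by lia.
by rewrite addrA !S' IH mulgA.
Qed.

Lemma zexpN (G : groupType) (a : G) c : zexp a (- c)%R = (zexp a c)^-1.
Proof. by apply/esym/mulg1_eq; rewrite -zexpD subrr. Qed.

Lemma nsg_zexp (G : groupType) (N : nsubgroup G) a c : nsg_set N a -> nsg_set N (zexp a c).
Proof. by case: c => n Na /=; [|apply: nsgV]; apply: nsgX. Qed.

Lemma nsg_zexp_dvd (G : groupType) (N : nsubgroup G) a n c :
  nsg_set N (a ^+ n) -> (Posz n %| c)%Z -> nsg_set N (zexp a c).
Proof.
move=> Na; have h (m : nat) : (n %| m)%N -> nsg_set N (a ^+ m).
  by case/dvdnP => q ->; rewrite mulnC expgnA; apply: nsgX.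
by case: c => m; rewrite /dvdz /= => /h; [|apply: nsgV].
Qed.

Lemma dvdz_additive1 (G : groupType) (f : G -> int) (d : int) :
  (d %| (f (1 * 1)%g - (f 1%g + f 1%g))%R)%Z -> (d %| f 1%g)%Z.
Proof.
rewrite mulg1 => /(dvdzB (dvdz0 _)); congr (_ %| _)%Z; ring.
Qed.

Lemma dvdz_additive_zexp (G : groupType) (S : set G) (f : G -> int) (d : int) a c :
  (forall c, S (zexp a c)) ->
  (forall g h, S g -> S h -> (d %| (f (g * h)%g - (f g + f h))%R)%Z) ->
  (d %| (f (zexp a c) - c * f a)%R)%Z.
Proof.
move=> Sa fD.
have f0 := dvdz_additive1 (fD _ _ (Sa 0%R) (Sa 0%R)).
have fS c' : (d %| (f (zexp a (c' + 1)%R) - (f (zexp a c') + f a))%R)%Z.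
  by rewrite zexpD; apply: (fD _ (zexp a 1)).
elim/int_ind: c => [|n IH|n IH].
- by rewrite mul0r subr0.
- rewrite -addn1 PoszD.
  rewrite (_ : _ - _ = (f (zexp a (n%:Z + 1)) - (f (zexp a n%:Z) + f a)) +
     (f (zexp a n%:Z) - n%:Z * f a))%R; last by ring.
  exact: dvdzD.
rewrite (_ : _ - _ = (f (zexp a (- n%:Z)) - (- n%:Z) * f a) -
   (f (zexp a ((- n.+1%:Z) + 1)) - (f (zexp a (- n.+1%:Z)) + f a)))%R.
  exact: dvdzB.
rewrite (_ : - n.+1%:Z + 1 = - n%:Z)%R; last by lia.
by rewrite -addn1 PoszD; ring.
Qed.

(* Order 0 stands for an infinite cyclic group; gcdn 0 n = n. *)
Definition word_order (o : nat -> nat) (w : seq nat) :=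
  foldr (fun j d => gcdn (o j) d) 0%N w.

Lemma word_order_cat o u v : word_order o (u ++ v) = gcdn (word_order o u) (word_order o v).
Proof. by elim: u => [|j u IH] /=; rewrite ?gcd0n // IH gcdnA. Qed.

(** * Bracketed Lyndon words in a filtered group *)

Section LyndonCommutators.
Context (F : groupType) (x : nat -> F).
Implicit Types (u v w : seq nat).

(** Bracketing along the standard factorization. The number n is fuel, and by [lcomm_rec_irr] any n
    of at least the length gives the same value. *)
Fixpoint lcomm_rec n w : F :=
  if n is n'.+1 then
    if (size w <= 1)%N then x (head 0%N w)
    else [~ lcomm_rec n' (take (stdi w).+1 w), lcomm_rec n' (drop (stdi w).+1 w)]
  else 1.

Definition lcomm w := lcomm_rec (size w) w.

Lemma lcomm_rec_irr n n' w : w != [::] -> (size w <= n)%N -> (size w <= n')%N ->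
  lcomm_rec n w = lcomm_rec n' w.
Proof.
elim: n n' w => [|n IH] n' w w0; first by rewrite leqn0 size_eq0 (negbTE w0).
case: n' => [|n']; first by rewrite leqn0 size_eq0 (negbTE w0).
move=> wn wn'; rewrite /=; case: leqP => // w1.
have [u [v [wE u0 v0 sE _]]] := stdiP w1.
have su : (0 < size u)%N by rewrite lt0n size_eq0.
have sv : (0 < size v)%N by rewrite lt0n size_eq0.
have swE : (size u + size v)%N = size w by rewrite wE size_cat.
rewrite sE wE take_size_cat // drop_size_cat //.
by congr [~ _, _]; apply: IH => //; lia.
Qed.

Lemma lcomm1 j : lcomm [:: j] = x j.
Proof. by []. Qed.

Lemma lcomm_cat u v : u != [::] -> v != [::] -> is_std u v ->
  lcomm (u ++ v) = [~ lcomm u, lcomm v].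
Proof.
move=> u0 v0 S.
have su : (0 < size u)%N by rewrite lt0n size_eq0.
have sv : (0 < size v)%N by rewrite lt0n size_eq0.
have w1 : (1 < size (u ++ v))%N by rewrite size_cat; lia.
have uv0 : u ++ v != [::] by case: (u) u0.
have sE : (size (u ++ v) <= (size (u ++ v)).-1.+1)%N by lia.
rewrite {1}/lcomm (lcomm_rec_irr uv0 (leqnn _) sE) /= leqNgt w1 /=.
rewrite size_cat in w1 sE *.
rewrite (stdi_uniq u0 v0 S) take_size_cat // drop_size_cat //.
by congr [~ _, _]; apply: lcomm_rec_irr => //; lia.
Qed.

(* Gamma and M play the roles of gamma_l(H) and gamma_(l+1)(H)[D, H, ..., H]
   (l-1 copies of H), for l >= 1; the quotients Gamma l / M l form a Lie ring
   generated in degree 1. *)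
Context (Gam M : nat -> nsubgroup F) (k : nat).
Hypothesis MG : forall l, (0 < l)%N -> nsg_set (M l) `<=` nsg_set (Gam l).
Hypothesis GM : forall l, (0 < l)%N -> nsg_set (Gam l.+1) `<=` nsg_set (M l).
Hypothesis GG : forall i j a b, (0 < i)%N -> (0 < j)%N -> nsg_set (Gam i) a ->
  nsg_set (Gam j) b -> nsg_set (Gam (i + j)) [~ a, b].
Hypothesis MGR : forall i j a b, (0 < i)%N -> (0 < j)%N -> nsg_set (M i) a ->
  nsg_set (Gam j) b -> nsg_set (M (i + j)) [~ a, b].
Hypothesis Ggen : forall l, (0 < l)%N ->
  nsg_set (Gam l.+1) `<=` nsg_set (nsgR (Gam l) (Gam 1)).
Hypothesis Gx : forall j, nsg_set (Gam 1) (x j).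
Hypothesis Ggen1 : nsg_set (Gam 1) `<=`
  generated ([set z | exists2 j, (j < k)%N & z = x j] `|` nsg_set (M 1)).

Lemma Gam_ge i j : (0 < i <= j)%N -> nsg_set (Gam j) `<=` nsg_set (Gam i).
Proof.
move=> /andP [i0]; elim: j => [|j IH]; first by lia.
rewrite leq_eqVlt => /orP [/eqP -> //|ij].
by apply: subset_trans (IH ij); apply: subset_trans (MG _); [apply: GM|]; lia.
Qed.

Lemma Gam_M i j : (0 < i < j)%N -> nsg_set (Gam j) `<=` nsg_set (M i).
Proof.
move=> /andP [i0 ij]; apply: subset_trans (GM i0).
by apply: Gam_ge; lia.
Qed.

Definition mspan l (A : set F) := generated (A `|` nsg_set (M l)).

Lemma mspan_sub l A B : A `<=` B -> mspan l A `<=` mspan l B.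
Proof. by move=> AB; apply: generated_sub; apply: setSU. Qed.

Lemma mspan_mem l A a : A a -> mspan l A a.
Proof. by move=> Aa; apply: gen_mem; left. Qed.

Lemma mspan_M l A a : nsg_set (M l) a -> mspan l A a.
Proof. by move=> Aa; apply: gen_mem; right. Qed.

Lemma mspan_Gam l A : (0 < l)%N -> A `<=` nsg_set (Gam l) ->
  mspan l A `<=` nsg_set (Gam l).
Proof. by move=> l0 AG; apply: generated_nsg => a [/AG|/(MG l0)]. Qed.

Lemma mspan_mspan l A B : A `<=` mspan l B -> mspan l A `<=` mspan l B.
Proof.
move=> AB z; elim=> {z} [z [/AB //|]| |y z _ hy _ hz|z _ hz].
- exact: mspan_M.
- exact: gen_one.
- exact: gen_mul.
- exact: gen_inv.
Qed.

(** The correction [a, g] falls into Gam (l+1), hence into M l. So spans are stable under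
    conjugation, and the commutator identities behave as bilinearity. *)
Lemma mspan_conj l A a g : (0 < l)%N -> A `<=` nsg_set (Gam l) ->
  nsg_set (Gam 1) g -> mspan l A a -> mspan l A (a ^ g).
Proof.
move=> l0 AG Gg Sa; rewrite conjg_mulR; apply: gen_mul => //; apply: mspan_M.
by apply: GM => //; rewrite -addn1; apply: GG => //; apply: mspan_Gam Sa.
Qed.

(** Bilinearity in the first argument: commutation with b need only be checked on the generators A,
    because [MGR] takes care of M i. *)
Lemma mspan_comml i j A B a b : (0 < i)%N -> (0 < j)%N ->
  A `<=` nsg_set (Gam i) -> B `<=` nsg_set (Gam (i + j)) -> nsg_set (Gam j) b ->
  (forall a, A a -> mspan (i + j) B [~ a, b]) ->
  mspan i A a -> mspan (i + j) B [~ a, b].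
Proof.
move=> i0 j0 AG BG Gb AB; have ij0 : (0 < i + j)%N by lia.
have S1 a' : mspan i A a' -> nsg_set (Gam 1) a'.
  by move/(mspan_Gam i0 AG); apply: Gam_ge.
elim=> {a} [a [/AB //|Ma]| |a a' Sa h Sa' h'|a Sa h].
- by apply/mspan_M/MGR.
- by rewrite comm1g; apply: gen_one.
- rewrite commMgJ; apply: gen_mul => //; apply: mspan_conj => //; exact: S1.
- rewrite commVgJ; apply: mspan_conj => //; last exact: gen_inv.
  by apply: nsgV; apply: S1.
Qed.

Lemma mspan_commC l A a b : mspan l A [~ a, b] -> mspan l A [~ b, a].
Proof. by rewrite -invgR => /gen_inv; rewrite invgK. Qed.

Lemma mspan_commr i j A B a b : (0 < i)%N -> (0 < j)%N ->
  A `<=` nsg_set (Gam j) -> B `<=` nsg_set (Gam (i + j)) -> nsg_set (Gam i) a ->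
  (forall b, A b -> mspan (i + j) B [~ a, b]) ->
  mspan j A b -> mspan (i + j) B [~ a, b].
Proof.
move=> i0 j0 AG BG Ga AB Sb; apply: mspan_commC; rewrite addnC in BG AB *.
by apply: (mspan_comml (A := A)) => // c /AB /mspan_commC.
Qed.

Lemma mspan_commVl i j B a b : (0 < i)%N -> (0 < j)%N ->
  B `<=` nsg_set (Gam (i + j)) -> nsg_set (Gam i) a -> nsg_set (Gam j) b ->
  mspan (i + j) B [~ a, b] -> mspan (i + j) B [~ a^-1, b].
Proof.
move=> i0 j0 BG Ga Gb S; rewrite commVgJ; apply: mspan_conj => //; first by lia.
  by apply/nsgV; apply: (Gam_ge _ Ga); lia.
exact: gen_inv.
Qed.

Lemma mspan_commVr i j B a b : (0 < i)%N -> (0 < j)%N ->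
  B `<=` nsg_set (Gam (i + j)) -> nsg_set (Gam i) a -> nsg_set (Gam j) b ->
  mspan (i + j) B [~ a, b] -> mspan (i + j) B [~ a, b^-1].
Proof.
move=> i0 j0 BG Ga Gb S; apply: mspan_commC; rewrite addnC in BG S *.
by apply: mspan_commVl => //; apply: mspan_commC.
Qed.

(** The Jacobi identity [[a, b], c] = [[a, c], b] + [a, [b, c]] read off from Hall-Witt; the
    inverses and conjugations in the latter are absorbed by bilinearity and [mspan_conj]. *)
Lemma mspan_jacobi i j l B a b c : (0 < i)%N -> (0 < j)%N -> (0 < l)%N ->
  B `<=` nsg_set (Gam (i + j + l)) ->
  nsg_set (Gam i) a -> nsg_set (Gam j) b -> nsg_set (Gam l) c ->
  mspan (i + j + l) B [~ [~ a, c], b] -> mspan (i + j + l) B [~ a, [~ b, c]] ->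
  mspan (i + j + l) B [~ [~ a, b], c].
Proof.
move=> i0 j0 l0 BG Ga Gb Gc S1 S2.
have n0 : (0 < i + j + l)%N by lia.
have G1 m g : (0 < m)%N -> nsg_set (Gam m) g -> nsg_set (Gam 1) g.
  by move=> m0; apply: Gam_ge; lia.
have G1V m g : (0 < m)%N -> nsg_set (Gam m) g -> nsg_set (Gam 1) g^-1.
  by move=> m0 /(G1 _ _ m0)/nsgV.
have H1 : mspan (i + j + l) B [~ [~ b^-1, c^-1], a].
  have -> : [~ b^-1, c^-1] = [~ b, c] ^ (c^-1 * b^-1).
    by rewrite commVgJ commgVJ -conjVg invgK conjgM.
  have E : (i + j + l = (j + l) + i)%N by lia.
  rewrite E in BG S1 S2 *.
  apply: (mspan_comml (A := [set [~ b, c]])) => //; first lia.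
  - by move=> _ ->; apply: GG.
  - by move=> _ ->; apply: mspan_commC.
  apply: mspan_conj; first lia.
  - by move=> _ ->; apply: GG.
  - by apply: nsgM; [apply: G1V Gc|apply: G1V Gb].
  - exact: mspan_mem.
have H2 : mspan (i + j + l) B [~ [~ c, a^-1], b^-1].
  have E : (i + j + l = (i + l) + j)%N by lia.
  rewrite E in BG S1 S2 *.
  apply: mspan_commVr => //; first lia.
    by rewrite addnC; apply: GG => //; apply: nsgV.
  apply: (mspan_comml (A := [set [~ a, c]])) => //; first lia.
  - by move=> _ ->; apply: GG.
  - by move=> _ ->.
  rewrite commgVJ invgR; apply: mspan_conj; first lia.
  - by move=> _ ->; apply: GG.
  - exact: G1V Ga.
  - exact: mspan_mem.
have W := hall_witt a b^-1 c; rewrite invgK in W.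
have S3 : mspan (i + j + l) B ([~ a, b, c] ^ b^-1).
  have -> : [~ a, b, c] ^ b^-1 = ([~ b^-1, c^-1, a] ^ c * [~ c, a^-1, b^-1] ^ a)^-1.
    by apply: invg_inj; rewrite invgK; apply/mulg1_eq; rewrite mulgA.
  by apply/gen_inv/gen_mul; apply: mspan_conj => //; [apply: G1 Gc|apply: G1 Ga].
by have := mspan_conj n0 BG (G1 _ _ j0 Gb) S3; rewrite conjgKV.
Qed.

Lemma lcomm_Gam w : w != [::] -> nsg_set (Gam (size w)) (lcomm w).
Proof.
move: {2}(size w) (leqnn (size w)) => m.
elim: m w => [|m IH] w; first by rewrite leqn0 size_eq0 => ->.
move=> wm w0; have [w1|w1] := leqP (size w) 1.
  by case: w w0 w1 {wm} => [|j []] // _ _; rewrite lcomm1; apply: Gx.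
have [u [v [wE u0 v0 _ S]]] := stdiP w1.
have su : (0 < size u)%N by rewrite lt0n size_eq0.
have sv : (0 < size v)%N by rewrite lt0n size_eq0.
move: wm; rewrite wE lcomm_cat // size_cat => wm.
by apply: GG => //; apply: IH => //; lia.
Qed.

Definition lcomms l (P : pred (seq nat)) : set F :=
  [set z | exists2 w, [&& lyndon w, size w == l, letters_lt k w & P w] & z = lcomm w].

Lemma lcomms_Gam l (P : pred (seq nat)) : lcomms l P `<=` nsg_set (Gam l).
Proof.
move=> _ [w /and4P [Lw /eqP <- _ _] ->].
exact/lcomm_Gam/lyndon_neq0.
Qed.

Lemma lcomms_sub l (P Q : pred (seq nat)) :
  (forall w, size w = l -> letters_lt k w -> P w -> Q w) ->
  lcomms l P `<=` lcomms l Q.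
Proof.
move=> PQ z [w /and4P [Lw sw kw Pw] ->]; exists w => //.
by rewrite Lw sw kw PQ //; apply/eqP.
Qed.

(* Induction on |uv|, then downwards on uv, then on |u|: if u = ab is the
   standard factorization and b < v, use [[a, b], v] = [[a, v], b] + [a, [b, v]]. *)
Lemma lyndon_commutator u v : lyndon u -> lyndon v -> ltw u v ->
  letters_lt k (u ++ v) ->
  mspan (size (u ++ v)) (lcomms (size (u ++ v)) (fun w => ~~ ltw w (u ++ v) && ltw w v))
    [~ lcomm u, lcomm v].
Proof.
have [N] := ubnP (size (u ++ v)); elim: N u v => // N IHN u v.
have [q] := ubnP ((k ^ size (u ++ v) - wval k (u ++ v)) * (size (u ++ v)).+1 + size u).
elim: q u v => // q IHq u v; rewrite ltnS => hq; rewrite ltnS => hN Lu Lv uv kuv.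
have u0 := lyndon_neq0 Lu; have v0 := lyndon_neq0 Lv.
have su : (0 < size u)%N by rewrite lt0n size_eq0.
have sv : (0 < size v)%N by rewrite lt0n size_eq0.
have std_case : is_std u v -> mspan (size (u ++ v))
   (lcomms (size (u ++ v)) (fun w => ~~ ltw w (u ++ v) && ltw w v)) [~ lcomm u, lcomm v].
  move=> S; rewrite -lcomm_cat //; apply: mspan_mem; exists (u ++ v) => //.
  have Luv := lyndon_cat Lu Lv uv.
  by rewrite Luv eqxx kuv ltw_irr /= lyndon_suffix.
have [u1|u1] := leqP (size u) 1.
  case: (u) u0 u1 std_case => [//|j []] // _ _; apply; exact: is_std_letter.
have [a [b [uE a0 b0 _ S]]] := stdiP u1.
have [bv|bv] := boolP (ltw b v); last first.
  by apply: std_case; rewrite uE; apply: is_std_cat.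
have sa : (0 < size a)%N by rewrite lt0n size_eq0.
have sb : (0 < size b)%N by rewrite lt0n size_eq0.
rewrite uE in Lu uv kuv hq hN *; clear u u0 su u1 uE std_case.
have La := lyndon_stdl Lu a0 b0 S; have Lb := lyndon_stdr Lu a0 b0 S.
have ab := lyndon_std_lt Lu a0 b0.
have sz : size ((a ++ b) ++ v) = (size a + size b + size v)%N by rewrite !size_cat.
move: (kuv); rewrite !letters_lt_cat => /andP [/andP [ka kb] kv].
(* The inner induction hypothesis, with its bounds relaxed to those of the present goal: cd must
   come after abv, or equal it with a shorter left factor, and d <= v. *)
have rec c d : lyndon c -> lyndon d -> ltw c d -> letters_lt k (c ++ d) ->
    size (c ++ d) = size ((a ++ b) ++ v) ->
    ltw ((a ++ b) ++ v) (c ++ d) \/ (c ++ d = (a ++ b) ++ v /\ size c < size (a ++ b))%N ->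
    ~~ ltw v d ->
    mspan (size ((a ++ b) ++ v)) (lcomms (size ((a ++ b) ++ v))
      (fun w => ~~ ltw w ((a ++ b) ++ v) && ltw w v)) [~ lcomm c, lcomm d].
  move=> Lc Ld cd kcd scd lt dv; rewrite -scd.
  have H : mspan (size (c ++ d)) (lcomms (size (c ++ d))
      (fun w => ~~ ltw w (c ++ d) && ltw w d)) [~ lcomm c, lcomm d].
    have m : ((k ^ size (c ++ d) - wval k (c ++ d)) * (size (c ++ d)).+1 + size c < q)%N.
      rewrite scd; case: lt => [lt|[-> sc]]; last first.
        by apply: leq_trans hq; rewrite ltn_add2l.
      have lt' : (wval k ((a ++ b) ++ v) < wval k (c ++ d))%N.
        by rewrite -ltw_wval.
      have ub : (wval k (c ++ d) < k ^ size ((a ++ b) ++ v))%N by rewrite -scd wval_lt.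
      have szc : (size c <= size ((a ++ b) ++ v))%N by rewrite -scd size_cat leq_addr.
      by apply: lex_measure_lt hq lt' ub _; rewrite ltnS.
    have hN' : (size (c ++ d) < N.+1)%N by rewrite scd ltnS.
    exact: IHq m hN' Lc Ld cd kcd.
  apply: mspan_sub H; apply: lcomms_sub => w sw kw /andP [w1 w2]; apply/andP; split.
  - case: lt => [lt|[<- _] //]; apply: contra w1 => w1; exact: ltw_trans w1 lt.
  - exact: ltw_nltw_trans w2 dv.
clear hq IHq; rewrite lcomm_cat // sz.
have Ga := lcomm_Gam a0; have Gb := lcomm_Gam b0; have Gv := lcomm_Gam v0.
have BG (P : pred (seq nat)) : lcomms (size a + size b + size v) P `<=`
    nsg_set (Gam (size a + size b + size v)).
  exact: lcomms_Gam.
have av : ltw a v := ltw_trans ab bv.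
have LI c : lyndon c -> nsg_set (Gam (size c)) (lcomm c).
  by move/lyndon_neq0/lcomm_Gam.
apply: mspan_jacobi => //; rewrite -?sz.
(* The term [[a, v], b]: [a, v] expands into words w with av <= w < v, so wb >= avb > abv, the last
   because bv < vb. If b < w, the bracket is turned round, and bw > abv because b > ab. *)
- have E : size ((a ++ b) ++ v) = (size (a ++ v) + size b)%N by rewrite sz size_cat addnAC.
  have kav : letters_lt k (a ++ v) by rewrite letters_lt_cat ka.
  have avN : (size (a ++ v) < N)%N.
    by apply: leq_trans hN; rewrite E -[ltnLHS]addn0 ltn_add2l.
  have hav := IHN a v avN La Lv av kav.
  rewrite [X in mspan X]E; apply: (mspan_comml _ _ _ _ _ _ hav) => //.
  + by rewrite size_cat addn_gt0 sa.
  + exact: lcomms_Gam.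
  + rewrite -E sz; exact: BG.
  move=> _ [w /and4P [Lw /eqP sw kw /andP [wav wv]] ->]; rewrite -E.
  have swb : size (w ++ b) = size ((a ++ b) ++ v) by rewrite E -sw size_cat.
  have lt1 : ltw ((a ++ b) ++ v) (w ++ b).
    have h1 : ltw ((a ++ b) ++ v) ((a ++ v) ++ b).
      by rewrite -!catA ltw_cat2l; apply: lyndon_rot => //; apply: lyndon_cat.
    apply: ltw_nltw_trans h1 _; rewrite ltw_cat //.
    by rewrite (negbTE wav) /=; case: eqP => //=; rewrite ltw_irr.
  have [wb|wb] := boolP (ltw w b).
    apply: rec => //; first by rewrite letters_lt_cat kw.
      by left.
    exact: ltwW.
  have [->|wneb] := eqVneq w b; first by rewrite commgg; apply: gen_one.
  have bw : ltw b w := ltw_total wneb wb.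
  apply: mspan_commC; apply: rec => //.
  + by rewrite letters_lt_cat kb.
  + by rewrite size_cat addnC -size_cat.
  + left; have ub := lyndon_suffix Lu a0 b0.
    by apply: ltw_catr => //; apply: ltw_size_prefix => //; rewrite size_cat leq_addl.
  + exact: ltwW.
(* The term [a, [b, v]]: [b, v] expands into words w with bv <= w < v. Either aw > abv, or w = bv
   and the left factor has shrunk from ab to a. *)
have E : size ((a ++ b) ++ v) = (size a + size (b ++ v))%N by rewrite sz size_cat addnA.
have kbv : letters_lt k (b ++ v) by rewrite letters_lt_cat kb.
have bvN : (size (b ++ v) < N)%N.
  by apply: leq_trans hN; rewrite E addnC -[ltnLHS]addn0 ltn_add2l.
have hbv := IHN b v bvN Lb Lv bv kbv.
rewrite [X in mspan X]E; apply: (mspan_commr _ _ _ _ _ _ hbv) => //.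
- by rewrite size_cat addn_gt0 sb.
- exact: lcomms_Gam.
- by rewrite -E sz; exact: BG.
move=> _ [w /and4P [Lw /eqP sw kw /andP [wbv wv]] ->]; rewrite -E.
have Lbv := lyndon_cat Lb Lv bv.
have bw : ltw b w.
  by apply: ltw_nltw_trans (ltw_self_cat _ v0) wbv.
apply: rec => //.
- exact: ltw_trans bw.
- by rewrite letters_lt_cat ka.
- by rewrite E size_cat sw.
- have [wE|ne] := eqVneq w (b ++ v).
    by right; rewrite wE catA size_cat -[ltnLHS]addn0 ltn_add2l.
  left; rewrite -catA ltw_cat2l; exact: ltw_total ne wbv.
- exact: ltwW.
Qed.

Lemma mspan_dvd_add l A (f : F -> int) (d : int) : (0 < l)%N ->
  A `<=` nsg_set (Gam l) ->
  (forall g h, nsg_set (Gam l) g -> nsg_set (Gam l) h -> (d %| (f (g * h)%g - (f g + f h))%R)%Z) ->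
  (forall g, nsg_set (M l) g -> (d %| f g)%Z) ->
  (forall g, A g -> (d %| f g)%Z) ->
  forall g, mspan l A g -> (d %| f g)%Z.
Proof.
move=> l0 AG fD fM fA g; elim=> {g} [g [/fA//|/fM//]| |g h Sg dg Sh dh|g Sg dg].
- exact/fM/nsg1.
- have := fD _ _ (mspan_Gam l0 AG Sg) (mspan_Gam l0 AG Sh).
  by move/dvdzBr; apply; apply: dvdzD.
have Gg := mspan_Gam l0 AG Sg.
have := fD _ _ Gg (nsgV Gg).
rewrite mulgV => /dvdzBl /(_ (fM _ (nsg1 _))) h.
by rewrite -(addKr (f g) (f g^-1)) addrC; apply: dvdzB.
Qed.

Lemma Gam_mspan l : (0 < l)%N ->
  nsg_set (Gam l) `<=` mspan l (lcomms l xpredT).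
Proof.
elim: l => // -[|l] IH _.
  apply: subset_trans Ggen1 _; apply: mspan_mspan => _ [j jk ->].
  apply: mspan_mem; exists [:: j]; rewrite ?lcomm1 //=.
  by rewrite /letters_lt /= jk.
have l0 : (0 < l.+1)%N by [].
apply: subset_trans (Ggen l0) _ => g; elim=> {g} [_ [y Gy [h Gh ->]]| |g h _ Sg _ Sh|g _ Sg].
- rewrite -[l.+2]addn1; apply: (mspan_comml l0 _ _ _ Gh _ (IH l0 _ Gy)) => //.
  + exact: lcomms_Gam.
  + exact: lcomms_Gam.
  move=> _ [w /and4P [Lw /eqP sw kw _] ->].
  apply: (mspan_commr l0 _ _ _ _ _ (Ggen1 Gh)) => //.
  + by move=> _ [j _ ->]; apply: Gx.
  + exact: lcomms_Gam.
  + by rewrite -sw; apply/lcomm_Gam/lyndon_neq0.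
  move=> _ [j jk ->]; rewrite -lcomm1.
  have kj : letters_lt k [:: j] by rewrite /letters_lt /= jk.
  have [->|ne] := eqVneq w [:: j]; first by rewrite commgg; apply: gen_one.
  have [wj|/(ltw_total ne) jw] := boolP (ltw w [:: j]).
    have := lyndon_commutator Lw (lyndon1 j) wj.
    rewrite letters_lt_cat kw kj size_cat sw => /(_ isT).
    by apply: mspan_sub; apply: lcomms_sub.
  apply: mspan_commC; have := lyndon_commutator (lyndon1 j) Lw jw.
  rewrite letters_lt_cat kw kj size_cat sw [(1 + _)%N]addnC => /(_ isT).
  by apply: mspan_sub; apply: lcomms_sub.
- exact: gen_one.
- exact: gen_mul.
- exact: gen_inv.
Qed.

(** Modulo M (i+j), [a^n, b] equals [a, b]^n, since the correction [[a, b], a^n] lies in Gam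
    (i+j+i). Thus the exponent of one entry bounds that of a bracket. *)
Lemma comm_expg i j a b n : (0 < i)%N -> (0 < j)%N -> nsg_set (Gam i) a ->
  nsg_set (Gam j) b -> nsg_set (M i) (a ^+ n) -> nsg_set (M (i + j)) ([~ a, b] ^+ n).
Proof.
move=> i0 j0 Ga Gb /MGR - /(_ _ _ i0 j0 Gb).
have ij0 : (0 < i + j)%N by lia.
suff E : cosetg (M (i + j)) [~ a ^+ n, b] = cosetg (M (i + j)) ([~ a, b] ^+ n).
  by move/cosetg_eq1; rewrite E => /cosetg_eq1.
elim: n => [|n IH]; first by rewrite comm1g.
have cM := @cosetg_is_multiplicative _ (M (i + j)).
rewrite !expgS commMgJ conjg_mulR (cM (_ * _) [~ a ^+ n, b]) (cM [~ a, b] [~ _, _]).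
rewrite (cM [~ a, b] ([~ a, b] ^+ n)) IH.
have -> : cosetg (M (i + j)) [~ [~ a, b], a ^+ n] = 1; last by rewrite mulg1.
apply/cosetg_eq1; apply: (@Gam_M _ (i + j + i)); first by lia.
by apply: GG => //; [apply: GG | apply: nsgX].
Qed.

Lemma lcomm_expg j w n : j \in w -> nsg_set (M 1) (x j ^+ n) ->
  nsg_set (M (size w)) (lcomm w ^+ n).
Proof.
move: {2}(size w) (leqnn (size w)) => m.
elim: m w => [|m IH] w; first by rewrite leqn0 size_eq0 => /eqP ->.
move=> wm wj Mj; have [w1|w1] := leqP (size w) 1.
  by case: w wj w1 {wm} => [|i []] //; rewrite inE => /eqP <-.
have [u [v [wE u0 v0 _ S]]] := stdiP w1.
have su : (0 < size u)%N by rewrite lt0n size_eq0.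
have sv : (0 < size v)%N by rewrite lt0n size_eq0.
have Gu := lcomm_Gam u0; have Gv := lcomm_Gam v0.
move: wm wj; rewrite wE lcomm_cat // size_cat mem_cat => wm /orP [uj|vj].
  by apply: comm_expg => //; apply: IH => //; lia.
rewrite -invgR expVgn addnC; apply/nsgV/comm_expg => //.
by apply: IH => //; lia.
Qed.

Context (o : nat -> nat).
Hypothesis Mx : forall j, (j < k)%N -> nsg_set (M 1) (x j ^+ o j).

Lemma nsg_gcdn (N : nsubgroup F) a m n : nsg_set N (a ^+ m) -> nsg_set N (a ^+ n) ->
  nsg_set N (a ^+ gcdn m n).
Proof.
case: m => [|m] Nm Nn; first by rewrite gcd0n.
case: (egcdnP n (ltn0Sn m)) => u v E _.
have : nsg_set N (a ^+ (u * m.+1)) by rewrite mulnC expgnA; apply: nsgX.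
rewrite E addnC expgnDr => h.
have /nsgV h2 : nsg_set N (a ^+ (v * n)) by rewrite mulnC expgnA; apply: nsgX.
by have := nsgM h h2; rewrite mulgK.
Qed.

Lemma lcomm_word_order w : w != [::] -> letters_lt k w ->
  nsg_set (M (size w)) (lcomm w ^+ word_order o w).
Proof.
move=> w0 kw.
have H v : {subset v <= w} -> nsg_set (M (size w)) (lcomm w ^+ word_order o v).
  elim: v => [|j v IH] vw /=; first exact: nsg1.
  apply: nsg_gcdn; last by apply: IH => i iv; apply: vw; rewrite inE iv orbT.
  have jw : j \in w by apply: vw; rewrite inE eqxx.
  by apply: (lcomm_expg jw); apply: Mx; apply: (allP kw).
exact: H.
Qed.

Lemma mspan_split l A b z : (0 < l)%N -> A `<=` nsg_set (Gam l) ->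
  nsg_set (Gam l) b -> mspan l (A `|` [set b]) z ->
  exists c, exists2 s, mspan l A s & z = zexp b c * s.
Proof.
move=> l0 AG Gb.
have G1b c : nsg_set (Gam 1) (zexp b c) by apply/nsg_zexp/(Gam_ge _ Gb).
elim=> {z} [z [[Az|->]|Mz]| |y z _ [c [s Ss ->]] _ [d [t St ->]]|z _ [c [s Ss ->]]].
- by exists 0%R; exists z; rewrite ?mul1g //; apply: mspan_mem.
- by exists 1%R; exists 1; rewrite ?mulg1 //; apply: gen_one.
- by exists 0%R; exists z; rewrite ?mul1g //; apply: mspan_M.
- by exists 0%R; exists 1; rewrite ?mulg1 //; apply: gen_one.
- exists (c + d)%R; exists (s ^ zexp b d * t).
    by apply: gen_mul => //; apply: mspan_conj.
  by rewrite zexpD /conjg !mulgA mulgK.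
- exists (- c)%R; exists (s^-1 ^ (zexp b c)^-1).
    by apply: mspan_conj => //; [apply: nsgV | apply: gen_inv].
  by rewrite zexpN /conjg invgK invgM !mulgA mulVg mul1g.
Qed.

(** Where the two bounds meet. Generation writes h as a product of bracketed Lyndon words modulo M
    l. At the least remaining word w, the function f w detects the exponent c of [lcomm w] modulo d
    w, so d w divides c; and [lcomm w] has exponent d w modulo M l. *)
Lemma Gam_elim l (f : seq nat -> F -> int) h : (0 < l)%N ->
  let ok w := [&& lyndon w, size w == l & letters_lt k w] in
  let d w := Posz (word_order o w) in
  (forall w g h, ok w -> nsg_set (Gam l) g -> nsg_set (Gam l) h ->
    (d w %| (f w (g * h)%g - (f w g + f w h))%R)%Z) ->
  (forall w g, ok w -> nsg_set (M l) g -> (d w %| f w g)%Z) ->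
  (forall w w', ok w -> ok w' -> ltw w w' -> (d w %| f w (lcomm w'))%Z) ->
  (forall w, ok w -> (d w %| (f w (lcomm w) - 1)%R)%Z) ->
  nsg_set (Gam l) h -> (forall w, ok w -> (d w %| f w h)%Z) -> nsg_set (M l) h.
Proof.
move=> l0 ok d fD fM flt f1 Gh fh.
(* The words of value below i have been eliminated; for i = k^l none remain. *)
have H i : mspan l (lcomms l (fun w => i <= wval k w)%N) h.
  elim: i => [|i IH]; first exact: Gam_mspan.
  have [[w /andP [okw /eqP wi]]|none] :=
      pselect (exists w, ok w && (wval k w == i)); last first.
    apply: mspan_sub IH => z [w /and4P [Lw sw kw iw] zE]; exists w => //.
    rewrite Lw sw kw ltn_neqAle iw andbT /= eq_sym; apply/negP => wi.
    by apply: none; exists w; rewrite /ok Lw sw kw.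
  have /and3P [Lw sw kw] := okw.
  have Gw : nsg_set (Gam l) (lcomm w).
    by rewrite -(eqP sw); apply/lcomm_Gam/lyndon_neq0.
  have [||c [s Ss hE]] := @mspan_split l (lcomms l (fun w => i < wval k w)%N) (lcomm w) h l0 _ Gw.
  - exact: lcomms_Gam.
  - apply: mspan_sub IH => z [v /and4P [Lv sv kv]]; rewrite leq_eqVlt.
    case/orP => [/eqP iv zE|iv zE].
      right; rewrite zE /=; congr lcomm; apply: (@wval_inj k) => //.
        by rewrite (eqP sv) (eqP sw).
      by rewrite wi.
    by left; exists v => //; rewrite Lv sv kv.
  rewrite hE; apply: gen_mul => //; apply: mspan_M.
  rewrite -(eqP sw); apply: (@nsg_zexp_dvd _ _ _ (word_order o w)).
    by apply: lcomm_word_order => //; apply: lyndon_neq0.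
  have ds : (d w %| f w s)%Z.
    apply: (mspan_dvd_add l0 (@lcomms_Gam _ _) _ _ _ Ss).
    - by move=> *; apply: fD.
    - by move=> *; apply: fM.
    move=> _ [v /and4P [Lv sv kv iv] ->]; apply: flt => //; first by rewrite /ok Lv sv.
    by rewrite (@ltw_wval k) ?wi // (eqP sv) (eqP sw).
  have Gs := mspan_Gam l0 (@lcomms_Gam _ _) Ss.
  have e1 := fD w _ _ okw (@nsg_zexp _ _ _ c Gw) Gs; rewrite -hE in e1.
  have e2 := dvdz_additive_zexp c (fun c => nsg_zexp c Gw) (fun g h => fD w g h okw).
  have e3 := dvdz_mull c (f1 _ okw); have e4 := fh _ okw.
  rewrite -/(d w) (_ : c = f w h - (f w h - (f w (zexp (lcomm w) c) + f w s))
    - f w s - (f w (zexp (lcomm w) c) - c * f w (lcomm w))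
    - c * (f w (lcomm w) - 1))%R; last by ring.
  exact: dvdzB (dvdzB (dvdzB (dvdzB e4 e1) ds) e2) e3.
apply: (@generated_nsg _ _ _ _ _ (H (k ^ l)%N)) => z [|//].
case=> w /and4P [_ /eqP sw kw]; rewrite -sw leqNgt wval_lt //.
Qed.

End LyndonCommutators.

(** * Power series with constant term 1 *)

Section PowerSeries.
Local Open Scope ring_scope.

(* Coefficient functions of noncommutative power series in letters X_j, j : nat. *)
Definition series := seq nat -> int.
HB.instance Definition _ := Choice.on series.

Section SeriesRing.
Implicit Types (f g h : series) (v w : seq nat).

Definition series_add f g : series := fun v => f v + g v.
Definition series_opp f : series := fun v => - f v.
Definition series_zero : series := fun _ => 0.
Definition series_one : series := fun v => (v == [::])%:R.

(** The Cauchy product over all splittings of v (see [seriesM]), peeled off at the first letter so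
    that the ring axioms follow by induction on v. *)
Fixpoint series_mul f g v : int := f [::] * g v +
  if v is x :: v' then series_mul (fun u => f (x :: u)) g v' else 0.

Lemma series_addA : associative series_add.
Proof. by move=> f g h; apply/funext => v; rewrite /series_add addrA. Qed.
Lemma series_addC : commutative series_add.
Proof. by move=> f g; apply/funext => v; rewrite /series_add addrC. Qed.
Lemma series_add0 : left_id series_zero series_add.
Proof. by move=> f; apply/funext => v; rewrite /series_add add0r. Qed.
Lemma series_addN : left_inverse series_zero series_opp series_add.
Proof. by move=> f; apply/funext => v; rewrite /series_add addNr. Qed.

HB.instance Definition _ := GRing.isZmodule.Build series
  series_addA series_addC series_add0 series_addN.

Lemma series_mulDl : left_distributive series_mul series_add.
Proof.
move=> f g h; apply/funext => v; rewrite /series_add.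
elim: v f g => [|x v IH] f g /=; first by rewrite !addr0 mulrDl.
by rewrite mulrDl addrACA; congr (_ + _); exact: IH.
Qed.

Lemma series_mulDr : right_distributive series_mul series_add.
Proof.
move=> f g h; apply/funext => v; rewrite /series_add.
elim: v f => [|x v IH] f /=; first by rewrite !addr0 mulrDr.
by rewrite mulrDr addrACA; congr (_ + _); exact: IH.
Qed.

Lemma series_mulZl c f h v :
  series_mul (fun u => c * f u) h v = c * series_mul f h v.
Proof.
elim: v f => [|x v IH] f /=; first by rewrite !addr0 mulrA.
by rewrite mulrDr mulrA; congr (_ + _); exact: IH.
Qed.

Lemma series_mulA : associative series_mul.
Proof.
move=> f g h; apply/funext => v; apply: esym.
elim: v f => [|x v IH] f /=; first by rewrite !addr0 mulrA.
have -> : (fun u => f [::] * g (x :: u) + series_mul (fun u0 => f (x :: u0)) g u)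
   = series_add (fun u => f [::] * g (x :: u)) (series_mul (fun u0 => f (x :: u0)) g).
  by [].
rewrite series_mulDl /series_add series_mulZl IH !addr0 mulrDr !addrA.
by rewrite mulrA.
Qed.

Lemma series_mul1l : left_id series_one series_mul.
Proof.
move=> f; apply/funext => v; case: v => [|x v] /=; first by rewrite mul1r addr0.
rewrite mul1r -[RHS]addr0; congr (_ + _).
by elim: v => [|y v IH] /=; rewrite mul0r add0r.
Qed.

Lemma series_mul1r : right_id series_one series_mul.
Proof.
move=> f; apply/funext => v.
elim: v f => [|x v IH] f /=; first by rewrite mulr1 addr0.
by rewrite mulr0 add0r (IH (fun u => f (x :: u))).
Qed.

HB.instance Definition _ := GRing.Zmodule_isPzRing.Build series
  series_mulA series_mul1l series_mul1r series_mulDl series_mulDr.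

Lemma seriesD f g v : (f + g) v = f v + g v. Proof. by []. Qed.
Lemma seriesN f v : (- f) v = - f v. Proof. by []. Qed.
Lemma seriesB f g v : (f - g) v = f v - g v. Proof. by []. Qed.
Lemma series1 v : (1 : series) v = (v == [::])%:R. Proof. by []. Qed.
Definition shift x f : series := fun u => f (x :: u).

Lemma seriesM_nil f g : (f * g) [::] = f [::] * g [::].
Proof. exact: addr0. Qed.
Lemma seriesM_cons f g x v :
  (f * g) (x :: v) = f [::] * g (x :: v) + (shift x f * g) v.
Proof. by []. Qed.

Lemma seriesM f g v :
  (f * g) v = \sum_(i < (size v).+1) f (take i v) * g (drop i v).
Proof.
elim: v f => [|x v IH] f; first by rewrite big_ord1 seriesM_nil.
rewrite seriesM_cons big_ord_recl /= IH; congr (_ + _).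
Qed.

Lemma eq_seriesM f g g' v : (forall u, (size u <= size v)%N -> g u = g' u) ->
  (f * g) v = (f * g') v.
Proof.
by move=> E; rewrite !seriesM; apply: eq_bigr => i _; rewrite E // size_drop leq_subr.
Qed.

(** Solves f * g = 1 for f with constant term 1: the coefficient of g at a word is determined by
    those at shorter words. The number n is fuel. *)
Fixpoint series_inv_rec n f v : int :=
  if n is n'.+1 then
    if v is x :: v' then - (shift x f * (series_inv_rec n' f : series)) v'
    else 1
  else 0.

Definition series_inv f : series := fun v => series_inv_rec (size v).+1 f v.

Lemma series_inv_irr n m f v : (size v < n)%N -> (size v < m)%N ->
  series_inv_rec n f v = series_inv_rec m f v.
Proof.
elim: n m v => // n IH [//|m] [//|x v] /= vn vm; congr (- _).
by apply: eq_seriesM => u uv; apply: IH; lia.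
Qed.

Lemma series_mulV f : f [::] = 1 -> f * series_inv f = 1.
Proof.
move=> f1; apply/funext => -[|x v]; first by rewrite seriesM_nil f1 mulr1.
rewrite seriesM_cons f1 mul1r series1 {1}/series_inv.
set a := (X in _ + X); rewrite (_ : series_inv_rec _ _ _ = - a) ?addNr //.
congr (- _); apply: eq_seriesM => u uv.
by apply: (@series_inv_irr (size v).+1 (size u).+1); lia.
Qed.

Definition low m f := forall v, (size v < m)%N -> f v = 0.

Lemma lowM_coef a b f g w : low a f -> low b g -> size w = (a + b)%N ->
  (f * g) w = f (take a w) * g (drop a w).
Proof.
move=> fa gb sw; rewrite seriesM.
have aw : (a < (size w).+1)%N by rewrite sw; lia.
rewrite (bigD1 (Ordinal aw)) //= big1 ?addr0 // => i /eqP ia.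
have ne : (i : nat) <> a by move=> E; apply: ia; apply: val_inj.
have iw := ltn_ord i.
have [lt|lt|//] := ltngtP i a.
- by rewrite fa ?mul0r // size_takel; lia.
- by rewrite gb ?mulr0 // size_drop; lia.
Qed.

Lemma lowM a b f g : low a f -> low b g -> low (a + b) (f * g).
Proof.
move=> fa gb v sv; rewrite seriesM big1 // => i _; have iw := ltn_ord i.
have [lt|lt] := ltnP i a; first by rewrite fa ?mul0r // size_takel; lia.
by rewrite gb ?mulr0 // size_drop; lia.
Qed.

End SeriesRing.

Definition useries := {f : series | f [::] == 1}.
HB.instance Definition _ := [Choice of useries by <:].

Section USeries.
Implicit Types (u : useries) (f g : series).

Lemma useries_nil u : val u [::] = 1. Proof. exact/eqP/(valP u). Qed.

Definition mkuseries f (f1 : f [::] = 1) : useries := Sub f (introT eqP f1).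

Lemma mkuseriesE f (f1 : f [::] = 1) : val (mkuseries f1) = f. Proof. exact: SubK. Qed.

Lemma useries_mul_subproof u1 u2 : (val u1 * val u2) [::] = 1.
Proof. by rewrite seriesM_nil !useries_nil mulr1. Qed.

Definition useries_mul u1 u2 := mkuseries (useries_mul_subproof u1 u2).
Definition useries_one : useries := mkuseries (erefl : (1 : series) [::] = 1).
Definition useries_inv u := mkuseries (erefl : series_inv (val u) [::] = 1).

Lemma useries_mulA : associative useries_mul.
Proof. by move=> a b c; apply: val_inj; rewrite !mkuseriesE mulrA. Qed.
Lemma useries_mul1 : left_id useries_one useries_mul.
Proof. by move=> a; apply: val_inj; rewrite !mkuseriesE mul1r. Qed.
Lemma useries_mulr1 : right_id useries_one useries_mul.
Proof. by move=> a; apply: val_inj; rewrite !mkuseriesE mulr1. Qed.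
Lemma useries_mulrV : right_inverse useries_one useries_inv useries_mul.
Proof.
by move=> a; apply: val_inj; rewrite !mkuseriesE series_mulV // useries_nil.
Qed.
Lemma useries_mulV : left_inverse useries_one useries_inv useries_mul.
Proof.
move=> a; have h := useries_mulrV (useries_inv a).
have aE : a = useries_inv (useries_inv a).
  by rewrite -[LHS]useries_mulr1 -h useries_mulA useries_mulrV useries_mul1.
by rewrite [X in useries_mul _ X]aE h.
Qed.

HB.instance Definition _ := isGroup.Build useries
  useries_mulA useries_mul1 useries_mulr1 useries_mulV useries_mulrV.

Lemma useries1E : val (1%g : useries) = 1. Proof. by []. Qed.
Lemma useriesM a b : val (a * b : useries)%g = val a * val b. Proof. by []. Qed.
Lemma useriesVl u : val (u^-1)%g * val u = 1.
Proof. by rewrite -useriesM mulVg. Qed.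
Lemma useriesVr u : val u * val (u^-1)%g = 1.
Proof. by rewrite -useriesM mulgV. Qed.

Variable d : seq nat -> int.
Hypothesis d_cat : forall a b, (d (a ++ b) %| d a)%Z /\ (d (a ++ b) %| d b)%Z.

(** By [d_cat] these series form a two-sided ideal, so the series congruent to 1 form a normal
    subgroup, [ucong]. *)
Definition divs n f := forall v, (size v <= n)%N -> (d v %| f v)%Z.

Lemma divs0 n : divs n 0. Proof. by move=> v _; exact: dvdz0. Qed.

Lemma divsD n f g : divs n f -> divs n g -> divs n (f + g).
Proof. by move=> hf hg v vn; apply: dvdzD; [apply: hf | apply: hg]. Qed.

Lemma divsN n f : divs n f -> divs n (- f).
Proof. by move=> hf v vn; rewrite seriesN rpredN; apply: hf. Qed.

Lemma divsB n f g : divs n f -> divs n g -> divs n (f - g).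
Proof. by move=> hf hg; apply: divsD => //; apply: divsN. Qed.

Lemma divsM_l n m f g : divs n f -> low m g -> divs (n + m) (f * g).
Proof.
move=> hf hg v vn; rewrite seriesM; apply: rpred_sum => i _.
have iv := ltn_ord i; have [lt|le] := ltnP (size (drop i v)) m.
  by rewrite hg // mulr0 rpred0.
have [dl _] := d_cat (take i v) (drop i v); rewrite cat_take_drop in dl.
apply/dvdz_mulr/(dvdz_trans dl)/hf.
by move: le; rewrite size_drop size_takel; lia.
Qed.

Lemma divsM_r n m f g : low m f -> divs n g -> divs (n + m) (f * g).
Proof.
move=> hf hg v vn; rewrite seriesM; apply: rpred_sum => i _.
have iv := ltn_ord i; have [lt|le] := ltnP (size (take i v)) m.
  by rewrite hf // mul0r rpred0.
have [_ dr] := d_cat (take i v) (drop i v); rewrite cat_take_drop in dr.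
apply/dvdz_mull/(dvdz_trans dr)/hg.
by move: le; rewrite size_drop size_takel; lia.
Qed.

Lemma divsM0_l n f g : divs n f -> divs n (f * g).
Proof. by move=> hf; rewrite -(addn0 n); apply: divsM_l. Qed.

Lemma divsM0_r n f g : divs n g -> divs n (f * g).
Proof. by move=> hg; rewrite -(addn0 n); apply: divsM_r. Qed.

Definition ucong (n : nat) : nsubgroup useries.
Proof.
exists (fun u => divs n (val u - 1)); cbv beta.
- by rewrite useries1E subrr; apply: divs0.
- move=> u v hu hv; rewrite useriesM.
  rewrite (_ : _ - 1 = (val u - 1) * val v + (val v - 1)); last first.
    by rewrite mulrBl mul1r addrA subrK.
  by apply: divsD => //; apply: divsM0_l.
- move=> u hu; rewrite (_ : _ - 1 = - (val u^-1%g * (val u - 1))).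
    by apply/divsN/divsM0_r.
  by rewrite mulrBr useriesVl mulr1 opprB.
- move=> u v hu; rewrite (_ : _ - 1 = val v^-1%g * (val u - 1) * val v).
    by apply/divsM0_l/divsM0_r.
  by rewrite mulrBr mulr1 mulrBl useriesVl /conjg !useriesM mulrA.
Defined.

Lemma ucongP n u : nsg_set (ucong n) u <-> divs n (val u - 1).
Proof. by []. Qed.

End USeries.

Section Filtration.
Implicit Types (u v : useries).

(* Divisibility by 0 is vanishing: this is the degree filtration. *)
Definition ulow (n : nat) : nsubgroup useries := ucong
  (d := fun=> 0) (fun _ _ => conj (dvdzz 0) (dvdzz 0)) n.

Lemma ulowP n u : nsg_set (ulow n) u <-> low n.+1 (val u - 1).
Proof.
split=> [/ucongP h v vn|h]; first by apply/eqP; rewrite -dvd0z; apply: h.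
by apply/ucongP => v vn; rewrite h.
Qed.

Lemma ulow0 u : nsg_set (ulow 0) u.
Proof. by apply/ulowP => -[|//] _; rewrite seriesB useries_nil subrr. Qed.

Lemma commuE u v : val [~ u, v]%g - 1 =
  val (u^-1 * v^-1)%g * ((val u - 1) * (val v - 1) - (val v - 1) * (val u - 1)).
Proof.
have -> : (val u - 1) * (val v - 1) - (val v - 1) * (val u - 1) = val u * val v - val v * val u.
  rewrite !mulrBl !mulrBr !mul1r !mulr1.
  move: (val u) (val v) => a b.
  rewrite -[a * b - a - _]addrA -opprD -[b * a - b - _]addrA -opprD.
  by rewrite [b + (a - 1)]addrCA; move: (a + _) => c; rewrite opprB addrA subrK.
rewrite mulrBr /commg /conjg !useriesM !mulrA; congr (_ - _).
by rewrite -[X in _ = X * _]mulrA useriesVl mulr1 useriesVl.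
Qed.

(** In a word of length at most n+m+1, the factor v - 1 takes at least m+1 letters and leaves at
    most n for u - 1, where divisibility is known. As [ulow 0] is everything, any commutator gains
    one degree. *)
Lemma ucong_comm d dc n m u v : nsg_set (@ucong d dc n) u -> nsg_set (ulow m) v ->
  nsg_set (@ucong d dc (n + m).+1) [~ u, v]%g.
Proof.
move=> /ucongP hu /ulowP hv; apply/ucongP; rewrite commuE.
apply: (divsM0_r dc); rewrite -addnS; apply: divsB; [exact: divsM_l|exact: divsM_r].
Qed.

Lemma ulow_comm n m u v : nsg_set (ulow n) u -> nsg_set (ulow m) v ->
  nsg_set (ulow (n + m).+1) [~ u, v]%g.
Proof. exact: ucong_comm. Qed.

(** In the lowest degree in which it can be nontrivial, a group commutator is the Lie bracket of the
    leading terms: the factor u^-1 v^-1 of [commuE] contributes only its constant term 1. *)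
Lemma commu_coef i j u v w : nsg_set (ulow i) u -> nsg_set (ulow j) v ->
  size w = (i.+1 + j.+1)%N ->
  val [~ u, v]%g w = val u (take i.+1 w) * val v (drop i.+1 w) -
                     val v (take j.+1 w) * val u (drop j.+1 w).
Proof.
move=> /ulowP hu /ulowP hv sw.
set c := (val u - 1) * (val v - 1) - (val v - 1) * (val u - 1).
have lc : low (i.+1 + j.+1) c.
  by move=> x sx; rewrite /c seriesB !(lowM hu hv, lowM hv hu) ?subrr // addnC.
have : (val [~ u, v]%g - 1) w = c w.
  rewrite commuE -/c; set g := val (u^-1 * v^-1)%g.
  rewrite -[g](subrK 1) mulrDl mul1r seriesD.
  have lg : low 1 (g - 1) by apply/ulowP/ulow0.
  by rewrite (lowM lg lc) ?add0r // sw.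
have w0 : w != [::] by rewrite -size_eq0 sw.
rewrite seriesB series1 (negbTE w0) subr0 => ->.
rewrite /c seriesB (lowM_coef hu hv) // (lowM_coef hv hu) 1?addnC //.
have e x : x != [::] -> ((x == [::])%:R : int) = 0 by move/negbTE ->.
by rewrite !seriesB !series1 !e ?subr0 // ?take_neq0 ?drop_neq0 // sw; lia.
Qed.

End Filtration.

Section Generators.

Definition sX (j : nat) : series := fun v => (v == [:: j])%:R.

Lemma sX1_nil j : (1 + sX j) [::] = 1. Proof. by []. Qed.

Definition ugen j := mkuseries (sX1_nil j).

Lemma sXM_cons j f x v : (sX j * f) (x :: v) = (x == j)%:R * f v.
Proof.
rewrite seriesM_cons /= mul0r add0r.
have -> : shift x (sX j) = (x == j)%:R.
  apply/funext => -[|y u]; rewrite /shift /sX eqseq_cons ?andbT.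
    by case: (x == j).
  by rewrite andbF; case: (x == j).
by case: (x == j); rewrite ?mul1r ?mul0r.
Qed.

Lemma ugenX_coef j r v : val (ugen j ^+ r)%g v =
  if all (pred1 j) v then 'C(r, size v)%:R else 0.
Proof.
elim: r v => [|r IH] v; first by case: v => [|x v] //=; case: ifP.
rewrite expgS useriesM /= mulrDl mul1r seriesD IH.
case: v => [|x v]; first by rewrite seriesM_nil /= mul0r addr0 !bin0.
rewrite sXM_cons IH /= binS natrD.
by case: eqP => //= _; case: ifP => // _; rewrite ?mul1r ?mul0r ?mulr0 ?addr0 // addrC.
Qed.

End Generators.

End PowerSeries.

(** * Projectivity of normal subgroups of free groups *)

Section Morphisms.
Context (G H : groupType) (f : {multiplicative G -> H}).

Lemma mor1 : f 1 = 1.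
Proof. by apply: (@mulgI _ (f 1)); rewrite mulg1 -gmulfM mulg1. Qed.

Lemma morV x : f x^-1 = (f x)^-1.
Proof. by apply/esym/mulg1_eq; rewrite -gmulfM mulgV mor1. Qed.

Lemma morX x n : f (x ^+ n) = f x ^+ n.
Proof. by elim: n => [|n IH]; rewrite ?mor1 // !expgS gmulfM IH. Qed.

Lemma morR x y : f [~ x, y] = [~ f x, f y].
Proof. by rewrite /commg /conjg !gmulfM !morV. Qed.

End Morphisms.

Section PredSubgroup.
Context (G : groupType) (P : G -> Prop).
Hypothesis P1 : P 1.
Hypothesis PM : forall x y, P x -> P y -> P (x * y).
Hypothesis PV : forall x, P x -> P x^-1.

Definition psg_pred : pred G := fun x => `[< P x >].
(* The closure proofs are arguments so that the group structure can be inferred. *)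
Definition psg_of of P 1 & (forall x y, P x -> P y -> P (x * y)) &
  (forall x, P x -> P x^-1) := {x : G | psg_pred x}.
Notation psg := (psg_of P1 PM PV).
HB.instance Definition _ := SubChoice.on psg.

Lemma psg_closed : group_closed psg_pred.
Proof.
split; first exact/asboolP.
by move=> x y /asboolP Px /asboolP Py; apply/asboolP/PM => //; apply: PV.
Qed.

HB.instance Definition _ :=
  SubChoice_isSubGroup.Build G psg_pred psg psg_closed.

Lemma psgP (x : psg) : P (val x). Proof. exact/asboolP/(valP x). Qed.

End PredSubgroup.

(** The basis maps into the subgroup defined by P; the induced map followed by the inclusion fixes
    the basis, so by uniqueness it is the identity of F. *)
Lemma free_ind (F : groupType) (X : Type) (b : X -> F) (P : F -> Prop) :
  is_free_basis b -> P 1 -> (forall x y, P x -> P y -> P (x * y)) ->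
  (forall x, P x -> P x^-1) -> (forall x, P (b x)) -> forall f, P f.
Proof.
move=> free P1 PM PV Pb.
pose K : groupType := psg_of P1 PM PV.
have [g [gb _]] := free K (fun x => Sub (b x) (introT (asboolP _) (Pb x))).
have [g0 [_ uniq]] := free F b.
pose h : {multiplicative F -> F} := (val : K -> F) \o g.
have hb x : h (b x) = b x by rewrite /h /= gb.
have E f : h f = f by rewrite (uniq h hb) -(uniq idfun).
move=> f; rewrite -(E f); exact: psgP.
Qed.

Section Wreath.
Context (F : groupType) (H : nsubgroup F) (E : groupType).

(* (F/H -> E) x| F, where F acts on F/H by left multiplication *)
Definition wreath := ((quotg H -> E) * F)%type.
HB.instance Definition _ := Choice.on wreath.
Implicit Types (a b c : wreath).

Definition wr_mul a b : wreath :=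
  (fun q => a.1 (cosetg H b.2 * q) * b.1 q, a.2 * b.2).
Definition wr_one : wreath := (fun=> 1, 1).
Definition wr_inv a : wreath :=
  (fun q => (a.1 (cosetg H (a.2)^-1 * q))^-1, (a.2)^-1).

Lemma wr_mulA : associative wr_mul.
Proof.
move=> a b c; rewrite /wr_mul /=; congr pair; last by rewrite mulgA.
by apply/funext => q; rewrite cosetg_is_multiplicative !mulgA.
Qed.
Lemma wr_mul1 : left_id wr_one wr_mul.
Proof.
move=> [u f]; rewrite /wr_mul /=; congr pair; last by rewrite mul1g.
by apply/funext => q; rewrite mul1g.
Qed.
Lemma wr_mulr1 : right_id wr_one wr_mul.
Proof.
move=> [u f]; rewrite /wr_mul /=; congr pair; last by rewrite mulg1.
by apply/funext => q; rewrite mulg1 cosetg1 mul1g.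
Qed.
Lemma wr_mulV : left_inverse wr_one wr_inv wr_mul.
Proof.
move=> [u f]; rewrite /wr_mul /=; congr pair; last by rewrite mulVg.
apply/funext => q; rewrite mulgA -cosetg_is_multiplicative mulVg cosetg1 mul1g.
exact: mulVg.
Qed.
Lemma wr_mulrV : right_inverse wr_one wr_inv wr_mul.
Proof.
move=> [u f]; rewrite /wr_mul /=; congr pair; last by rewrite mulgV.
by apply/funext => q; rewrite mulgV.
Qed.

HB.instance Definition _ := isGroup.Build wreath
  wr_mulA wr_mul1 wr_mulr1 wr_mulV wr_mulrV.

End Wreath.

(* Normal subgroups of free groups are projective. Instead of the
   Nielsen-Schreier theorem: a homomorphism from H to E/N induces one from F to
   the wreath product of E/N by F/H, whose values on a basis lift to E. *)
Lemma nsg_free_projective (F : groupType) (X : Type) (b : X -> F)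
    (H : nsubgroup F) (E : groupType) (N : nsubgroup E) (th : F -> E) :
  is_free_basis b ->
  (forall x y, nsg_set H x -> nsg_set H y ->
     nsg_set N ((th (x * y))^-1 * (th x * th y))) ->
  exists mu : F -> E,
    (forall x y, nsg_set H x -> nsg_set H y -> mu (x * y) = mu x * mu y) /\
    forall x, nsg_set H x -> nsg_set N ((th x)^-1 * mu x).
Proof.
move=> free thM.
pose psi x := cosetg N (th x).
have psiM x y : nsg_set H x -> nsg_set H y -> psi (x * y) = psi x * psi y.
  by move=> Hx Hy; rewrite /psi -cosetg_is_multiplicative; apply/cosetgP/thM.
have psi1 : psi 1 = 1.
  by apply: (@mulgI _ (psi 1)); rewrite mulg1 -psiM ?mulg1 //; apply: nsg1.
have psiV x : nsg_set H x -> psi x^-1 = (psi x)^-1.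
  move=> Hx; apply/esym/mulg1_eq; rewrite -psiM //; last exact: nsgV.
  by rewrite mulgV.
(* [tau] is a transversal of H, and [kk] its cocycle with values in H. Composed with [psi] it gives
   the induced homomorphism from F to the wreath product of E/N by F/H. *)
pose tau (q : quotg H) : F := repr q.
have tauE q : cosetg H (tau q) = q by rewrite /cosetg /tau reprK.
pose kk f q := (tau (cosetg H f * q))^-1 * f * tau q.
have kkH f q : nsg_set H (kk f q).
  rewrite /kk -mulgA; apply/cosetgP.
  by rewrite cosetg_is_multiplicative !tauE.
have kkM f g q : kk (f * g) q = kk f (cosetg H g * q) * kk g q.
  rewrite /kk !mulgA mulgK; congr (_^-1 * _ * _ * _); congr tau.
  by rewrite cosetg_is_multiplicative.
have cV x : cosetg N x^-1 = (cosetg N x)^-1 by exact: morV.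
have [Psi [Psib _]] := free (wreath H E) (fun x => (fun q => th (kk (b x) q), b x)).
have PsiE f : (Psi f).2 = f /\ forall q, cosetg N ((Psi f).1 q) = psi (kk f q).
  move: f; apply: (free_ind free).
  - rewrite (mor1 Psi); split=> // q; rewrite cosetg1 /kk cosetg1 mul1g mulg1 mulVg.
    by rewrite psi1.
  - move=> f g [f2 f1] [g2 g1]; rewrite (@gmulfM _ _ Psi); split=> [|q]; first by rewrite /= f2 g2.
    rewrite /= cosetg_is_multiplicative f1 g1 g2 kkM; apply: esym.
    exact: (psiM (kk f _) (kk g q) (kkH _ _) (kkH _ _)).
  - move=> f [f2 f1]; rewrite (morV Psi); split=> [|q]; first by rewrite /= f2.
    have e := kkM f f^-1 q; rewrite mulgV in e.
    have k1 : kk 1 q = 1 by rewrite /kk cosetg1 mul1g mulg1 mulVg.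
    rewrite k1 in e; rewrite /= f2 cV f1.
    rewrite -(psiV (kk f _) (kkH _ _)); congr psi.
    by apply/mulg1_eq/esym.
  by move=> x; rewrite Psib; split.
(* Elements of H fix the coset 1, so evaluation there is multiplicative on H. It yields [psi] at
   t^-1 x t, as the representative t of H may differ from 1; conjugation by [th t] undoes this. *)
pose t := tau 1.
have Ht : nsg_set H t by apply/cosetg_eq1/tauE.
exists (fun x => th t * (Psi x).1 1 * (th t)^-1); split.
  move=> x y Hx Hy; rewrite (@gmulfM _ _ Psi) /= (PsiE y).1.
  have -> : cosetg H y = 1 by apply/cosetg_eq1.
  by rewrite mulg1 !mulgA mulgVK.
move=> x Hx; apply/cosetgP; rewrite !cosetg_is_multiplicative (PsiE x).2.
have x1 : cosetg H x = 1 by apply/cosetg_eq1.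
have kE : kk x 1 = t^-1 * x * t by rewrite /kk x1 mulg1.
rewrite cV -/(psi t) kE !psiM ?psiV //; try exact: nsgV; last first.
  by apply: nsgM => //; apply: nsgV.
by rewrite !mulgA mulgV mul1g mulgK.
Qed.

(** * From H/D to gamma_(c+1)(H)/[D, H, ..., H] *)

Lemma word_order_dvd o a b :
  (Posz (word_order o (a ++ b)) %| Posz (word_order o a))%Z /\
  (Posz (word_order o (a ++ b)) %| Posz (word_order o b))%Z.
Proof. by rewrite word_order_cat; split; [apply: dvdn_gcdl|apply: dvdn_gcdr]. Qed.

Definition uord (o : nat -> nat) n : nsubgroup useries := ucong (word_order_dvd o) n.

(* H/D is generated by the k elements x j, of order dividing o j, and has
   class at most n; th maps it to power series modulo uord o n, with
   x j |-> 1 + X_j. *)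
Definition presented (F : groupType) (H D : nsubgroup F) n k (o : nat -> nat) :=
  exists (x : nat -> F) (th : F -> useries),
    [/\ forall j, nsg_set H (x j),
        nsg_set H `<=` generated ([set z | exists2 j, (j < k)%N & z = x j] `|` nsg_set D),
        forall j, (j < k)%N -> nsg_set D (x j ^+ o j),
        nsg_set (gamma n.+1 H) `<=` nsg_set D &
    [/\ forall g h, nsg_set H g -> nsg_set H h ->
          nsg_set (uord o n) ((th (g * h))^-1 * (th g * th h)),
        forall g, nsg_set D g -> nsg_set (uord o n) (th g) &
        forall j, (j < k)%N -> nsg_set (uord o n) ((th (x j))^-1 * ugen j)]].

(* phi induces an isomorphism of H/D with the direct sum of the Z/d(w), w in W. *)
Definition coordinatized (F : groupType) (H D : nsubgroup F) (I : eqType)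
    (W : seq I) (d : I -> nat) :=
  exists phi : I -> F -> int,
    [/\ forall w g h, w \in W -> nsg_set H g -> nsg_set H h ->
          (Posz (d w) %| (phi w (g * h)%g - (phi w g + phi w h))%R)%Z,
        forall h, nsg_set H h ->
          (nsg_set D h <-> forall w, w \in W -> (Posz (d w) %| phi w h)%Z) &
        forall t : I -> int, exists2 y, nsg_set H y &
          forall w, w \in W -> (Posz (d w) %| (phi w y - t w)%R)%Z].

(** Match the first coordinate w with a power of [e w], then correct the other coordinates inside
    the elements whose coordinate w is divisible by [d w]. The set S is general because it shrinks
    in this way. *)
Lemma unitriangular_onto (F : groupType) (I : eqType) (S : set F) (W : seq I)
    (d : I -> int) (f : I -> F -> int) (e : I -> F) :
  S 1 -> (forall g h, S g -> S h -> S (g * h)) -> (forall g, S g -> S g^-1) ->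
  (forall w, w \in W -> S (e w)) ->
  (forall w g h, w \in W -> S g -> S h -> (d w %| (f w (g * h)%g - (f w g + f w h))%R)%Z) ->
  uniq W -> pairwise (fun w v => (d w %| f w (e v))%Z) W ->
  (forall w, w \in W -> (d w %| (f w (e w) - 1)%R)%Z) ->
  forall t : I -> int, exists2 y, S y &
    forall w, w \in W -> (d w %| (f w y - t w)%R)%Z.
Proof.
elim: W S => [|w W IH] S S1 SM SV Se fD uW pW fe t; first by exists 1.
have Sz g c : S g -> S (zexp g c).
  move=> Sg; have X n : S (g ^+ n) by elim: n => // n; rewrite expgS; apply: SM.
  by case: c => n; [apply: X|apply/SV/X].
have wW : w \in w :: W by rewrite inE eqxx.
have vW v : v \in W -> v \in w :: W by rewrite inE => ->; rewrite orbT.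
have Sw := Se _ wW.
pose S' := [set g | S g /\ (d w %| f w g)%Z].
have f1 : (d w %| f w 1%g)%Z.
  exact: dvdz_additive1 (fD w 1 1 wW S1 S1).
case/andP: uW => wnW uW; move: pW; rewrite pairwise_cons => /andP [/allP pw pW].
have [||||||y [Sy yw] fy] := IH S' _ _ _ _ _ uW pW _
    (fun v => t v - f v (zexp (e w) (t w)))%R.
- by split.
- move=> g h [Sg dg] [Sh dh]; split; first exact: SM.
  by apply: (dvdzBr (fD w g h wW Sg Sh)); apply: dvdzD.
- move=> g [Sg dg]; split; first exact: SV.
  have := fD w g g^-1 wW Sg (SV _ Sg); rewrite mulgV => /dvdzBl /(_ f1) h.
  by rewrite -(addKr (f w g) (f w g^-1)) addrC; apply: dvdzB.
- by move=> v vWv; split; [apply/Se/vW | apply: pw].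
- by move=> v g h /vW vv [Sg _] [Sh _]; apply: fD.
- by move=> v /vW; apply: fe.
exists (zexp (e w) (t w) * y); first by apply: SM => //; apply: Sz.
have Sz' := Sz (e w) (t w) Sw.
move=> v; rewrite inE => /orP [/eqP ->|vWv].
  have a1 := fD w _ _ wW Sz' Sy.
  have a2 := dvdz_additive_zexp (t w) (fun c => Sz _ c Sw) (fun g h => fD w g h wW).
  have a3 := dvdz_mull (t w) (fe _ wW).
  rewrite (_ : _ - _ = (f w (zexp (e w) (t w) * y)%g - (f w (zexp (e w) (t w)) + f w y))
     + (f w (zexp (e w) (t w)) - t w * f w (e w)) + t w * (f w (e w) - 1) + f w y)%R; last by ring.
  by apply: dvdzD => //; apply: dvdzD => //; apply: dvdzD.
have a1 := fD v _ _ (vW _ vWv) Sz' Sy.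
rewrite (_ : _ - _ = (f v (zexp (e w) (t w) * y)%g - (f v (zexp (e w) (t w)) + f v y))
   + (f v y - (t v - f v (zexp (e w) (t w)))))%R; last by ring.
by apply: dvdzD => //; apply: fy.
Qed.

Definition lyn_range c n k := flatten [seq lyn (iota 0 k) l | l <- iota c.+1 n].

Lemma mem_lyn_range c n k w : (w \in lyn_range c n k) =
  [&& lyndon w, (c < size w <= c + n)%N & letters_lt k w].
Proof.
have E : all (mem (iota 0 k)) w = letters_lt k w.
  by apply: eq_all => i; rewrite /= mem_iota.
apply/flatten_mapP/and3P => [[l]|[Lw sw kw]].
  rewrite mem_iota mem_lyn E => sl /and3P [Lw /eqP sw kw]; split=> //; lia.
by exists (size w); rewrite ?mem_iota ?mem_lyn ?E ?Lw ?eqxx //; lia.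
Qed.

Lemma uniq_lyn_range c n k : uniq (lyn_range c n k).
Proof.
rewrite /lyn_range; elim: n c => //= n IH c; rewrite cat_uniq IH andbT.
rewrite filter_uniq ?uniq_words ?iota_uniq //=.
apply/hasPn => w /flatten_mapP [l]; rewrite mem_iota mem_lyn => lc /and3P [_ /eqP sw _].
by apply/negP; rewrite mem_lyn => /and3P [_ /eqP sw' _]; lia.
Qed.

Definition shortlex (w v : seq nat) := (size w < size v) || (size w == size v) && ~~ ltw v w.

Lemma shortlex_total : total shortlex.
Proof.
move=> w v; rewrite /shortlex; case: (ltngtP (size w) (size v)) => //= _.
by case: (boolP (ltw v w)) => //= /ltwW ->.
Qed.

Lemma shortlex_trans : transitive shortlex.
Proof.
move=> v w u; rewrite /shortlex.
case: (ltngtP (size w) (size v)) => //= wv; case: (ltngtP (size v) (size u)) => //= vu h1 h2.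
- by rewrite (ltn_trans wv vu).
- by rewrite -vu wv.
- by rewrite wv vu.
- by rewrite wv vu eqxx (nltw_trans h1 h2) orbT.
Qed.

Section Step.
Context (F : groupType) (X : Type) (b : X -> F) (free : is_free_basis b).
Context (H D : nsubgroup F) (DH : nsg_set D `<=` nsg_set H).
Context (n c k : nat) (n1 : (0 < n)%N) (nc : (n <= c)%N) (o : nat -> nat).
Context (x : nat -> F) (mu : F -> useries).
Hypothesis Hx : forall j, nsg_set H (x j).
Hypothesis gen : nsg_set H `<=`
  generated ([set z | exists2 j, (j < k)%N & z = x j] `|` nsg_set D).
Hypothesis ord : forall j, (j < k)%N -> nsg_set D (x j ^+ o j).
Hypothesis cls : nsg_set (gamma n.+1 H) `<=` nsg_set D.
Hypothesis muM : forall g h, nsg_set H g -> nsg_set H h -> mu (g * h) = mu g * mu h.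
Hypothesis muD : forall g, nsg_set D g -> nsg_set (uord o n) (mu g).
Hypothesis mux : forall j, (j < k)%N -> nsg_set (uord o n) ((ugen j)^-1 * mu (x j)).

Let Gam l := gamma l H.
Let M l := nsgMul (gamma l.+1 H) (nsgRn l.-1 H D).

Lemma step_MG l : (0 < l)%N -> nsg_set (M l) `<=` nsg_set (Gam l).
Proof. by move=> l0; apply: nsgMul_sub; [apply: gamma_le|apply: nsgRn_mono]. Qed.

Lemma step_GM l : (0 < l)%N -> nsg_set (Gam l.+1) `<=` nsg_set (M l).
Proof. by move=> _; apply: nsgMul_l. Qed.

Lemma step_GG i j g h : (0 < i)%N -> (0 < j)%N -> nsg_set (Gam i) g ->
  nsg_set (Gam j) h -> nsg_set (Gam (i + j)) [~ g, h].
Proof. exact: gamma_comm. Qed.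

Lemma step_MGR i j g h : (0 < i)%N -> (0 < j)%N -> nsg_set (M i) g ->
  nsg_set (Gam j) h -> nsg_set (M (i + j)) [~ g, h].
Proof.
move=> i0 j0 [a Ga [d Dd ->]] Gh; rewrite commMgJ; apply: nsgM.
  apply: nsgMul_l; apply: nsgJ; rewrite -addSn.
  exact: gamma_comm.
apply: nsgMul_r; have := nsgRn_comm Dd Gh; rewrite -nsgRnD.
by rewrite (_ : _ + _ = (i + j).-1)%N //; lia.
Qed.

Lemma step_Ggen l : (0 < l)%N -> nsg_set (Gam l.+1) `<=` nsg_set (nsgR (Gam l) (Gam 1)).
Proof. by move=> l0; rewrite /Gam gammaS. Qed.

Lemma step_Ggen1 : nsg_set (Gam 1) `<=`
  generated ([set z | exists2 j, (j < k)%N & z = x j] `|` nsg_set (M 1)).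
Proof.
apply: subset_trans gen _; apply: generated_sub; apply: setUS.
exact: nsgMul_r.
Qed.

Lemma step_Mx j : (j < k)%N -> nsg_set (M 1) (x j ^+ o j).
Proof. by move=> jk; apply/nsgMul_r/ord. Qed.

Lemma mu1 : mu 1 = 1.
Proof. by apply: (@mulgI _ (mu 1)); rewrite mulg1 -muM ?mulg1 //; apply: nsg1. Qed.

Lemma muV g : nsg_set H g -> mu g^-1 = (mu g)^-1.
Proof.
move=> Hg; apply/esym/mulg1_eq; rewrite -muM ?mulgV ?mu1 //; exact: nsgV.
Qed.

Lemma muR g h : nsg_set H g -> nsg_set H h -> mu [~ g, h] = [~ mu g, mu h].
Proof.
move=> Hg Hh; have Vg := nsgV Hg; have Vh := nsgV Hh.
by rewrite /commg /conjg !muM ?muV //; do ?apply: nsgM.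
Qed.

Lemma mu_nsgR (A : nsubgroup F) (N : nsubgroup useries) :
  nsg_set A `<=` nsg_set H ->
  (forall a h, nsg_set A a -> nsg_set H h -> nsg_set N [~ mu a, mu h]) ->
  forall g, nsg_set (nsgR A H) g -> nsg_set N (mu g).
Proof.
move=> AH NR g Rg.
have sub z : generated (commutators (nsg_set A) (nsg_set H)) z -> nsg_set H z.
  by move=> Rz; apply: AH; apply: (@nsgR_subl _ A H).
elim: Rg => {g} [_ [a Aa [h Hh ->]]| |g h Rg Ng Rh Nh|g Rg Ng].
- by rewrite muR //; [apply: NR | apply: AH].
- by rewrite mu1; apply: nsg1.
- by rewrite muM; [apply: nsgM|apply: sub..].
- by rewrite muV; [apply: nsgV|apply: sub].
Qed.

Lemma mu_gamma l g : (0 < l)%N -> nsg_set (Gam l) g -> nsg_set (ulow l.-1) (mu g).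
Proof.
case: l => // l _; rewrite /Gam /gamma [l.+1.-1]/=.
elim: l g => [|l IH] g; first by move=> _; apply: ulow0.
rewrite nsgRnS; apply: (@mu_nsgR (nsgRn l H H)); first exact: nsgRn_sub.
by move=> a h /IH ha _; rewrite -[l]addn0; apply: ulow_comm => //; apply: ulow0.
Qed.

Lemma mu_D l g : nsg_set (nsgRn l H D) g -> nsg_set (uord o (n + l)) (mu g).
Proof.
elim: l g => [|l IH] g; first by rewrite addn0; apply: muD.
rewrite nsgRnS; apply: (@mu_nsgR (nsgRn l H D)); first by apply: subset_trans DH; apply: nsgRn_sub.
move=> a h /IH ha _; rewrite addnS -[(n + l)%N]addn0; apply: ucong_comm => //.
exact: ulow0.
Qed.

Local Notation phi := (fun (w : seq nat) (g : F) => val (mu g) w).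
Local Notation d := (fun w : seq nat => Posz (word_order o w)).

Lemma phi_coefM a w (u v : useries) : nsg_set (ulow a) u -> nsg_set (ulow a) v ->
  (0 < size w)%N -> (size w < a.+1 + a.+1)%N ->
  val (u * v)%g w = (val u w + val v w)%R.
Proof.
move=> /ulowP hu /ulowP hv w0 wa.
have := lowM hu hv wa.
have w1 : (w == [::]) = false by rewrite -size_eq0; case: size w0.
rewrite mulrBl !mulrBr !mul1r !mulr1 useriesM.
rewrite !(seriesB, seriesD, seriesN, series1) w1 mulr0n => h.
apply/eqP; rewrite -subr_eq0; apply/eqP; rewrite -[RHS]h.
by rewrite subr0 opprD addrA.
Qed.

Lemma uord_coef a w u : nsg_set (uord o a) u -> (0 < size w <= a)%N ->
  (d w %| val u w)%Z.
Proof.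
move=> /ucongP hu /andP [w0 wa].
have := hu w wa; rewrite seriesB series1 -size_eq0.
by case: size w0 => // s _; rewrite subr0.
Qed.

Lemma ulow_coef a w u : nsg_set (ulow a) u -> (0 < size w <= a)%N -> val u w = 0%R.
Proof.
move=> /ulowP hu /andP [w0 wa].
have := hu w wa; rewrite seriesB series1 -size_eq0.
by case: size w0 => // s _; rewrite subr0.
Qed.

(** Induction along w = uv: the coefficient of the bracket at y is a product of coefficients split
    as uv minus one split as vu. Since uv < vu, the second is divisible for all y <= uv, and the
    first for y < uv. All this holds only modulo word orders, since [mu (x j)] is 1 + X_j only
    modulo [uord]. *)
Lemma lcomm_leading w : lyndon w -> letters_lt k w ->
  (forall v, size v = size w -> ltw v w -> (d v %| val (mu (lcomm x w)) v)%Z) /\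
  (d w %| (val (mu (lcomm x w)) w - 1)%R)%Z.
Proof.
move: {2}(size w) (leqnn (size w)) => m.
elim: m w => [|m IH] w; first by rewrite leqn0 size_eq0 => /eqP ->.
move=> wm Lw kw; have w0 := lyndon_neq0 Lw.
have [w1|w1] := leqP (size w) 1.
  case: w w0 w1 {wm Lw} kw => [|j []] // _ _; rewrite /letters_lt /= andbT => jk.
  rewrite lcomm1.
  have hj v : (size v <= n)%N -> (d v %| (val (mu (x j)) v - val (ugen j) v)%R)%Z.
    have := mux jk; move/ucongP => h.
    have h2 : divs d n (val (mu (x j)) - val (ugen j))%R.
      rewrite (_ : (_ - _)%R = (val (ugen j) * (val ((ugen j)^-1 * mu (x j))%g - 1))%R).
        exact: (divsM0_r (word_order_dvd o)).
      by rewrite mulrBr mulr1 useriesM mulrA useriesVr mul1r.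
    by move=> vn; have := h2 v vn; rewrite seriesB.
  have uE i : val (ugen j) [:: i] = (i == j)%:R%R.
    by rewrite mkuseriesE seriesD series1 /= /sX eqseq_cons andbT add0r.
  split.
    case=> [|i []] //= _; rewrite ltn_neqAle andbF orbF => /andP [ij _].
    by have := hj [:: i] n1; rewrite uE (negbTE ij) subr0.
  by have := hj [:: j] n1; rewrite uE eqxx.
have [u [v [wE u0 v0 _ S]]] := stdiP w1.
have Lu : lyndon u by apply: (@lyndon_stdl u v); rewrite -?wE.
have Lv : lyndon v by apply: (@lyndon_stdr u v); rewrite -?wE.
have su : (0 < size u)%N by rewrite lt0n size_eq0.
have sv : (0 < size v)%N by rewrite lt0n size_eq0.
move: kw; rewrite wE letters_lt_cat => /andP [ku kv].
rewrite wE in Lw wm *; rewrite size_cat in wm.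
have [u1 u2] := IH u ltac:(lia) Lu ku; have [v1 v2] := IH v ltac:(lia) Lv kv.
have Gu : nsg_set (Gam (size u)) (lcomm x u) by apply: (lcomm_Gam step_GG Hx).
have Gv : nsg_set (Gam (size v)) (lcomm x v) by apply: (lcomm_Gam step_GG Hx).
rewrite lcomm_cat // muR; [|exact: gamma_sub Gu|exact: gamma_sub Gv].
have lu := mu_gamma su Gu; have lv := mu_gamma sv Gv.
set a := mu (lcomm x u) in u1 u2 lu *; set e := mu (lcomm x v) in v1 v2 lv *.
have suE : (size u).-1.+1 = size u by rewrite prednK.
have svE : (size v).-1.+1 = size v by rewrite prednK.
have coefE y : size y = (size u + size v)%N -> val [~ a, e] y =
   (val a (take (size u) y) * val e (drop (size u) y) -
    val e (take (size v) y) * val a (drop (size v) y))%R.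
  by move=> sy; rewrite (commu_coef lu lv) suE svE.
have split_lt (p q : seq nat) (s t : useries) y : size y = (size p + size q)%N ->
    ltw y (p ++ q) ->
    (forall z, size z = size p -> ltw z p -> (d z %| val s z)%Z) ->
    (forall z, size z = size q -> ltw z q -> (d z %| val t z)%Z) ->
    (d y %| (val s (take (size p) y) * val t (drop (size p) y))%R)%Z.
  move=> sy lt hs ht.
  have st : size (take (size p) y) = size p by rewrite size_takel // sy leq_addr.
  have sd : size (drop (size p) y) = size q by rewrite size_drop sy addKn.
  have [d1 d2] := word_order_dvd o (take (size p) y) (drop (size p) y).
  rewrite cat_take_drop in d1 d2.
  move: lt; rewrite -{1}(cat_take_drop (size p) y) ltw_cat // => /orP [lt|/andP [_ lt]].
    exact: dvdz_mulr (dvdz_trans d1 (hs _ st lt)).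
  exact: dvdz_mull (dvdz_trans d2 (ht _ sd lt)).
have uvvu : ltw (u ++ v) (v ++ u) := lyndon_rot Lw u0 v0.
split=> [y|].
  rewrite size_cat => sy lt; rewrite coefE //; apply: dvdzB; first exact: (split_lt u v).
  by apply: (split_lt v u) => //; [rewrite addnC|apply: ltw_trans lt uvvu].
rewrite coefE ?size_cat // take_size_cat // drop_size_cat //.
have h2 : (d (u ++ v) %| (val e (take (size v) (u ++ v)) * val a (drop (size v) (u ++ v)))%R)%Z.
  by apply: (split_lt v u) => //; rewrite size_cat addnC.
have [d1 d2] := word_order_dvd o u v.
rewrite (_ : (_ - _ - _)%R = ((val a u - 1) * val e v + (val e v - 1)
  - val e (take (size v) (u ++ v)) * val a (drop (size v) (u ++ v)))%R); last by ring.
apply: dvdzB => //; apply: dvdzD.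
  exact: dvdz_mulr (dvdz_trans d1 u2).
exact: dvdz_trans d2 v2.
Qed.

Local Notation ok l := (fun w : seq nat => [&& lyndon w, size w == l & letters_lt k w]).

Lemma lcomm_Gam_step w : lyndon w -> nsg_set (Gam (size w)) (lcomm x w).
Proof. by move/lyndon_neq0; apply: (lcomm_Gam step_GG Hx). Qed.

Lemma lyndon_size_gt0 w : lyndon w -> (0 < size w)%N.
Proof. by move/lyndon_neq0; rewrite lt0n size_eq0. Qed.

Lemma phi_addG g h w : nsg_set (Gam c.+1) g -> nsg_set (Gam c.+1) h ->
  (0 < size w <= c + n)%N -> phi w (g * h) = (phi w g + phi w h)%R.
Proof.
move=> Gg Gh /andP [w0 wc]; rewrite muM; [|exact: gamma_sub Gg|exact: gamma_sub Gh].
by apply: (phi_coefM (a := c)) => //; [apply: (mu_gamma _ Gg)|apply: (mu_gamma _ Gh)|lia].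
Qed.

Lemma step_layer l g : (c < l <= c + n)%N -> nsg_set (Gam l) g ->
  (forall w, ok l w -> (d w %| phi w g)%Z) -> nsg_set (M l) g.
Proof.
move=> /andP [cl lc] Gg hg; have l0 : (0 < l)%N by lia.
have Gc h : nsg_set (Gam l) h -> nsg_set (Gam c.+1) h by apply: gamma_le.
apply: (Gam_elim step_MG step_GM step_GG step_MGR step_Ggen Hx step_Ggen1 step_Mx
  (f := phi) l0) => //.
- move=> w g1 g2 /and3P [Lw /eqP sw kw] G1 G2.
  rewrite phi_addG ?subrr ?dvdz0 //; [exact: Gc|exact: Gc|].
  by rewrite sw l0.
- move=> w h /and3P [Lw /eqP sw kw] Mh.
  have Gh := step_MG l0 Mh.
  case: Mh Gh => a Ga [e De ->] Gae.
  have Ga' : nsg_set (Gam l) a by apply: gamma_le Ga.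
  have Ge' : nsg_set (Gam l) e by apply: (nsgRn_mono DH De).
  rewrite phi_addG ?sw ?l0 //; [|exact: Gc|exact: Gc].
  apply: dvdzD.
    by rewrite (ulow_coef (mu_gamma _ Ga)) ?dvdz0 //= sw l0 /=.
  (* The l-1 commutators raise the degree n to n+l-1, which is at least l because n > 0. *)
  by apply: (uord_coef (mu_D De)); rewrite sw l0 /=; lia.
- move=> w w' /and3P [Lw /eqP sw kw] /and3P [Lw' /eqP sw' kw'] lt.
  by have [h _] := lcomm_leading Lw' kw'; apply: h => //; rewrite sw sw'.
- by move=> w /and3P [Lw /eqP sw kw]; have [_] := lcomm_leading Lw kw.
Qed.

(** For the converse, h is pushed down the lower central series one degree at a time, modulo
    [D, H, ..., H]: that factor has divisible coordinates, so those of the remaining element stay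
    divisible and [step_layer] applies again. *)
Lemma step_kernel h : nsg_set (Gam c.+1) h ->
  nsg_set (nsgRn c H D) h <->
  (forall w, w \in lyn_range c n k -> (d w %| phi w h)%Z).
Proof.
move=> Gh; split=> [Dh w|hw].
  rewrite mem_lyn_range => /and3P [Lw sw kw].
  by apply: (uord_coef (mu_D Dh)); rewrite lyndon_size_gt0 //= addnC; case/andP: sw.
have claim i : (i <= n)%N -> exists2 g, nsg_set (Gam (c.+1 + i)) g &
    exists2 e, nsg_set (nsgRn c H D) e & h = g * e.
  elim: i => [|i IH] ni.
    by exists h; rewrite ?addn0 //; exists 1; [apply: nsg1|rewrite mulg1].
  have [|g Gg [e De hE]] := IH; first by lia.
  have Gcg : nsg_set (Gam c.+1) g by apply: gamma_le Gg; lia.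
  have Gce : nsg_set (Gam c.+1) e by apply: (nsgRn_mono DH De).
  have : nsg_set (M (c.+1 + i)) g.
    apply: step_layer => //; first by lia.
    move=> w /and3P [Lw /eqP sw kw].
    have wR : w \in lyn_range c n k by rewrite mem_lyn_range Lw kw sw; lia.
    have := hw w wR; rewrite hE phi_addG //; last by rewrite sw; lia.
    have de : (d w %| phi w e)%Z.
      by apply: (uord_coef (mu_D De)); rewrite sw; lia.
    by move=> s; have := dvdzB s de; rewrite addrK.
  case=> a Ga [e' De' gE]; exists a; first by rewrite addnS.
  exists (e' * e); last by rewrite hE gE mulgA.
  by apply: nsgM => //; apply: nsgRn_le De'; lia.
(* Now g lies in gamma_(c+n+1)(H) = [gamma_(n+1)(H), H, ..., H] with c copies, and gamma_(n+1)(H)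
   lies in D. *)
have [g Gg [e De ->]] := claim n (leqnn _).
apply: nsgM => //; have : nsg_set (nsgRn c H (gamma n.+1 H)) g.
  by rewrite /gamma -nsgRnD; move: Gg; rewrite /Gam /gamma addSn.
exact: nsgRn_mono.
Qed.

Lemma step_onto (t : seq nat -> int) : exists2 y, nsg_set (Gam c.+1) y &
  forall w, w \in lyn_range c n k -> (d w %| (phi w y - t w)%R)%Z.
Proof.
(* In this order the matrix of coefficients is triangular: on the bracket of v they vanish at
   shorter words and are divisible at smaller words of the same length. *)
pose W := sort shortlex (lyn_range c n k).
have memW w : (w \in W) = (w \in lyn_range c n k) by apply: mem_sort.
have [||||||||y Gy hy] :=
    @unitriangular_onto _ _ (nsg_set (Gam c.+1)) W d phi (lcomm x) _ _ _ _ _ _ _ _ t.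
- exact: nsg1.
- exact: nsgM.
- exact: nsgV.
- move=> w; rewrite memW mem_lyn_range => /and3P [Lw /andP [cw wc] kw].
  exact: gamma_le cw _ (lcomm_Gam_step Lw).
- move=> w g h; rewrite memW mem_lyn_range => /and3P [Lw /andP [cw wc] kw] Gg Gh.
  by rewrite phi_addG ?subrr ?dvdz0 // lyndon_size_gt0.
- by rewrite sort_uniq uniq_lyn_range.
- have := sort_sorted shortlex_total (lyn_range c n k).
  rewrite (sorted_pairwise shortlex_trans) -/W => pW.
  have uW : uniq W by rewrite sort_uniq uniq_lyn_range.
  rewrite uniq_pairwise in uW.
  have := pairwise_relI shortlex [rel w v | w != v] W; rewrite pW uW /=.
  apply: (@sub_in_pairwise _ [pred w | w \in W]); last by apply/allP.
  move=> w v; rewrite /= !inE !memW !mem_lyn_range.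
  move=> /and3P [Lw _ kw] /and3P [Lv _ kv] /andP [le ne].
  have Gv := mu_gamma (lyndon_size_gt0 Lv) (lcomm_Gam_step Lv).
  case/orP: le => [lt|/andP [/eqP sz nlt]].
    rewrite (ulow_coef Gv) ?dvdz0 // lyndon_size_gt0 //=.
    by rewrite -ltnS prednK ?lyndon_size_gt0.
  have [h _] := lcomm_leading Lv kv; apply: h => //.
  by apply: ltw_total; rewrite // eq_sym.
- move=> w; rewrite memW mem_lyn_range => /and3P [Lw _ kw].
  by have [_] := lcomm_leading Lw kw.
by exists y => // w wR; apply: hy; rewrite memW.
Qed.

End Step.

Lemma coordinatized_step (F : groupType) (X : Type) (b : X -> F) (H D : nsubgroup F)
    (n c k : nat) (o : nat -> nat) :
  is_free_basis b -> nsg_set D `<=` nsg_set H -> (0 < n <= c)%N -> presented H D n k o ->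
  coordinatized (gamma c.+1 H) (nsgRn c H D) (lyn_range c n k) (word_order o).
Proof.
move=> free DH /andP [n0 nc] [x [th [Hx gen ord cls [thM thD thx]]]].
have [mu [muM muth]] := nsg_free_projective free thM.
have muD g : nsg_set D g -> nsg_set (uord o n) (mu g).
  move=> Dg; have := nsgM (thD _ Dg) (muth _ (DH _ Dg)).
  by rewrite mulVKg.
have mux j : (j < k)%N -> nsg_set (uord o n) ((ugen j)^-1 * mu (x j)).
  move=> jk; have := nsgM (nsgV (thx _ jk)) (muth _ (Hx j)).
  by rewrite invgM invgK !mulgA mulgK.
exists (fun w g => val (mu g) w); split.
- move=> w g h; rewrite mem_lyn_range => /and3P [Lw /andP [_ wc] kw] Gg Gh.
  by rewrite (phi_addG n0 nc muM Gg Gh) ?subrr ?dvdz0 // lyndon_size_gt0.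
- exact: (step_kernel DH n0 nc Hx gen ord cls muM muD mux).
- exact: (step_onto n0 nc Hx muM mux).
Qed.

(** 1 plus a linear form. Modulo degree 2 such series multiply by adding their linear parts, which
    represents an abelian H/D. *)
Definition lin_series (k : nat) (a : nat -> int) : series :=
  fun v => match v with
           | [::] => 1%R
           | [:: j] => if (j < k)%N then a j else 0%R
           | _ => 0%R
           end.

(** Closes the loop of the iteration: the words in W become the letters of the next stage, and [x j]
    is an element dual to the j-th coordinate. *)
Lemma presented_coordinatized (F : groupType) (H D : nsubgroup F) (I : eqType)
    (i0 : I) (W : seq I) (d : I -> nat) :
  nsg_set D `<=` nsg_set H -> uniq W -> coordinatized H D W d ->
  presented H D 1 (size W) (fun j => d (nth i0 W j)).
Proof.
move=> DH uW [phi [phiD ker onto]].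
have memW j : (j < size W)%N -> nth i0 W j \in W by apply: mem_nth.
have /boolp.choice [x hx] : forall j, exists y, nsg_set H y /\
    forall w, w \in W -> (Posz (d w) %| (phi w y - (w == nth i0 W j)%:R)%R)%Z.
  by move=> j; have [y Hy hy] := onto (fun w => (w == nth i0 W j)%:R)%R; exists y.
have Hx j : nsg_set H (x j) := (hx j).1.
have Hz j a : nsg_set H (zexp (x j) a) by apply: nsg_zexp.
have phiZ w j a : w \in W ->
    (Posz (d w) %| (phi w (zexp (x j) a) - a * phi w (x j))%R)%Z.
  by move=> wW; apply: (dvdz_additive_zexp _ (Hz j)) => g h; apply: phiD.
have phi1 w : w \in W -> (Posz (d w) %| phi w 1%g)%Z.
  by move=> wW; have [h _] := ker 1 (nsg1 _); apply: h => //; apply: nsg1.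
have phiV w g : w \in W -> nsg_set H g -> (Posz (d w) %| (phi w g + phi w g^-1%g)%R)%Z.
  by move=> wW Hg; have := phiD w _ _ wW Hg (nsgV Hg); rewrite mulgV => /dvdzBl; apply; apply: phi1.
have Hgen j : (j < size W)%N -> forall a,
    generated ([set z | exists2 j, (j < size W)%N & z = x j] `|` nsg_set D) (zexp (x j) a).
  move=> jW; have g1 : generated ([set z | exists2 j, (j < size W)%N & z = x j] `|` nsg_set D) (x j).
    by apply: gen_mem; left; exists j.
  have gX m : generated ([set z | exists2 j, (j < size W)%N & z = x j] `|` nsg_set D) (x j ^+ m).
    elim: m => [|m IH]; first exact: gen_one.
    by rewrite expgS; apply: gen_mul.
  by case=> m; [apply: gX|apply/gen_inv/gX].
exists x; exists (fun g => mkuseries (erefl :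
  (lin_series (size W) (fun j => phi (nth i0 W j) g)) [::] = 1%R)).
split.
- exact: Hx.
- move=> h Hh.
  (* The element g matches h in the first i coordinates and is trivial in the others. *)
  have claim i : (i <= size W)%N -> exists g, [/\ nsg_set H g,
      generated ([set z | exists2 j, (j < size W)%N & z = x j] `|` nsg_set D) g &
      forall w, w \in W ->
        (Posz (d w) %| (phi w g - (if index w W < i then phi w h else 0)%N)%R)%Z].
    elim: i => [|i IH] iW.
      exists 1; split; [exact: nsg1|exact: gen_one|] => w wW.
      by rewrite ltn0 subr0; apply: phi1.
    have [|g [Hg gg hg]] := IH; first exact: ltnW.
    set a := phi (nth i0 W i) h.
    exists (g * zexp (x i) a); split; first exact: nsgM.
      by apply: gen_mul => //; apply: Hgen.
    move=> w wW; have e1 := phiD w _ _ wW Hg (Hz i a).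
    have e2 := phiZ w i a wW; have e3 := dvdz_mull a ((hx i).2 w wW).
    have e4 := hg w wW.
    rewrite (_ : _ - _ = (phi w (g * zexp (x i) a)%g - (phi w g + phi w (zexp (x i) a)))
       + (phi w g - (if (index w W < i)%N then phi w h else 0))
       + (phi w (zexp (x i) a) - a * phi w (x i))
       + a * (phi w (x i) - (w == nth i0 W i)%:R))%R.
      by do 3?[apply: dvdzD => //].
    have E : (w == nth i0 W i) = (index w W == i).
      apply/eqP/eqP => [->|<-]; first by rewrite index_uniq.
      by rewrite nth_index.
    rewrite E ltnS leq_eqVlt; case: eqP => [iE|_] /=.
      have -> : a = phi w h by rewrite /a -iE nth_index.
      by rewrite -iE ltnn; ring.
    by ring.
  have [g [Hg gg hg]] := claim _ (leqnn _).
  rewrite -(mulVKg g h); apply: gen_mul => //; apply: gen_mem; right.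
  have HV := nsgV Hg.
  apply/ker; first exact: nsgM.
  move=> w wW; have e1 := phiD w _ _ wW HV Hh; have e2 := phiV w g wW Hg.
  have e3 := hg w wW; rewrite index_mem wW in e3.
  apply: (dvdzBr e1).
  rewrite (_ : _ + _ = (phi w g + phi w g^-1%g) - (phi w g - phi w h))%R; last by ring.
  exact: dvdzB.
- move=> j jW; apply/ker; first exact: nsgX.
  move=> w wW; rewrite -[x j ^+ _]/(zexp (x j) (Posz _)).
  apply: (dvdzBr (phiZ _ _ _ wW)).
  have e := (hx j).2 w wW; case: eqVneq e => [->|_] e; first exact: dvdz_mulr.
  by apply: dvdz_mull; rewrite subr0 in e.
- rewrite gammaS //; apply: nsgR_sub => g h; rewrite /gamma /= => Hg Hh.
  have Vg := nsgV Hg; have Vh := nsgV Hh.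
  have Hgh := nsgM Hg Hh; have HVgh := nsgM Vh Hgh.
  apply/ker; first exact: nsgM.
  move=> w wW; rewrite /commg /conjg.
  have e1 := phiD w _ _ wW Vg HVgh; have e2 := phiD w _ _ wW Vh Hgh.
  have e3 := phiD w _ _ wW Hg Hh; have e4 := phiV w g wW Hg; have e5 := phiV w h wW Hh.
  have := dvdzD (dvdzD (dvdzD (dvdzD e1 e2) e3) e4) e5.
  by congr (_ %| _)%Z; ring.
set o := fun j => d (nth i0 W j).
have quot (u v : useries) : divs (fun w => Posz (word_order o w)) 1 (val v - val u)%R ->
    nsg_set (uord o 1) (u^-1 * v).
  move=> uv; apply/ucongP; rewrite (_ : (_ - 1)%R = (val u^-1%g * (val v - val u))%R).
    exact: (divsM0_r (word_order_dvd o)).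
  by rewrite mulrBr useriesVl useriesM.
have ord1 j : word_order o [:: j] = o j by rewrite /= gcdn0.
split.
- move=> g h Hg Hh; apply: quot; case=> [_|j []] //; rewrite seriesB useriesM.
  move=> _; rewrite seriesM_cons !mkuseriesE seriesM_nil /shift /= mul1r mulr1 gcdn0.
  case: ifP => jW; last by rewrite addr0 subrr dvdz0.
  have := dvdzB (dvdz0 _) (phiD _ _ _ (memW _ jW) Hg Hh).
  by congr (_ %| _)%Z; ring.
- move=> g Dg; apply/ucongP; case=> [|j []] //; rewrite seriesB mkuseriesE series1 /=.
  move=> _; rewrite gcdn0 subr0; case: ifP => jW; last by rewrite dvdz0.
  by apply: (ker g (DH _ Dg)).1 => //; apply: memW.
move=> j jW; apply: quot; case=> [|i []] //; rewrite seriesB !mkuseriesE seriesD series1 /sX /=.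
move=> _; rewrite gcdn0 add0r eqseq_cons andbT.
case: ifP => iW.
  have := dvdzB (dvdz0 _) ((hx j).2 _ (memW _ iW)); rewrite nth_uniq //.
  by congr (_ %| _)%Z; ring.
have -> : (i == j) = false by apply: contraFF iW => /eqP ->.
by rewrite subrr dvdz0.
Qed.

(** * From coordinates to the direct sum of cyclic groups *)

Lemma isog_epi (F : groupType) (A B : nsubgroup F) (T : groupType) (f : F -> T) :
  (forall g h, nsg_set A g -> nsg_set A h -> f (g * h) = f g * f h) ->
  (forall g, nsg_set A g -> (f g = 1 <-> nsg_set B g)) ->
  (forall y, exists2 g, nsg_set A g & f g = y) ->
  isog (subquotg A B) T.
Proof.
move=> fM fker fonto.
have Av (x : sgtype A) : nsg_set A (val x) := set_mem (valP x).
pose h (q : subquotg A B) : T := f (val (repr q)).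
have valM (x y : sgtype A) : val (x * y) = val x * val y by exact: gmulfM.
have valV (x : sgtype A) : val x^-1 = (val x)^-1 by exact: gmulfV.
have feq (x y : sgtype A) : nsg_set B (val (x^-1 * y)) <-> f (val x) = f (val y).
  rewrite -(fker _ (Av _)) valM valV fM; [|exact/nsgV/Av|exact: Av].
  have fV : f (val x)^-1 = (f (val x))^-1.
    have h1 : f 1 = 1 by apply/(fker _ (nsg1 _))/nsg1.
    apply/esym/mulg1_eq; rewrite -fM ?mulgV //; exact/nsgV/Av.
  rewrite fV; split=> [E|->]; last by rewrite mulVg.
  by rewrite -[RHS](mulVKg (f (val x))) E mulg1.
have hE x : h (cosetg _ x) = f (val x).
  by apply/esym/feq; exact: (@cosetg_repr _ (nsg_restr A B) x).
have hM p q : h (p * q) = h p * h q.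
  have [x ->] := cosetg_surj p; have [y ->] := cosetg_surj q.
  by rewrite -cosetg_is_multiplicative !hE valM fM.
pose hm : {multiplicative subquotg A B -> T} :=
  HB.pack h (isMultiplicative.Build _ _ h hM).
exists hm.
have /boolp.choice [k hk] : forall y, exists q, h q = y.
  move=> y; have [g Ag <-] := fonto y.
  by exists (cosetg _ (Sub g (mem_set Ag) : sgtype A)); rewrite hE.
exists k => // q; have [x ->] := cosetg_surj q.
have [y yE] := cosetg_surj (k (h (cosetg _ x))).
rewrite [LHS]yE; apply/cosetgP; apply/feq.
by rewrite -hE -yE hk hE.
Qed.

Definition int_epi (A : groupType) (q : nat) (kap : int -> A) :=
  [/\ forall a b, kap (a + b)%R = kap a * kap b,
      forall a, kap a = 1 <-> (Posz q %| a)%Z &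
      forall y, exists a, kap a = y].

Lemma int_epi_Z : int_epi (A := Zgroup) 0 id.
Proof.
split=> // [a|y]; last by exists y.
by rewrite dvd0z; split=> [->|/eqP].
Qed.

Lemma int_epi_Zp q : (1 < q)%N -> int_epi (A := Zmodgroup q) q (fun a : int => (a%:~R : 'Z_q)%R).
Proof.
move=> q1; split=> [a b|a|y].
- exact: intrD.
- have E (k : nat) : ((k%:R : 'Z_q)%R = 0%R) <-> (q %| k)%N.
    split=> [/(congr1 val)|/dvdnP [c ->]].
      by rewrite /= val_Zp_nat // => h; apply/eqP.
    by apply: val_inj; rewrite /= val_Zp_nat // modnMl.
  rewrite -[1]/(0%R : 'Z_q); case: a => k.
    by rewrite dvdzE /= -E.
  rewrite NegzE mulrNz dvdzE /= -E; split=> [/eqP|k0]; first by rewrite oppr_eq0 => /eqP.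
  by apply/eqP; rewrite oppr_eq0; apply/eqP.
by exists (Posz (val y)); apply: natr_Zp.
Qed.

Section Target.
Context (F : groupType) (H : nsubgroup F) (I : eqType) (W : seq I) (uW : uniq W).
Context (d : I -> nat) (phi : I -> F -> int) (lev : I -> nat) (i0 : I).
Hypothesis phiD : forall w g h, w \in W -> nsg_set H g -> nsg_set H h ->
  (Posz (d w) %| (phi w (g * h)%g - (phi w g + phi w h))%R)%Z.

(* A is the direct sum of the cyclic groups Z/d(w) over the w in W with P w *)
Definition realizes (P : pred I) (A : groupType) := exists f : F -> A,
  [/\ forall g h, nsg_set H g -> nsg_set H h -> f (g * h) = f g * f h,
      forall h, nsg_set H h ->
        (f h = 1 <-> forall w, w \in W -> P w -> (Posz (d w) %| phi w h)%Z) &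
      forall a, exists s : I -> int, forall h, nsg_set H h ->
        (forall w, w \in W -> P w -> (Posz (d w) %| (phi w h - s w)%R)%Z) -> f h = a].

Lemma realizes_power (P : pred I) (A : groupType) q (kap : int -> A) k :
  int_epi q kap -> (forall w, w \in W -> P w -> d w = q) -> count P W = k ->
  realizes P (dpower A k).
Proof.
move=> [kapD kap1 kapS] dq <-.
set J := [seq w <- W | P w]; have sJ : size J = count P W by rewrite size_filter.
have memJ (i : 'I_(count P W)) : nth i0 J i \in W /\ P (nth i0 J i).
  have : nth i0 J i \in J by rewrite mem_nth // sJ.
  by rewrite mem_filter => /andP [].
have kapB a b : (Posz q %| (a - b)%R)%Z -> kap a = kap b.
  by move/kap1 => h; rewrite -(subrK b a) kapD h mul1g.
exists (fun h => [ffun i : 'I_(count P W) => kap (phi (nth i0 J i) h)]); split.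
- move=> g h Hg Hh; apply/ffunP => i.
  have [iW iP] := memJ i; rewrite !ffunE -kapD; apply: kapB.
  by rewrite -(dq _ iW iP); apply: phiD.
- move=> h Hh; split=> [/ffunP E w wW Pw|E].
    have wJ : w \in J by rewrite mem_filter Pw.
    have iw : (index w J < count P W)%N by rewrite -sJ index_mem.
    have := E (Ordinal iw); rewrite !ffunE /= nth_index // => /kap1.
    by rewrite (dq w).
  apply/ffunP => i; have [iW iP] := memJ i.
  by rewrite !ffunE; apply/kap1; rewrite -(dq _ iW iP); apply: E.
move=> a; have /boolp.choice [c hc] : forall i, exists z, kap z = a i by move=> i; apply: kapS.
exists (fun w => if insub (index w J) is Some i then c i else 0%R).
move=> h Hh E; apply/ffunP => i; have [iW iP] := memJ i.
rewrite ffunE -hc; apply: kapB; have := E _ iW iP.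
rewrite (dq _ iW iP) index_uniq ?sJ ?filter_uniq //.
by rewrite valK.
Qed.

Lemma realizes_sum (P Q : pred I) (A B : groupType) :
  (forall w, ~~ (P w && Q w)) ->
  realizes P A -> realizes Q B -> realizes (predU P Q) (dsum A B).
Proof.
move=> PQ [f [fM fk fs]] [g [gM gk gs]].
exists (fun h => (f h, g h)); split.
- by move=> a b Ha Hb; rewrite fM // gM.
- move=> h Hh; split=> [[/(fk _ Hh) f1 /(gk _ Hh) g1] w wW|E].
    by case/orP; [apply: f1|apply: g1].
  have -> : f h = 1 by apply/fk => // w wW Pw; apply: E => //; rewrite /= Pw.
  have -> : g h = 1 by apply/gk => // w wW Pw; apply: E => //; rewrite /= Pw orbT.
  by [].
case=> a b; have [s hs] := fs a; have [u hu] := gs b.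
exists (fun w => if P w then s w else u w) => h Hh E; congr pair.
  by apply: hs => // w wW Pw; have := E w wW; rewrite /= Pw; apply.
apply: hu => // w wW Qw; have := E w wW; rewrite /= Qw orbT.
by have := PQ w; rewrite Qw andbT => /negbTE ->; apply.
Qed.

Lemma realizes_ext (P Q : pred I) A : P =1 Q -> realizes P A -> realizes Q A.
Proof.
move=> PQ [f [fM fk fs]]; exists f; split=> // [h Hh|a].
  by rewrite fk //; split=> E w wW; [rewrite -PQ|rewrite PQ]; apply: E.
have [s hs] := fs a; exists s => h Hh E; apply: hs => // w wW; rewrite PQ; exact: E.
Qed.

(** Level 0 stands for Z and level i for order r_i. Only cumulative counts are assumed; each new
    level contributes the difference of two of them. *)
Lemma realizes_target (m t : nat) (r dd : nat -> nat) :
  (forall i, (1 <= i <= t)%N -> (1 < r i)%N) ->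
  (forall w, w \in W -> d w = if lev w == 0%N then 0%N else r (lev w)) ->
  (forall i, (i <= t)%N -> count (fun w => lev w <= i)%N W = dd (m + i)%N) ->
  realizes (fun w => lev w <= t)%N (target_group m t r dd).
Proof.
elim: t => [|t IH] r1 dE cE.
  apply: (realizes_power int_epi_Z).
    by move=> w wW; rewrite leqn0 dE // => ->.
  by rewrite cE // addn0.
rewrite /target_group -[t.+1]addn1 iotaD /= map_cat foldl_cat /=.
apply: (realizes_ext (P := predU (fun w => lev w <= t)%N (fun w => lev w == t.+1))).
  by move=> w /=; rewrite addn1 [RHS]leq_eqVlt orbC ltnS.
apply: realizes_sum.
- by move=> w; case: eqP => [->|]; rewrite ?andbF // ltnn.
- apply: IH => // [i it|i it]; first by apply: r1; lia.
  by apply: cE; lia.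
have r1' : (1 < r (1 + t))%N by apply: r1; lia.
apply: (realizes_power (int_epi_Zp r1')).
  by move=> w wW /eqP lw; rewrite dE // lw.
rewrite (_ : (m + (1 + t)).-1 = m + t)%N; last by lia.
rewrite -cE // -cE; last by lia.
have := count_predUI (fun w => lev w <= t)%N (fun w => lev w == t.+1) W.
rewrite [count (predI _ _) W](eq_count (a2 := pred0)); last first.
  by move=> w /=; case: eqP => [->|]; rewrite ?andbF // ltnn.
rewrite count_pred0 addn0 [count (predU _ _) W](eq_count (a2 := fun w => lev w <= 1 + t)%N).
  by move=> ->; rewrite addKn.
by move=> w /=; rewrite [RHS]leq_eqVlt orbC ltnS.
Qed.

End Target.

(** * The nilpotent product *)

(** A prime dividing i is at most n, so i is prime to r; and i C(r, i) = r C(r-1, i-1). *)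
Lemma divisible_bin n r : (forall p, prime p -> (p <= n)%N -> gcdn p r = 1%N) ->
  forall i, (0 < i <= n)%N -> (r %| 'C(r, i))%N.
Proof.
move=> cop i /andP [i0 iN].
have ci : coprime r i.
  rewrite /coprime; apply/eqP.
  have g0 : (0 < gcdn r i)%N by rewrite gcdn_gt0 i0 orbT.
  apply/eqP; rewrite eqn_leq g0 andbT leqNgt; apply/negP => g1.
  have pp := pdiv_prime g1; set p := pdiv _ in pp.
  have pr : (p %| r)%N := dvdn_trans (pdiv_dvd _) (dvdn_gcdl _ _).
  have pi : (p %| i)%N := dvdn_trans (pdiv_dvd _) (dvdn_gcdr _ _).
  have := cop p pp (leq_trans (dvdn_leq i0 pi) iN).
  by rewrite (gcdn_idPl pr) => p1; rewrite p1 in pp.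
case: i i0 {iN} ci => // i _ ci.
rewrite -(Gauss_dvdr _ ci) -mul_bin_diag; exact: dvdn_mulr.
Qed.

Lemma ugen_order (o : nat -> nat) n j : 
  (forall p, prime p -> (p <= n)%N -> gcdn p (o j) = 1%N) ->
  nsg_set (uord o n) (ugen j ^+ o j).
Proof.
move=> cop; apply/ucongP => v vn; rewrite seriesB ugenX_coef series1.
case: v vn => [|i v] vn; first by rewrite /= bin0 subrr dvdz0.
rewrite subr0; case: ifP => [vj|_]; last exact: dvdz0.
have ovj : (word_order o (i :: v) %| o j)%N.
  by move: vj => /= /andP [/eqP -> _]; apply: dvdn_gcdl.
rewrite natz dvdzE /=; apply: dvdn_trans ovj _.
exact: (divisible_bin cop).
Qed.

Lemma ulow_gamma l (p : useries) : nsg_set (gamma l.+1 (nsgT _)) p -> nsg_set (ulow l) p.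
Proof.
rewrite /gamma [l.+1.-1]/=.
elim: l p => [|l IH] p; first by move=> _; apply: ulow0.
rewrite nsgRnS; apply: nsgR_sub => x y /IH hx _.
by rewrite -[l]addn0; apply: ulow_comm => //; apply: ulow0.
Qed.

Lemma ulow_uord o n u : nsg_set (ulow n) u -> nsg_set (uord o n) u.
Proof. by move/ulowP => h; apply/ucongP => v vn; rewrite h ?dvdz0. Qed.

(** Transfers terms of the lower central series between groups with images in a common Q. It serves
    to kill gamma_(n+1)(P) among the truncated series and to place gamma_(n+1)(F) in R. *)
Lemma gamma_lift (A B Q : groupType) (f : {multiplicative A -> Q})
    (g : {multiplicative B -> Q}) l :
  (forall a, exists b, f a = g b) ->
  forall a, nsg_set (gamma l.+1 (nsgT A)) a ->
  exists2 b, nsg_set (gamma l.+1 (nsgT B)) b & f a = g b.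
Proof.
move=> fg; rewrite /gamma [l.+1.-1]/=.
elim: l => [|l IH] a; first by move=> _; have [b e] := fg a; exists b.
rewrite nsgRnS; elim=> {a} [_ [x Gx [y _ ->]]| |x y _ [x' Gx' ex] _ [y' Gy' ey]|x _ [x' Gx' ex]].
- have [x' Gx' ex] := IH x Gx; have [y' ey] := fg y.
  by exists [~ x', y']; [apply: nsgR_mem|rewrite !morR ex ey].
- by exists 1; [apply: nsg1|rewrite !mor1].
- by exists (x' * y'); [apply: nsgM|rewrite !gmulfM ex ey].
- by exists x'^-1; [apply: nsgV|rewrite !morV ex].
Qed.

Lemma free_product_ind (I : Type) (C : I -> groupType) (P : groupType)
    (inj : forall i, {multiplicative C i -> P}) (S : P -> Prop) :
  is_free_product inj -> S 1 -> (forall x y, S x -> S y -> S (x * y)) ->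
  (forall x, S x -> S x^-1) -> (forall i x, S (inj i x)) -> forall p, S p.
Proof.
move=> free S1 SM SV Si.
pose K : groupType := psg_of S1 SM SV.
pose j0 i (x : C i) : K := Sub (inj i x) (introT (asboolP _) (Si i x)).
have jM i : forall x y, j0 i (x * y) = j0 i x * j0 i y.
  by move=> x y; apply: val_inj; rewrite gmulfM !SubK gmulfM.
pose j i : {multiplicative C i -> K} := HB.pack (j0 i) (isMultiplicative.Build _ _ (j0 i) (jM i)).
have [g [gb _]] := free K j.
have [g0 [_ uniq]] := free P inj.
pose h : {multiplicative P -> P} := (val : K -> P) \o g.
have hb i x : h (inj i x) = inj i x by rewrite /h /= gb.
have E p : h p = p by rewrite (uniq h hb) -(uniq idfun).
move=> p; rewrite -(E p); exact: psgP.
Qed.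

Lemma cyclic_hom_Z (G : groupType) (a : G) :
  exists f : {multiplicative Zgroup -> G}, f (1%R : int) = a.
Proof.
pose f : Zgroup -> G := zexp a.
have M (x y : Zgroup) : f (x * y)%g = f x * f y by exact: (zexpD a x y).
pose fm : {multiplicative Zgroup -> G} := HB.pack f (isMultiplicative.Build _ _ f M).
by exists fm.
Qed.

Lemma cyclic_hom_Zp (G : groupType) (a : G) q : (1 < q)%N -> a ^+ q = 1 ->
  exists f : {multiplicative Zmodgroup q -> G}, f (1%R : 'Z_q) = a.
Proof.
move=> q1 aq.
have am k : a ^+ (k %% q) = a ^+ k.
  by rewrite {2}(divn_eq k q) expgnDr mulnC expgnA aq expg1n mul1g.
pose f (x : Zmodgroup q) := a ^+ (val (x : 'Z_q)).
have M (x y : Zmodgroup q) : f (x * y) = f x * f y.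
  rewrite /f -expgnDr -[RHS]am; congr (_ ^+ _).
  by rewrite -[X in _ = (_ %% X)%N](Zp_cast q1).
pose fm : {multiplicative Zmodgroup q -> G} := HB.pack f (isMultiplicative.Build _ _ f M).
exists fm.
rewrite /= /f; have -> : val (1%R : 'Z_q) = (1 %% q)%N.
  by rewrite -[X in _ = (_ %% X)%N](Zp_cast q1).
by rewrite am.
Qed.

Section FirstPresentation.
Context (n m t : nat) (r : nat -> nat).
Hypothesis r_gt1 : forall i : nat, (1 <= i <= t)%N -> (1 < r i)%N.
Hypothesis r_coprime : forall i p : nat, (1 <= i <= t)%N -> prime p -> (p <= n)%N ->
  gcdn p (r i) = 1%N.
Context (P : groupType) (inj : forall i : 'I_m + 'I_t, {multiplicative cyclic_family r i -> P}).
Hypothesis P_free : is_free_product inj.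
Context (F : groupType) (R : nsubgroup F).
Context (iso : {multiplicative quotg R -> nilpotent_product n P}).
Context (iso' : nilpotent_product n P -> quotg R).
Hypothesis isoK : cancel iso iso'.
Hypothesis isoK' : cancel iso' iso.

Definition level_order (l : nat) := if l == 0%N then 0%N else r l.
(** Letters count from 0: truncated subtraction sends the first m letters to level 0 and letter
    m+i-1 to level i. *)
Definition letter_order (j : nat) := level_order (j.+1 - m).

Definition cyclic_gen (i : 'I_m + 'I_t) : cyclic_family r i :=
  match i with inl _ => (1%R : int) | inr j => (1%R : 'Z_(r j.+1)) end.

Lemma cyclic_gen_order i : cyclic_gen i ^+ letter_order (unsplit i) = 1.
Proof.
case: i => [i|j] /=; rewrite /letter_order /level_order /=.
  by have /eqP -> : (i.+1 - m == 0)%N by rewrite subn_eq0.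
rewrite -addnS addKn /=.
have r1 : (1 < r j.+1)%N by apply: r_gt1; rewrite /= ltn_ord.
suff : ((r j.+1)%:R = 0 :> 'Z_(r j.+1))%R by [].
by apply: val_inj; rewrite /= val_Zp_nat // modnn.
Qed.

Lemma cyclic_gen_ind i (S : cyclic_family r i -> Prop) : S 1 ->
  (forall x y, S x -> S y -> S (x * y)) -> (forall x, S x -> S x^-1) ->
  S (cyclic_gen i) -> forall x, S x.
Proof.
move=> S1 SM SV Sg.
have SX k : S (cyclic_gen i ^+ k) by elim: k => // k IH; rewrite expgS; apply: SM.
case: i S S1 SM SV Sg SX => [i|j] S S1 SM SV Sg SX x.
  have E k : (cyclic_gen (inl i) ^+ k) = Posz k.
    by elim: k => [|k IH]; [|rewrite expgS IH]; exact: erefl.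
  case: x => k; first by rewrite -E.
  have -> : Negz k = (cyclic_gen (inl i) ^+ k.+1)^-1 by rewrite E.
  exact/SV/SX.
have -> : x = cyclic_gen (inr j) ^+ (val (x : 'Z_(r j.+1))).
  by rewrite -[LHS](natr_Zp (x : 'Z_(r j.+1))).
exact: SX.
Qed.

Lemma cyclic_hom (G : groupType) i (a : G) : a ^+ letter_order (unsplit i) = 1 ->
  exists f : {multiplicative cyclic_family r i -> G}, f (cyclic_gen i) = a.
Proof.
case: i => [i|j] ha; first exact: cyclic_hom_Z.
have r1 : (1 < r j.+1)%N by apply: r_gt1; rewrite /= ltn_ord.
apply: (cyclic_hom_Zp r1); move: ha.
by rewrite /letter_order /level_order /= -addnS addKn.
Qed.

Let k := (m + t)%N.
Let N := gamma n.+1 (nsgT P).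

Definition letter_gen (j : nat) : P :=
  if insub j is Some i then inj (split (i : 'I_(m + t))) (cyclic_gen (split i)) else 1.

Lemma letter_genE i : letter_gen (unsplit i) = inj i (cyclic_gen i).
Proof. by rewrite /letter_gen valK unsplitK. Qed.

Lemma letter_gen_order j : (j < k)%N -> letter_gen j ^+ letter_order j = 1.
Proof.
move=> jk; rewrite -[j]/(val (Ordinal jk)) -[Ordinal jk]splitK letter_genE.
by rewrite -morX cyclic_gen_order mor1.
Qed.

Lemma letter_gen_ind (S : P -> Prop) : S 1 ->
  (forall x y, S x -> S y -> S (x * y)) -> (forall x, S x -> S x^-1) ->
  (forall j, (j < k)%N -> S (letter_gen j)) -> forall p, S p.
Proof.
move=> S1 SM SV Sg; apply: (free_product_ind P_free) => // i.
apply: cyclic_gen_ind.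
- by rewrite mor1.
- by move=> x y; rewrite gmulfM; apply: SM.
- by move=> x; rewrite morV; apply: SV.
by rewrite -letter_genE; apply: Sg; apply: ltn_ord.
Qed.

Lemma letter_order_coprime j p : (j < k)%N -> prime p -> (p <= n)%N ->
  (j.+1 - m != 0)%N -> gcdn p (letter_order j) = 1%N.
Proof.
move=> jk pp pn j0; rewrite /letter_order /level_order (negbTE j0).
by apply: r_coprime => //; rewrite /k in jk; lia.
Qed.

Let p1 (x : F) : nilpotent_product n P := iso (cosetg R x).
Let p2 (x : P) : nilpotent_product n P := cosetg N x.

Lemma p1M x y : p1 (x * y) = p1 x * p1 y.
Proof. by rewrite /p1 cosetg_is_multiplicative gmulfM. Qed.

HB.instance Definition _ := isMultiplicative.Build F (nilpotent_product n P) p1 p1M.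

Lemma p2M x y : p2 (x * y) = p2 x * p2 y.
Proof. exact: cosetg_is_multiplicative. Qed.

HB.instance Definition _ := isMultiplicative.Build P (nilpotent_product n P) p2 p2M.

Lemma p1V x : p1 x^-1 = (p1 x)^-1. Proof. exact: (morV p1). Qed.
Lemma p2V x : p2 x^-1 = (p2 x)^-1. Proof. exact: (morV p2). Qed.
Lemma p1X x i : p1 (x ^+ i) = p1 x ^+ i. Proof. exact: (morX p1). Qed.
Lemma p2X x i : p2 (x ^+ i) = p2 x ^+ i. Proof. exact: (morX p2). Qed.

Lemma p1_ker x : p1 x = 1 <-> nsg_set R x.
Proof.
rewrite -cosetg_eq1 /p1; split=> [E|->]; last by rewrite mor1.
by apply: (can_inj isoK); rewrite E mor1.
Qed.

Lemma p1_onto q : exists x, p1 x = q.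
Proof.
have [x xE] := cosetg_surj (iso' q).
by exists x; rewrite /p1 -xE isoK'.
Qed.

Lemma p2_ker x : p2 x = 1 <-> nsg_set N x.
Proof. exact: cosetg_eq1. Qed.

Lemma p2_onto q : exists x, p2 x = q.
Proof. by have [x xE] := cosetg_surj q; exists x. Qed.

Lemma presented_nilpotent_product : presented (nsgT F) R n k letter_order.
Proof.
have p12 x : exists y, p1 x = p2 y by have [y yE] := p2_onto (p1 x); exists y.
have /boolp.choice [x hx] : forall j, exists x, p1 x = p2 (letter_gen j).
  by move=> j; apply: p1_onto.
have [g gE] : exists g : {multiplicative P -> quotg (uord letter_order n)},
    forall j, (j < k)%N -> g (letter_gen j) = cosetg _ (ugen j).
  have ex i : exists f : {multiplicative cyclic_family r i -> quotg (uord letter_order n)},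
      f (cyclic_gen i) = cosetg _ (ugen (unsplit i)).
    apply: cyclic_hom; rewrite -morX; apply/cosetg_eq1.
    have [j0|j0] := eqVneq ((unsplit i).+1 - m)%N 0%N.
      by rewrite /letter_order j0; apply: nsg1.
    by apply: ugen_order => p pp pn; apply: letter_order_coprime.
  have [g [gi _]] := P_free (fun i => projT1 (cid (ex i))).
  exists g => j jk; rewrite -[j]/(val (Ordinal jk)) -[Ordinal jk]splitK letter_genE gi.
  exact: projT2 (cid (ex _)).
(* Hence g depends only on the image in the nilpotent product, and [th] can be defined on F by
   passing through any element of P with the same image. *)
have gN p : nsg_set N p -> g p = 1.
  move=> Np; have gl a : exists b, g a = cosetg (uord letter_order n) b.
    exact: cosetg_surj.
  have [u Gu ->] := gamma_lift gl Np.
  by apply/cosetg_eq1/ulow_uord/ulow_gamma.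
have p2g a a' : p2 a = p2 a' -> g a = g a'.
  move=> E; apply: (@mulIg _ (g a'^-1)); rewrite -!gmulfM mulgV mor1.
  by apply/gN/p2_ker; rewrite p2M E -p2M mulgV; apply: mor1.
have /boolp.choice [s hs] : forall y : F, exists a, p1 y = p2 a := p12.
pose th y := repr (g (s y)).
have thE y : cosetg _ (th y) = g (s y) by rewrite /cosetg /th reprK.
have thp y a : p1 y = p2 a -> cosetg _ (th y) = g a.
  by move=> E; rewrite thE; apply: p2g; rewrite -hs.
exists x, th; split=> //.
(* The letters generate P, not F, so the induction runs over an element p of P with the same image
   as h. *)
- move=> h _; have [p] := p12 h; elim/letter_gen_ind: p h => [|a b IHa IHb|a IHa|j jk] h E.
  + by apply: gen_mem; right; apply/p1_ker; rewrite E; apply: mor1.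
  + have [y ya] := p1_onto (p2 a).
    rewrite -(mulVKg y h); apply: gen_mul; first exact: IHa.
    by apply: IHb; rewrite p1M p1V E p2M ya mulKg.
  + by rewrite -[h]invgK; apply/gen_inv/IHa; rewrite p1V E p2V invgK.
  rewrite -(mulVKg (x j) h); apply: gen_mul; apply: gen_mem.
    by left; exists j.
  by right; apply/p1_ker; rewrite p1M p1V E hx mulVg.
- by move=> j jk; apply/p1_ker; rewrite p1X hx -p2X letter_gen_order //.
- move=> y Gy; have [p Np E] := gamma_lift p12 Gy.
  by apply/p1_ker; rewrite E; apply/p2_ker.
split.
- move=> y z _ _; apply/cosetgP; rewrite cosetg_is_multiplicative.
  rewrite (thp y (s y)) ?hs // (thp z (s z)) ?hs // -gmulfM.
  by apply: thp; rewrite p1M p2M !hs.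
- by move=> y /p1_ker E; apply/cosetg_eq1; rewrite (thp _ 1) ?mor1.
- by move=> j jk; apply/cosetgP; rewrite (thp _ _ (hx j)) gE.
Qed.

End FirstPresentation.

(** * Iteration *)

Definition word_level (lev : nat -> nat) (w : seq nat) := foldr (fun j l => maxn (lev j) l) 0%N w.

Lemma word_level_le lev w i : (word_level lev w <= i)%N = all (fun j => lev j <= i)%N w.
Proof. by elim: w => //= j w IH; rewrite geq_max IH. Qed.

Section Levels.
Context (t : nat) (r : nat -> nat).
Hypothesis r_dvd : forall i : nat, (1 <= i <= t - 1)%N -> (r i.+1 %| r i)%N.

Lemma level_order_dvd i j : (i <= j <= t)%N -> (level_order r j %| level_order r i)%N.
Proof.
case/andP; elim: j => [|j IH]; first by rewrite leqn0 => /eqP ->.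
rewrite leq_eqVlt => /orP [/eqP -> //|ij] jt.
apply: dvdn_trans (IH ij (ltnW jt)); rewrite /level_order /=.
by case: eqP => [//|j0]; apply: r_dvd; lia.
Qed.

Definition leveled (I : eqType) (W : seq I) (d lev N : _ -> nat) :=
  (forall w, w \in W -> (lev w <= t)%N /\ d w = level_order r (lev w)) /\
  forall i, (i <= t)%N -> count (fun w => lev w <= i)%N W = N i.

(** Orders decrease along divisibility as the level grows, so the gcd is the order at the maximal
    level; level 0, of order 0, is neutral for the gcd. *)
Lemma word_order_level o lev w : w != [::] ->
  (forall j, j \in w -> (lev j <= t)%N /\ o j = level_order r (lev j)) ->
  word_order o w = level_order r (word_level lev w).
Proof.
elim: w => // j w IH _ h; have [jt oj] := h j (mem_head _ _).
have hw i : i \in w -> (lev i <= t)%N /\ o i = level_order r (lev i).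
  by move=> iw; apply: h; rewrite inE iw orbT.
have [->|w0] := eqVneq w [::]; first by rewrite /= gcdn0 maxn0.
have wt : (word_level lev w <= t)%N.
  by rewrite word_level_le; apply/allP => i /hw [].
rewrite /= IH // oj -/(word_level lev w).
have [le|/ltnW le] := leqP (word_level lev w) (lev j).
  by apply/gcdn_idPl/level_order_dvd; rewrite le.
by apply/gcdn_idPr/level_order_dvd; rewrite le.
Qed.

(** A word has level at most i exactly when all its letters do, so the cumulative counts are numbers
    of Lyndon words on N i letters. *)
Lemma leveled_lyn c n k (o lev N : nat -> nat) : leveled (iota 0 k) o lev N ->
  leveled (lyn_range c n k) (word_order o) (word_level lev)
    (fun i => \sum_(1 <= j < n.+1) chi (c + j) (N i))%N.
Proof.
move=> [hk hN]; split=> [w|i it].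
  rewrite mem_lyn_range => /and3P [Lw _ kw].
  have hw j : j \in w -> (lev j <= t)%N /\ o j = level_order r (lev j).
    by move=> jw; apply: hk; rewrite mem_iota; apply: (allP kw).
  split; last exact: word_order_level (lyndon_neq0 Lw) hw.
  by rewrite word_level_le; apply/allP => j /hw [].
rewrite /lyn_range count_flatten -map_comp sumnE big_map.
rewrite /index_iota subn1 /= -[c.+1]addn1 iotaDl big_map.
rewrite big_seq [RHS]big_seq; apply: eq_bigr => l; rewrite mem_iota => /andP [l0 _] /=.
rewrite -(hN i it) -size_filter -[in RHS]size_filter.
rewrite -size_lyn ?filter_uniq ?iota_uniq //; last by lia.
apply: perm_size; apply: uniq_perm.
- by rewrite !filter_uniq ?uniq_words ?iota_uniq.
- by rewrite filter_uniq ?uniq_words ?filter_uniq ?iota_uniq.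
move=> w; rewrite mem_filter !mem_lyn word_level_le.
rewrite andbCA; congr (_ && _); rewrite andbCA; congr (_ && _).
by rewrite -all_predI; apply: eq_all => j; rewrite /= mem_filter.
Qed.

Lemma leveled_nth (I : eqType) (i0 : I) (W : seq I) (d lev : I -> nat) N :
  leveled W d lev N ->
  leveled (iota 0 (size W)) (fun j => d (nth i0 W j)) (fun j => lev (nth i0 W j)) N.
Proof.
move=> [hW hN]; split=> [j|i it].
  by rewrite mem_iota => jW; apply/hW/mem_nth.
rewrite -hN // -[in RHS](mkseq_nth i0 W) /mkseq count_map.
by apply: eq_count.
Qed.

(** The iteration after the first class entry. The assumption H <= R persists, since H only shrinks,
    and lets the base case ignore the intersection with R. *)
Lemma multiplier_coordinatized (F : groupType) (X : Type) (b : X -> F)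
    (R H D : nsubgroup F) (m : nat) (dd : nat -> nat) (cs : seq nat)
    (I : eqType) (i0 : I) (W : seq I) (d lev : I -> nat) N :
  is_free_basis b -> (forall i : nat, (1 <= i <= t)%N -> (1 < r i)%N) ->
  (forall c, c \in cs -> (1 <= c)%N) ->
  nsg_set D `<=` nsg_set H -> nsg_set H `<=` nsg_set R -> uniq W ->
  coordinatized H D W d -> leveled W d lev N ->
  (forall i, (i <= t)%N -> dd (m + i)%N = foldl (fun x c => chi c.+1 x) (N i) cs) ->
  isog (subquotg (nsgI R (foldl (fun H c => gamma c.+1 H) H cs)) (poly_comm_rec H D cs))
    (target_group m t r dd).
Proof.
move=> free r1; elim: cs I i0 W d lev N H D => [|c cs IH] I i0 W d lev N H D cs1 DH HR uW cW lW ddE.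
  have [phi [phiD ker onto]] := cW; have [hW hN] := lW.
  have [||f [fM fk fs]] := realizes_target uW i0 phiD r1 (lev := lev) (m := m) (dd := dd).
  - by move=> w wW; case: (hW w wW).
  - by move=> i it; rewrite hN // ddE.
  apply: (isog_epi (f := f)) => /=.
  - by move=> g h [_ Hg] [_ Hh]; apply: fM.
  - move=> g [_ Hg]; rewrite fk // ker //; split=> E w wW; last by move=> _; apply: E.
    by apply: E => //; case: (hW w wW).
  move=> y; have [s hs] := fs y; have [g Hg hg] := onto s.
  by exists g; [split=> //; apply: HR|apply: hs => // w wW _; apply: hg].
(* H/D is abelian here, so the step applies with n = 1 and needs only c >= 1. *)
have c1 : (0 < 1 <= c)%N by apply: cs1; rewrite inE eqxx.
apply: (IH _ [::] (lyn_range c 1 (size W)) _ _ _ (gamma c.+1 H) (nsgRn c H D)).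
- by move=> c' c'cs; apply: cs1; rewrite inE c'cs orbT.
- by apply: nsgRn_mono.
- by apply: subset_trans HR; apply: gamma_sub.
- exact: uniq_lyn_range.
- exact: coordinatized_step free DH c1 (presented_coordinatized i0 DH uW cW).
- exact: leveled_lyn (leveled_nth i0 lW).
by move=> i it; rewrite ddE //= big_nat1 addn1.
Qed.

End Levels.

Lemma count_ltn_iota a b : (a <= b)%N -> count (fun j => j < a)%N (iota 0 b) = a.
Proof.
move=> ab; rewrite -(subnKC ab) iotaD count_cat add0n.
rewrite (@eq_in_count _ _ predT); last by move=> j; rewrite mem_iota => /andP [_ ->].
rewrite count_predT size_iota (@eq_in_count _ _ pred0) ?count_pred0 ?addn0 //.
by move=> j; rewrite mem_iota => /andP [aj _]; rewrite /= ltnNge aj.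
Qed.

Theorem theorem3p4 (n m t : nat) (r : nat -> nat)
    (n_ge1 : (1 <= n)%N) (t_ge1 : (1 <= t)%N)
    (r_gt1 : forall i : nat, (1 <= i <= t)%N -> (1 < r i)%N)
    (r_dvd : forall i : nat, (1 <= i <= t - 1)%N -> (r i.+1 %| r i)%N)
    (r_coprime : forall p : nat, prime p -> (p <= n)%N -> gcdn p (r 1%N) = 1%N)
    (* class row (c1, cs) *)
    (c1 : nat) (cs : seq nat)
    (c1_ge : (n <= c1)%N) (cs_ge1 : forall c : nat, c \in cs -> (1 <= c)%N)
    (* the free product P of the m + t cyclic groups *)
    (P : groupType)
    (inj : forall i : 'I_m + 'I_t, {multiplicative cyclic_family r i -> P})
    (P_free_product : is_free_product inj)
    (* a free presentation F / R of the n-th nilpotent product *)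
    (F : groupType) (X : Type) (b : X -> F) (F_free : is_free_basis b)
    (R : nsubgroup F) (FR_iso : isog (quotg R) (nilpotent_product n P)) :
  isog (polynilpotent_multiplier R (c1 :: cs))
       (target_group m t r (mult_rank n c1 cs)).
Proof.
have [iso [iso' isoK isoK']] := FR_iso.
have cop i p : (1 <= i <= t)%N -> prime p -> (p <= n)%N -> gcdn p (r i) = 1%N.
  move=> it pp pn; apply/eqP; rewrite -dvdn1 -(r_coprime p pp pn) dvdn_gcd dvdn_gcdl /=.
  apply: dvdn_trans (dvdn_gcdr _ _) _.
  have := level_order_dvd r_dvd (i := 1) (j := i) it.
  by rewrite /level_order /=; case: i it.
have pres := presented_nilpotent_product r_gt1 cop P_free_product isoK isoK'.
have RT : nsg_set R `<=` nsg_set (nsgT F) by [].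
have n_c : (0 < n <= c1)%N by rewrite n_ge1.
(* The entry c1 is consumed by [coordinatized_step] for the nilpotent product itself. Exactly m+i
   letters have level at most i, hence N is [addn m]. *)
apply: (multiplier_coordinatized (m := m) r_dvd [::] F_free r_gt1 cs_ge1 _ _ _
   (coordinatized_step F_free RT n_c pres)
   (leveled_lyn (N := addn m) (lev := fun j => (j.+1 - m)%N) r_dvd c1 n _)).
- exact: nsgRn_mono.
(* By c1 >= n, gamma_(c1+1)(F) lies in gamma_(n+1)(F), hence in R. *)
- have [x [th [_ _ _ cls _]]] := pres.
  by apply: subset_trans cls; apply: gamma_le.
- exact: uniq_lyn_range.
- split=> [j|i it].
    by rewrite mem_iota => jk; split=> //; lia.
  rewrite -(count_ltn_iota (a := m + i) (b := m + t)) ?leq_add2l //.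
  by apply: eq_count => j /=; lia.
by move=> i it.
Qed.
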